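(* Let $\mathcal{H}$ be a complex Hilbert space and $T\in\boldsymbol{B}(\mathcal{H})$. Then the following conditions are equivalent: (i) $T$ is a subnormal contraction; (ii) $T$ is a CPD contraction; (iii) $T$ is CPD and the telescopic series $\sum_{n=0}^\infty\big(\|T^{n+1}h\|^2-\|T^nh\|^2\big)$ is convergent in $\mathbb{R}$ for every $h\in\mathcal{H}$; (iv) $T$ is CPD and $\lim_{n\to\infty}(\|T^{n+1}h\|^2-\|T^nh\|^2)=0$ for every $h\in\mathcal{H}$; (v) there exist operators $B,C\in\boldsymbol{B}(\mathcal{H})$ and a compactly supported semispectral measure $F\colon\mathfrak{B}(\mathbb{R}_+)\to\boldsymbol{B}(\mathcal{H})$ such that $B=B^*$, $C\geq0$, $F(\{1\})=0$ and $$T^{*n}T^n=I+nB+n^2C+\int_{\mathbb{R}_+}Q_n(x)\,F(\mathrm{d}x),\quad n\in\mathbb{Z}_+,$$ with $C=0$, $D=0$, $F([1,\infty))=0$ and $\frac{1}{(1-x)^2}\in L^1(F)$, where $D:=B+\int_{[0,1)}\frac{1}{1-x}\,F(\mathrm{d}x)$ (or, equivalently, all of this holds with ''$\frac{1}{1-x}\in L^1(F)$'' in place of ''$\frac{1}{(1-x)^2}\in L^1(F)$''); (vi) there exists a semispectral measure $F\colon\mathfrak{B}(\mathbb{R}_+)\to\boldsymbol{B}(\mathcal{H})$ such that $F([1,\infty))=0$, $\frac{1}{1-x}\in L^1(F)$ and $$T^{*n}T^n=I-\int_{[0,1)}\frac{1-x^n}{(1-x)^2}\,F(\mathrm{d}x),\quad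 n\in\mathbb{Z}_+.$$
   Context: $\boldsymbol{B}(\mathcal{H})$ is the algebra of bounded linear operators on $\mathcal{H}$; $\mathbb{Z}_+=\{0,1,2,\ldots\}$, $\mathbb{R}_+=[0,\infty)$; $\mathfrak{B}(\mathbb{R}_+)$ is the Borel $\sigma$-algebra. A contraction is an operator with $\|T\|\leq1$. $T\in\boldsymbol{B}(\mathcal{H})$ is subnormal if there are a complex Hilbert space $\mathcal{K}\supseteq\mathcal{H}$ (isometric embedding) and a normal operator $N\in\boldsymbol{B}(\mathcal{K})$ with $Th=Nh$ for all $h\in\mathcal{H}$. A real sequence $\{\gamma_n\}_{n=0}^\infty$ is conditionally positive definite (CPD) if $\sum_{i,j=0}^k \gamma_{i+j}\lambda_i\bar\lambda_j\geq 0$ for all finite complex sequences $\lambda_0,\ldots,\lambda_k$ with $\sum_{i=0}^k\lambda_i=0$. $T\in\boldsymbol{B}(\mathcal{H})$ is CPD if $\{\|T^nh\|^2\}_{n=0}^\infty$ is CPD for every $h\in\mathcal{H}$. A semispectral measure $F\colon\mathfrak{B}(\mathbb{R}_+)\to\boldsymbol{B}(\mathcal{H})$ is a map that is $\sigma$-additive in the weak operator topology with $F(\Delta)\geq0$ for all $\Delta$ (no normalization). $L^1(F)$ is the space of complex Borel $\zeta$ with $\int|\zeta(x)|\langle F(\mathrm{d}x)h,h\rangle<\infty$ for all $h$; $\int\zeta\,\mathrm{d}F$ is the unique bounded operator with $\langle(\int\zeta\,\mathrm{d}F)h,h\rangle=\int\zeta(x)\langle F(\mathrm{d}x)h,h\rangle$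 for all $h$. (If $\frac{1}{(1-x)^2}\in L^1(F)$, then $\frac{1}{1-x}\in L^1(F)$, so $D$ in (v) makes sense.) The polynomials $Q_n$ are $Q_0=Q_1=0$ and $Q_n(x)=\sum_{j=0}^{n-2}(n-j-1)x^j$ for $n\geq2$. *)

(* Defs.v *)
From HB Require Import structures.
From mathcomp Require Import all_boot all_order all_algebra complex.
From mathcomp Require Import all_classical all_reals all_analysis.

Set Implicit Arguments.
Unset Strict Implicit.
Unset Printing Implicit Defensive.

Import Order.TTheory GRing.Theory Num.Theory.
Import numFieldNormedType.Exports.

Local Open Scope classical_set_scope.
Local Open Scope ring_scope.

(* Complex Hilbert spaces.  The inner product is linear in its first argument. *)
HB.mixin Record isHilbert (R : realType) H & CompleteNormedModule R[i] H := {
  inner : H -> H -> R[i] ;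
  inner_linear : forall z, linear_for *%R (inner ^~ z) ;
  inner_conj : forall x y, inner x y = (inner y x)^* ;
  inner_norm : forall x, inner x x = `|x| ^+ 2
}.

#[short(type="hilbertType")]
HB.structure Definition Hilbert (R : realType) :=
  {H of isHilbert R H & CompleteNormedModule R[i] H}.

(* The library norm of a vector space over R[i] takes its values in R[i]. *)
Definition rnorm (R : realType) (H : hilbertType R) (h : H) : R :=
  complex.Re `|h|.

(* The algebra B(H). *)
Record bop (R : realType) (H : hilbertType R) := BOp {
  bop_fun :> {linear H -> H} ;
  bop_bounded : bounded_near bop_fun (nbhs (0 : H))
}.

Section Operators.
Variables (R : realType) (H : hilbertType R).

Lemma bop0_bounded : bounded_near (\0 : {linear H -> H}) (nbhs (0 : H)).
Proof.
by apply/linear_boundedP; near=> r => x /=; rewrite normr0 mulr_ge0.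
Unshelve. all: by end_near. Qed.

Definition bop0 : bop H := BOp bop0_bounded.

HB.instance Definition _ := gen_eqMixin (bop H).
HB.instance Definition _ := gen_choiceMixin (bop H).
HB.instance Definition _ := isPointed.Build (bop H) bop0.

Definition opnorm (T : bop H) : R :=
  sup [set rnorm (T h) | h in [set h : H | rnorm h <= 1]].

Definition contraction_op (T : bop H) := opnorm T <= 1.

(* Existence is the Riesz representation theorem; uniqueness holds because
   the inner product is nondegenerate. *)
Definition adj (T : bop H) : bop H :=
  get [set S : bop H | forall x y, inner (T x) y = inner x (S y)].

Definition normal_op (T : bop H) := forall h, adj T (T h) = T (adj T h).

Definition selfadjoint (T : bop H) := adj T =1 T.

(* In the order of R[i], 0 <= z means that z is real and nonnegative. *)
Definition pos_op (T : bop H) := forall h, 0 <= inner (T h) h.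

End Operators.

Definition subnormal (R : realType) (H : hilbertType R) (T : bop H) :=
  exists (K : hilbertType R) (J : {linear H -> K}) (N : bop K),
    [/\ forall h, `|J h| = `|h|, normal_op N & forall h, J (T h) = N (J h)].

Definition cpd_seq (R : realType) (gamma : nat -> R) :=
  forall (k : nat) (lambda : 'I_k.+1 -> R[i]), \sum_i lambda i = 0 ->
    0 <= \sum_(i < k.+1) \sum_(j < k.+1)
      (gamma (i + j)%N)%:C%C * lambda i * (lambda j)^*.

Definition cpd_op (R : realType) (H : hilbertType R) (T : bop H) :=
  forall h, cpd_seq (fun n => rnorm (iter n T h) ^+ 2).

Definition Rplus (R : realType) : set R := `[0, +oo[.
Arguments Rplus R : clear implicits.

(* Only the values of F on Borel subsets of Rplus are meaningful.  The
   sigma-additivity is the one for the weak operator topology; R[i]^o is R[i]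
   with its usual topology. *)
Record semispectral (R : realType) (H : hilbertType R) := Semispectral {
  ssm :> set R -> bop H ;
  ssm_ge0 : forall D : set R, measurable D -> D `<=` Rplus R ->
    pos_op (ssm D) ;
  ssm_sigma_additive : forall A : (set R)^nat,
    (forall i, measurable (A i)) -> (forall i, A i `<=` Rplus R) ->
    trivIset setT A -> forall g h : H,
    (fun n => \sum_(0 <= i < n) inner (ssm (A i) g) h : R[i]^o) @ \oo -->
      (inner (ssm (\bigcup_i A i) g) h : R[i]^o)
}.

Section Semispectral.
Variables (R : realType) (H : hilbertType R) (F : semispectral H).

(* The scalar measure <F(.)h, h>, extended by 0 to the negative half-line (and
   set to 0 on non-Borel sets, as a measure must be nonnegative everywhere). *)
Definition ssm_scalar (h : H) (D : set (measurableTypeR R)) : \bar R :=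
  if `[< measurable D >]
  then (complex.Re (inner (F (D `&` Rplus R) h) h))%:E else 0%E.

Section ScalarMeasure.
Variable h : H.

Let Rplus_measurable : measurable (Rplus R).
Proof. exact: measurable_itv. Qed.

Let cvg_Re (u : nat -> R[i]) (l : R[i]) :
  (u : nat -> R[i]^o) @ \oo --> (l : R[i]^o) ->
  (fun n => complex.Re (u n)) @ \oo --> complex.Re l.
Proof.
move=> /cvgrPdist_lt ul; apply/cvgrPdist_lt => e e0.
have e0' : (0 : R[i]) < e%:C%C by rewrite ltcR.
have := ul _ e0'; apply: filterS => n /=.
rewrite -raddfB /= -ltcR; apply: le_lt_trans.
exact: normc_ge_Re.
Qed.

Let ssm_scalarE (D : set (measurableTypeR R)) : measurable D ->
  ssm_scalar h D = (complex.Re (inner (F (D `&` Rplus R) h) h))%:E.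
Proof. by move=> mD; rewrite /ssm_scalar asboolT. Qed.

Let ssm_scalar_ge0 D : (0 <= ssm_scalar h D)%E.
Proof.
rewrite /ssm_scalar; case: ifPn => // /asboolP mD; rewrite lee_fin.
have : 0 <= inner (F (D `&` Rplus R) h) h.
  by apply: ssm_ge0 => //; exact: measurableI.
by rewrite lecE => /andP[].
Qed.

Let ssm_scalar_sigma_additive : semi_sigma_additive (ssm_scalar h).
Proof.
move=> A mA tA mUA.
have mAR i  : measurable (A i `&` Rplus R : set R).
  exact: (measurableI _ _ (mA i) Rplus_measurable).
have AR i : A i `&` Rplus R `<=` Rplus R by exact: subIsetr.
have tAR : trivIset setT (fun i => A i `&` Rplus R) by exact: trivIset_setIr.
have /cvg_Re ReA := @ssm_sigma_additive _ _ F _ mAR AR tAR h h.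
rewrite ssm_scalarE// setI_bigcupl.
apply: cvg_EFin.
  by near=> n; rewrite sum_fin_num; apply/allP => x /mapP[i _ ->]; rewrite ssm_scalarE.
apply: cvg_trans ReA; apply: near_eq_cvg; near=> n => /=.
rewrite raddf_sum/= (eq_bigr _ (fun i _ => ssm_scalarE (mA i))).
by rewrite sumEFin.
Unshelve. all: by end_near. Qed.

Let ssm_scalar0 : ssm_scalar h set0 = 0%E.
Proof.
rewrite ssm_scalarE// set0I.
pose A0 (_ : nat) : set R := set0.
have m0 i : measurable (A0 i) by exact: measurable0.
have s0 (i : nat) : A0 i `<=` Rplus R by [].
have := @ssm_sigma_additive _ _ F _ m0 s0 (@trivIset_set0 _ _ _) h h.
rewrite bigcup0// => /cvg_Re.
set c := complex.Re _; set u := (fun n => complex.Re _) => uc.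
have uS n : u n.+1 - u n = c.
  by rewrite /u big_nat_recr//= raddfD /= addrC addKr.
have uSc : (fun n => u n.+1) @ \oo --> c by rewrite (cvg_shiftS u (nbhs c)).
have : (fun n => u n.+1 - u n) @ \oo --> c - c by exact: cvgB.
under eq_fun do rewrite uS; rewrite subrr => c0.
suff -> : c = 0 by [].
by rewrite -(cvg_lim (@Rhausdorff R) c0) lim_cst.
Qed.

HB.instance Definition _ := isMeasure.Build _ _ _ (ssm_scalar h)
  ssm_scalar0 ssm_scalar_ge0 ssm_scalar_sigma_additive.

End ScalarMeasure.

(* The real-valued elements of L^1(F), the only ones needed. *)
Definition L1 (zeta : R -> R) :=
  forall h, (ssm_scalar h).-integrable (Rplus R) (EFin \o zeta).

(* The operator integral of zeta over the Borel set D; it exists, and is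
   unique by polarization, if zeta is in L1. *)
Definition opint (D : set R) (zeta : R -> R) : bop H :=
  get [set S : bop H |
    forall h, inner (S h) h = (\int[ssm_scalar h]_(x in D) zeta x)%:C%C].

(* The closed support, as a subset of Rplus. *)
Definition ssm_support : set R :=
  [set x | Rplus R x /\
           forall U, open_nbhs x U -> ~ (F (U `&` Rplus R) =1 \0)].

End Semispectral.

(* For n <= 1 the sum is empty; otherwise j runs up to n - 2. *)
Definition Qpoly (R : realType) (n : nat) : {poly R} :=
  \sum_(j < n.-1) (n - j - 1)%:R *: 'X^j.

(* Main.v *)
(* Write g_n = |T^n h|^2 and let L be the functional x^n |-> g_n on polynomials.

   If g is CPD with first differences tending to 0, then L(q^2) >= 0 whenever
   q(1) = 0, so that n |-> L(x^n (1-x)^(2m+1)) decreases to 0 and is nonnegative: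
   L is nonnegative on all x^i (1-x)^j.  The second differences L((1-x)^2 x^k)
   are then the moments of a measure on [0,1) (Hausdorff), which depends on h as
   a bounded quadratic form and thus is <F(.)h, h>.  The integral of 1/(1-x) is
   L(1-x) by monotone convergence, and (1-x)^2 Q_n = x^n - 1 - n(x-1) gives (v)
   with B = T^*T - I and C = 0.  Both representations are linked by
   Q_n(x) = n/(1-x) - (1-x^n)/(1-x)^2.

   Conversely (vi) reads L(p) = p(1)|h|^2 + \int (p(x)-p(1))/(1-x)^2, so that L
   is again nonnegative on all x^i (1-x)^j.  Approximation by Bernstein
   polynomials turns this into Embry's condition, which implies the
   Bram-Halmos condition, and the normal extension lives on the completion of the
   finitely supported sequences in H for the Bram-Halmos form. *)
Require Import Defs.
From HB Require Import structures.
From mathcomp Require Import all_boot all_order all_algebra complex finmap.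
From mathcomp Require Import all_classical all_reals all_analysis measurable_realfun.
From mathcomp Require Import ring lra zify.

Set Implicit Arguments.
Unset Strict Implicit.
Unset Printing Implicit Defensive.

Import Order.TTheory GRing.Theory Num.Theory.
Import numFieldNormedType.Exports.
Local Open Scope classical_set_scope.
Local Open Scope ring_scope.
Import ComplexField.Normc.

(** * Semi-inner products *)

(** Nothing operator-valued is built directly. Measures, tails and integrals are constructed for one
    vector at a time, and what is carried along is that they are quadratic in the vector: [isquad]
    survives sums and limits along any proper filter, and [quad_bop] turns a bounded quadratic form
    into an operator. Boundedness is the delicate point, because 1/(1-x) is unbounded near 1 and
    each vector comes only with its own finite integral; a uniform boundedness principle
    ([isquad_sup_bounded]) supplies a common constant.

    Bernstein polynomials are used only through moments. That of x^m has degree at most m whatever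
    its order and converges to x^m coefficientwise, so every linear functional on polynomials passes
    to the limit. Inequalities between polynomials become membership in the cone [bcone], which is
    checked by algebra.

    The Bram-Halmos form is shown positive for every weight in [bcone]: weight 1 gives the inner
    product of the extension space, weight 1-x gives the contractivity that lets the extension act
    on the completion. *)

Section ComplexFacts.
Variable R : realType.
Implicit Types z w : R[i].

Lemma normc_normE z : `|z| = (normc z)%:C%C.
Proof. by rewrite normc_def; case: z. Qed.

Lemma cReM z w : complex.Re (z * w) =
  complex.Re z * complex.Re w - complex.Im z * complex.Im w.
Proof. by case: z; case: w. Qed.

Lemma cImM z w : complex.Im (z * w) =
  complex.Re z * complex.Im w + complex.Im z * complex.Re w.
Proof. by case: z; case: w. Qed.

Lemma cReD z w : complex.Re (z + w) = complex.Re z + complex.Re w.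
Proof. by case: z; case: w. Qed.

Lemma cImD z w : complex.Im (z + w) = complex.Im z + complex.Im w.
Proof. by case: z; case: w. Qed.

Lemma cReB z w : complex.Re (z - w) = complex.Re z - complex.Re w.
Proof. by case: z; case: w. Qed.

Lemma cImB z w : complex.Im (z - w) = complex.Im z - complex.Im w.
Proof. by case: z; case: w. Qed.

Lemma cReJ z : complex.Re z^* = complex.Re z.
Proof. by case: z. Qed.

Lemma cImJ z : complex.Im z^* = - complex.Im z.
Proof. by case: z. Qed.

Lemma complex_eq z w : complex.Re z = complex.Re w ->
  complex.Im z = complex.Im w -> z = w.
Proof. by case: z; case: w => a b c d /= -> ->. Qed.

Lemma normc_sqr z : normc z ^+ 2 = complex.Re z ^+ 2 + complex.Im z ^+ 2.
Proof. by case: z => a b /=; rewrite sqr_sqrtr// addr_ge0// sqr_ge0. Qed.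

Lemma normc_ge0 z : 0 <= normc z.
Proof. by case: z => a b; exact: sqrtr_ge0. Qed.

End ComplexFacts.

Lemma cvgr_sum (R : realType) (I J : Type) (F : set_system I) (FF : Filter F)
    (r : seq J) (P : pred J) (f : J -> I -> R) (l : J -> R) :
  (forall j, f j @ F --> l j) ->
  (fun i => \sum_(j <- r | P j) f j i) @ F --> \sum_(j <- r | P j) l j.
Proof.
move=> fl; elim: r => [|j r IH].
  by under eq_fun do rewrite big_nil; rewrite big_nil; exact: cvg_cst.
under eq_fun do rewrite big_cons; rewrite big_cons.
by case: (P j) => //; apply: cvgD.
Qed.

(** Degenerate forms are allowed, so that the same lemmas serve [H] itself ([hsip]), the Bram-Halmos
    form on finitely supported sequences ([bsip]) and the completion ([ksip]). *)
Record sip (R : realType) (V : lmodType R[i]) := Sip {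
  sip_fun :> V -> V -> R[i] ;
  sip_linear : forall z, linear_for *%R (sip_fun ^~ z) ;
  sip_conj : forall x y, sip_fun x y = (sip_fun y x)^* ;
  sip_ge0 : forall x, 0 <= sip_fun x x }.

Lemma discriminant_le (R : realFieldType) (a b c : R) :
  (forall x y, 0 <= x ^+ 2 * a + 2 * x * y * b + y ^+ 2 * c) -> b ^+ 2 <= a * c.
Proof.
move=> H; have a0 : 0 <= a by have := H 1 0; lra.
have c0 : 0 <= c by have := H 0 1; lra.
(* The first two instances evaluate to [c * (a * c - b ^+ 2)] and [a * (a * c - b ^+ 2)]; the third
   settles [a = c = 0], where it reads [0 <= - 2 * b ^+ 2]. *)
have h1 := H c (- b); have h2 := H (- b) a; have h3 := H 1 (- b).
have [cp|cn] := ltP 0 c.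
  rewrite -subr_ge0 -(pmulr_rge0 _ cp); lra.
have [ap|an] := ltP 0 a.
  rewrite -subr_ge0 -(pmulr_rge0 _ ap); lra.
have -> : a = 0 by lra.
move: h3; have -> : a = 0 by lra.
have -> : c = 0 by lra.
by lra.
Qed.

Section SemiInner.
Variables (R : realType) (V : lmodType R[i]) (s : sip V).
Implicit Types u v w : V.

(** The real part determines the whole form ([sip_rip]), so that estimates and limits can take place
    in [R] instead of [R[i]]. *)
Definition rip u v : R := complex.Re (s u v).
Definition snorm u : R := Num.sqrt (rip u u).

Lemma sipDl u v w : s (u + v) w = s u w + s v w.
Proof. by have := sip_linear s w 1 u v; rewrite scale1r mul1r. Qed.

Lemma sip0l w : s 0 w = 0.
Proof. by apply: (addrI (s 0 w)); rewrite -sipDl !addr0. Qed.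

Lemma sipZl a u w : s (a *: u) w = a * s u w.
Proof. by have := sip_linear s w a u 0; rewrite sip0l !addr0. Qed.

Lemma sipDr u v w : s u (v + w) = s u v + s u w.
Proof. by rewrite sip_conj sipDl rmorphD /= -!sip_conj. Qed.

Lemma sipZr a u w : s u (a *: w) = a^* * s u w.
Proof. by rewrite sip_conj sipZl rmorphM /= -sip_conj. Qed.

Lemma sipNl u v : s (- u) v = - s u v.
Proof. by rewrite -scaleN1r sipZl mulN1r. Qed.

Lemma sip_rip u v : s u v = (rip u v +i* rip u ('i%C *: v))%C.
Proof.
rewrite /rip sipZr cReM cReJ cImJ /= mul0r sub0r mulN1r opprK.
by case: (s u v).
Qed.

Lemma ripC u v : rip u v = rip v u.
Proof. by rewrite /rip sip_conj cReJ. Qed.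

Lemma ripDl u v w : rip (u + v) w = rip u w + rip v w.
Proof. by rewrite /rip sipDl raddfD. Qed.

Lemma ripDr u v w : rip u (v + w) = rip u v + rip u w.
Proof. by rewrite ripC ripDl !(ripC u). Qed.

Lemma ripZl a u w : rip (a%:C%C *: u) w = a * rip u w.
Proof. by rewrite /rip sipZl cReM /= mul0r subr0. Qed.

Lemma ripZr a u w : rip u (a%:C%C *: w) = a * rip u w.
Proof. by rewrite ripC ripZl ripC. Qed.

Lemma ripNl u w : rip (- u) w = - rip u w.
Proof. by rewrite /rip sipNl raddfN. Qed.

Lemma ripNr u w : rip u (- w) = - rip u w.
Proof. by rewrite ripC ripNl ripC. Qed.

Lemma rip0l w : rip 0 w = 0.
Proof. by rewrite /rip sip0l. Qed.

Lemma rip_ge0 u : 0 <= rip u u.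
Proof. by have := sip_ge0 s u; rewrite lecE => /andP[]. Qed.

Lemma ripZZ a u v : rip (a *: u) (a *: v) = normc a ^+ 2 * rip u v.
Proof.
rewrite /rip sipZl sipZr mulrA !cReM cImM cReJ cImJ normc_sqr; ring.
Qed.

Lemma rip_il u v : rip ('i%C *: u) v = - rip u ('i%C *: v).
Proof. by rewrite /rip sipZl sipZr !cReM cReJ cImJ /=; ring. Qed.

Lemma ripM u v : rip u v ^+ 2 <= rip u u * rip v v.
Proof.
apply: discriminant_le => x y.
have := rip_ge0 (x%:C%C *: u + y%:C%C *: v).
rewrite !(ripDl, ripDr, ripZl, ripZr) (ripC v u); lra.
Qed.

Lemma snorm_ge0 u : 0 <= snorm u. Proof. exact: sqrtr_ge0. Qed.

Lemma snorm_sqr u : snorm u ^+ 2 = rip u u.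
Proof. by rewrite sqr_sqrtr// rip_ge0. Qed.

Lemma rip_le u v : `|rip u v| <= snorm u * snorm v.
Proof.
rewrite -(@ler_pXn2r _ 2)// ?nnegrE ?mulr_ge0 ?snorm_ge0//.
by rewrite exprMn !snorm_sqr -normrX ger0_norm ?sqr_ge0// ripM.
Qed.

Lemma snormD u v : snorm (u + v) <= snorm u + snorm v.
Proof.
rewrite -(@ler_pXn2r _ 2)// ?nnegrE ?addr_ge0 ?snorm_ge0//.
rewrite sqrrD !snorm_sqr !(ripDl, ripDr) (ripC v u).
have := rip_le u v; have := ler_norm (rip u v); lra.
Qed.

Lemma snormZ a u : snorm (a *: u) = normc a * snorm u.
Proof.
rewrite /snorm ripZZ sqrtrM ?sqr_ge0// sqrtr_sqr ger0_norm// normc_ge0//.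
Qed.

Lemma snormN u : snorm (- u) = snorm u.
Proof. by rewrite /snorm ripNl ripNr opprK. Qed.

Lemma snorm0 : snorm 0 = 0.
Proof. by rewrite /snorm rip0l sqrtr0. Qed.

Lemma snormB u v : snorm (u - v) = snorm (v - u).
Proof. by rewrite -opprB snormN. Qed.

Lemma snorm_sip u : s u u = (snorm u ^+ 2)%:C%C.
Proof.
rewrite snorm_sqr /rip; have := sip_ge0 s u; rewrite lecE.
by case: (s u u) => a b /= /andP[/eqP->].
Qed.

(** A rotation reduces this to the real inequality [rip_le]: the real product of [z^* *: u] with [v]
    is [normc z ^+ 2]. *)
Lemma sip_le u v : normc (s u v) <= snorm u * snorm v.
Proof.
set z := s u v; have [->|z0] := eqVneq z 0.
  by rewrite normc0 mulr_ge0 ?snorm_ge0.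
have nz0 : 0 < normc z.
  by rewrite lt_def normc_ge0 andbT; apply: contra_neq z0; exact: eq0_normc.
rewrite -(ler_pM2l nz0) -expr2.
have -> : normc z ^+ 2 = rip (z^* *: u) v.
  by rewrite /rip sipZl -/z cReM cReJ cImJ normc_sqr; ring.
apply: le_trans (ler_norm _) _; apply: le_trans (rip_le _ _) _.
rewrite snormZ mulrA ler_wpM2r ?snorm_ge0// ler_wpM2r ?snorm_ge0//.
by rewrite -ler_sqr ?nnegrE ?normc_ge0// !normc_sqr cReJ cImJ sqrrN.
Qed.

End SemiInner.

Section HilbertFacts.
Variables (R : realType) (H : hilbertType R).
Implicit Types g h : H.

Lemma inner_ge0 h : 0 <= inner h h.
Proof. by rewrite inner_norm exprn_ge0. Qed.

Definition hsip : sip H := Sip (@inner_linear R H) (@inner_conj R H) inner_ge0.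

Lemma inner_rip g h :
  inner g h = (rip hsip g h +i* rip hsip g ('i%C *: h))%C.
Proof. exact: (sip_rip hsip). Qed.

Lemma norm_rnorm h : `|h| = (rnorm h)%:C%C.
Proof.
have : 0 <= `|h| by [].
by rewrite lecE /rnorm; case: `|h| => a b /= /andP[/eqP->].
Qed.

Lemma rnorm_ge0 h : 0 <= rnorm h.
Proof. by have : 0 <= `|h| by []; rewrite norm_rnorm lecR. Qed.

Lemma rnormE h : rnorm h = snorm hsip h.
Proof.
rewrite /snorm /rip /= inner_norm norm_rnorm.
by rewrite -rmorphXn /= sqrtr_sqr ger0_norm// rnorm_ge0.
Qed.

Lemma rnorm_eq0 h : rnorm h = 0 -> h = 0.
Proof. by move=> h0; apply/normr0_eq0; rewrite norm_rnorm h0. Qed.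

Lemma rip_eq0 h : rip hsip h h = 0 -> h = 0.
Proof. by move=> h0; apply: rnorm_eq0; rewrite rnormE /snorm h0 sqrtr0. Qed.

Lemma rip_inj g h : (forall x, rip hsip g x = rip hsip h x) -> g = h.
Proof.
move=> gh; apply/eqP; rewrite -subr_eq0; apply/eqP/rip_eq0.
by rewrite {1}ripDl ripNl gh subrr.
Qed.

(** The balls of [H] have radii in [R[i]]; a positive element of [R[i]] is real, which brings
    completeness down to real radii. *)
Lemma rnorm_complete (u : nat -> H) :
  (forall e : R, 0 < e -> exists N, forall m n, (N <= m)%N -> (N <= n)%N ->
     rnorm (u m - u n) < e) ->
  exists l, (fun n => rnorm (u n - l)) @ \oo --> (0 : R).
Proof.
move=> uC.
have : cvg (u @ \oo).
  apply: cauchy_cvg; apply/cauchy_exP => e e0.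
  move: e0; case: e => e e' /[dup] + /=; rewrite {1}ltcE /= => /andP[/eqP-> e0] _.
  have [N uN] := uC e e0.
  exists (u N); exists N => // n /= Nn.
  by rewrite -ball_normE /= norm_rnorm ltcR; exact: uN.
move=> /cvgrPdist_lt ul; exists (limn u).
apply/cvgrPdist_lt => e e0.
have e0' : (0 : R[i]) < e%:C%C by rewrite ltcR.
have := ul _ e0'; apply: filterS => n.
rewrite norm_rnorm ltcR sub0r normrN ger0_norm ?rnorm_ge0//.
by rewrite !rnormE snormB.
Qed.

End HilbertFacts.

(** * Quadratic forms and bounded operators *)

Section QuadraticForms.
Variables (R : realType) (V : lmodType R[i]).
Implicit Types (Q : V -> R) (g h : V).

(* By polarization, the quadratic forms of the Hermitian sesquilinear forms;
   unlike the latter, these conditions pass to pointwise limits at sight. *)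
Definition isquad Q :=
  (forall (r : R) h h' g,
    Q (r%:C%C *: h + h' + g) - Q (r%:C%C *: h + h' - g) =
    r * (Q (h + g) - Q (h - g)) + (Q (h' + g) - Q (h' - g))) /\
  (forall c h, Q (c *: h) = normc c ^+ 2 * Q h).

(** This is the real part of the Hermitian form with diagonal [Q]; its imaginary part is
    [polar Q h ('i%C *: g)], in accordance with [sip_rip]. *)
Definition polar Q h g : R := (Q (h + g) - Q (h - g)) / 4.

Section Polar.
Variable Q : V -> R.
Hypothesis Qq : isquad Q.

Lemma isquad0 : Q 0 = 0.
Proof. by rewrite -(scale0r 0) Qq.2 normc0 expr0n /= mul0r. Qed.

Lemma isquadN h : Q (- h) = Q h.
Proof. by rewrite -scaleN1r Qq.2 normcN normc1 expr1n mul1r. Qed.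

Lemma polarPl (r : R) h h' g :
  polar Q (r%:C%C *: h + h') g = r * polar Q h g + polar Q h' g.
Proof. by rewrite /polar Qq.1; ring. Qed.

Lemma polarC h g : polar Q h g = polar Q g h.
Proof. by rewrite /polar -(isquadN (h - g)) opprB (addrC h g). Qed.

Lemma polarPr (r : R) h h' g :
  polar Q g (r%:C%C *: h + h') = r * polar Q g h + polar Q g h'.
Proof. by rewrite polarC polarPl !(polarC _ g). Qed.

Lemma polarxx h : polar Q h h = Q h.
Proof.
rewrite /polar subrr isquad0 -mulr2n -scaler_nat Qq.2 subr0.
have -> : (2 : R[i]) = (2 : R)%:C%C by rewrite rmorph_nat.
by rewrite /= expr0n addr0 sqrtr_sqr ger0_norm//; field.
Qed.

Lemma isquad_i h : Q ('i%C *: h) = Q h.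
Proof. by rewrite Qq.2 normc_sqr /=; ring. Qed.

Lemma polar_il h g : polar Q ('i%C *: h) g = - polar Q h ('i%C *: g).
Proof.
have ii : 'i%C * 'i%C = - 1 :> R[i] by rewrite -expr2 sqr_i.
have H1 : Q ('i%C *: h + g) = Q (h - 'i%C *: g).
  by rewrite -(isquad_i (h - _)) scalerBr scalerA ii scaleN1r opprK.
have H2 : Q ('i%C *: h - g) = Q (h + 'i%C *: g).
  by rewrite -(isquad_i (h + _)) scalerDr scalerA ii scaleN1r.
by rewrite /polar H1 H2; ring.
Qed.

Lemma polar_i h : polar Q h ('i%C *: h) = 0.
Proof.
rewrite /polar; have -> : h + 'i%C *: h = (1 + 'i%C) *: h by rewrite scalerDl scale1r.
have -> : h - 'i%C *: h = (1 - 'i%C) *: h by rewrite scalerBl scale1r.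
by rewrite !Qq.2 !normc_sqr /=; field.
Qed.

Lemma isquadD h g : Q (h + g) = Q h + 2 * polar Q h g + Q g.
Proof.
rewrite -[LHS]polarxx.
have := polarPl 1 h g (h + g); rewrite scale1r => ->.
have := polarPr 1 h g h; rewrite scale1r => ->.
have := polarPr 1 h g g; rewrite scale1r => ->.
by rewrite !polarxx (polarC g h); ring.
Qed.

Lemma isquad_parallelogram h g : Q (h + g) + Q (h - g) = 2 * Q h + 2 * Q g.
Proof.
rewrite !isquadD isquadN.
have := polarPr (-1) g 0 h.
rewrite rmorphN1 scaleN1r addr0 => ->.
have -> : polar Q h 0 = 0 by rewrite /polar addr0 subr0 subrr mul0r.
by ring.
Qed.

End Polar.

(** The filter is arbitrary because limits are taken both along [\oo] and along the ultrafilter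
    [ultra_nat]. *)
Lemma isquad_cvg (I : Type) (F : set_system I) (FF : ProperFilter F)
    (q : I -> V -> R) Q : (forall i, isquad (q i)) ->
  (forall h, q ^~ h @ F --> Q h) -> isquad Q.
Proof.
move=> qq qQ; split=> [r h h' g|c h].
  pose A i : R := q i (r%:C%C *: h + h' + g) - q i (r%:C%C *: h + h' - g).
  have A1 : A @ F --> Q (r%:C%C *: h + h' + g) - Q (r%:C%C *: h + h' - g).
    by apply: cvgB; exact: qQ.
  apply: (cvg_unique (@Rhausdorff R) A1).
  have -> : A = fun i => r * (q i (h + g) - q i (h - g)) +
      (q i (h' + g) - q i (h' - g)) by apply/funext => i; exact: (qq i).1.
  by apply: cvgD; [apply: cvgMl_tmp; apply: cvgB|apply: cvgB]; exact: qQ.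
apply: (cvg_unique (@Rhausdorff R) (qQ _)).
rewrite (_ : q ^~ (c *: h) = fun i => normc c ^+ 2 * q i h).
  by apply: cvgMl_tmp; exact: qQ.
by apply/funext => i; exact: (qq i).2.
Qed.

Lemma isquadDZ (a b : R) Q Q' : isquad Q -> isquad Q' ->
  isquad (fun h => a * Q h + b * Q' h).
Proof.
move=> q q'; split=> [r h h' g|c h].
  pose u := r%:C%C *: h + h' + g; pose v := r%:C%C *: h + h' - g.
  rewrite -/u -/v (_ : _ - _ = a * (Q u - Q v) + b * (Q' u - Q' v)); last by ring.
  by rewrite q.1 q'.1; ring.
by rewrite q.2 q'.2; ring.
Qed.

Lemma isquad_cst0 : isquad (fun=> 0).
Proof. by split=> [r h h' g|c h]; ring. Qed.

Lemma isquad_sum (I : Type) (r : seq I) (P : pred I) (a : I -> R)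
    (q : I -> V -> R) : (forall i, isquad (q i)) ->
  isquad (fun h => \sum_(i <- r | P i) a i * q i h).
Proof.
move=> qq; elim: r => [|i r IH].
  by under eq_fun do rewrite big_nil; exact: isquad_cst0.
under eq_fun do rewrite big_cons.
case: (P i) => //; have := isquadDZ (a i) 1 (qq i) IH.
by under eq_fun do rewrite mul1r.
Qed.

Lemma isquad_sip (s : sip V) (T : {linear V -> V}) : isquad (fun h => rip s (T h) h).
Proof.
split=> [r h h' g|c h]; last by rewrite linearZ ripZZ.
rewrite !linearD !linearN !linearZ /= !(ripDl, ripDr, ripZl, ripZr, ripNl, ripNr).
by ring.
Qed.

Lemma isquad_ripT (s : sip V) (T : {linear V -> V}) :
  isquad (fun h => rip s (T h) (T h)).
Proof.
split=> [r h h' g|c h]; last by rewrite linearZ ripZZ.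
rewrite !linearD !linearN !linearZ /= !(ripDl, ripDr, ripZl, ripZr, ripNl, ripNr).
by ring.
Qed.

End QuadraticForms.

(** * Riesz representation: from bounded forms to operators *)

Section Riesz.
Variables (R : realType) (H : hilbertType R).
Local Notation rp := (rip (@hsip R H)).
Implicit Types g h : H.

Lemma cvg_ripl (u : nat -> H) l g : (fun n => rnorm (u n - l)) @ \oo --> (0 : R) ->
  (fun n => rp (u n) g) @ \oo --> rp l g.
Proof.
move=> ul; apply/cvgrPdist_le => e e0.
have e1 : 0 < e / (rnorm g + 1).
  by rewrite divr_gt0// ltr_wpDl// rnorm_ge0.
move/cvgrPdist_lt : ul => /(_ _ e1); apply: filterS => n.
rewrite sub0r normrN ger0_norm ?rnorm_ge0// => un.
rewrite -ripNl -ripDl; apply: le_trans (rip_le _ _ _) _.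
rewrite snormB -!rnormE.
rewrite -[leRHS](@divfK _ (rnorm g + 1)); last first.
  by rewrite gt_eqF// ltr_wpDl// rnorm_ge0.
by apply: ler_pM; rewrite ?rnorm_ge0// ?lerDl ?ltW.
Qed.

Lemma ripZ1_scale (l : H -> R) (M : R) :
  (forall (r : R) g h, l (r%:C%C *: g + h) = r * l g + l h) ->
  (forall g, rnorm g <= 1 -> `|l g| <= M) ->
  forall g, `|l g| <= M * rnorm g.
Proof.
move=> lin bd g; have l0 : l 0 = 0.
  by have := lin 1 0 0; rewrite scale1r addr0 mul1r; lra.
have [g0|g0] := eqVneq (rnorm g) 0.
  by rewrite (rnorm_eq0 g0) l0 normr0 -(rnorm_eq0 g0) g0 mulr0.
have gp : 0 < rnorm g by rewrite lt_def g0 rnorm_ge0.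
have lZ r : l (r%:C%C *: g) = r * l g by have := lin r g 0; rewrite addr0 l0 addr0.
have := bd ((rnorm g)^-1%:C%C *: g).
rewrite {1}rnormE snormZ -rnormE /= expr0n addr0 sqrtr_sqr normfV.
rewrite ger0_norm ?rnorm_ge0// mulVf// lexx => /(_ isT).
rewrite lZ normrM normfV (ger0_norm (rnorm_ge0 g)) mulrC ler_pdivrMr//.
Qed.

(** The representing vector minimizes the energy [rp g g - 2 * l g], which is bounded below by
    [- M ^+ 2]. The parallelogram law makes minimizing sequences Cauchy, and the vanishing first
    variation at the minimum is the claim. *)
Lemma riesz (l : H -> R) (M : R) :
  (forall (r : R) g h, l (r%:C%C *: g + h) = r * l g + l h) ->
  (forall g, rnorm g <= 1 -> `|l g| <= M) ->
  exists y, forall g, rp g y = l g.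
Proof.
move=> lin /(ripZ1_scale lin) bd.
have l0 : l 0 = 0.
  by have := lin 1 0 0; rewrite scale1r addr0 mul1r; lra.
pose J g := rp g g - 2 * l g.
have JM g : - M ^+ 2 <= J g.
  rewrite /J -snorm_sqr -rnormE; have := bd g; have := ler_norm (l g).
  have := sqr_ge0 (rnorm g - M); rewrite sqrrB; lra.
have Jnz : has_inf (range J).
  by split; [exists (J 0), 0|exists (- M ^+ 2) => _ [g _ <-]].
pose d := inf (range J).
have dJ g : d <= J g by apply: ge_inf; [exact: Jnz.2|exists g].
have /choice[u uP] (n : nat) : exists g, J g < d + n.+1%:R^-1.
  have e0 : (0 : R) < n.+1%:R^-1 by rewrite invr_gt0.
  by have [_ [g _ <-] ?] := inf_adherent e0 Jnz; exists g.
have [|y uy] := @rnorm_complete _ _ u.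
  (* Comparison with the midpoint gives |u_m - u_n|^2 = 2 J(u_m) + 2 J(u_n) - 4 J(mid) < 2/(m+1) +
     2/(n+1), hence the tolerance [e ^+ 2 / 4] for each reciprocal. *)
  move=> e e0; have e4 : 0 < e ^+ 2 / 4 by rewrite divr_gt0// exprn_gt0.
  have [N _ NP] := near_infty_natSinv_lt (PosNum e4).
  exists N => m n Nm Nn.
  have := NP _ Nm; have := NP _ Nn => /= n4 m4.
  rewrite -(@ltr_pXn2r _ 2)// ?nnegrE ?rnorm_ge0 ?ltW//.
  rewrite rnormE snorm_sqr.
  have := dJ ((2^-1 : R)%:C%C *: u m + (2^-1 : R)%:C%C *: u n + 0).
  have := uP m; have := uP n; rewrite /J addr0 lin.
  rewrite -[X in _ + l X](addr0 (_ *: u n)) lin l0.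
  rewrite !(ripDl, ripDr, ripZl, ripZr, ripNl, ripNr).
  rewrite (ripC _ (u n) (u m)).
  by move: n4 m4; set a := n.+1%:R^-1; set b := m.+1%:R^-1; lra.
exists y => g.
have key t : 0 <= 2 * t * (rp y g - l g) + t ^+ 2 * rp g g.
  have lim : (fun n => 2 * t * (rp (u n) g - l g) + t ^+ 2 * rp g g + n.+1%:R^-1)
      @ \oo --> 2 * t * (rp y g - l g) + t ^+ 2 * rp g g + 0.
    apply: cvgD; last exact: cvg_harmonic.
    apply: cvgD; last exact: cvg_cst.
    apply: cvgMl_tmp; apply: cvgB; last exact: cvg_cst.
    exact: cvg_ripl.
  rewrite -[leRHS]addr0; apply: (cvgr_to_ge lim); near=> n.
  have := dJ (t%:C%C *: g + u n); have := uP n; set e := n.+1%:R^-1.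
  rewrite /J lin !(ripDl, ripDr, ripZl, ripZr) (ripC _ g (u n)); lra.
have gg := rip_ge0 (@hsip R H) g.
rewrite ripC; apply/eqP; rewrite -subr_eq0; apply/eqP.
set a := _ - _ in key *; set b := rp g g in key gg.
have [b0|b0] := eqVneq b 0.
  by have := key 1; have := key (-1); rewrite b0; lra.
have bp : 0 < b by rewrite lt_def b0.
(* The quadratic polynomial 2ta + t^2 b in t has its minimum here, with value -a^2/b. *)
have := key (- a / b).
have -> : 2 * (- a / b) * a + (- a / b) ^+ 2 * b = - (a ^+ 2 / b) by field.
rewrite oppr_ge0 pmulr_lle0 ?invr_gt0// => a2.
by apply/eqP; rewrite -sqrf_eq0 eq_le a2 sqr_ge0.
Unshelve. all: by end_near. Qed.

(** Riesz in the second variable gives [S g]. The condition on ['i%C], which mirrors [rip_il], says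
    that [b] is the real part of a sesquilinear form; it is what makes [S] complex-linear and not
    only real-linear. *)
Lemma form_bop (b : H -> H -> R) (M : R) :
  (forall (r : R) g g' h, b (r%:C%C *: g + g') h = r * b g h + b g' h) ->
  (forall (r : R) g g' h, b h (r%:C%C *: g + g') = r * b h g + b h g') ->
  (forall g h, b ('i%C *: g) h = - b g ('i%C *: h)) ->
  (forall g h, rnorm g <= 1 -> rnorm h <= 1 -> `|b g h| <= M) ->
  exists S : bop H, forall g h, rp (S g) h = b g h.
Proof.
move=> bl br bi bM.
have bM' g h : rnorm h <= 1 -> `|b g h| <= M * rnorm g.
  move=> h1; apply: (@ripZ1_scale (b ^~ h)) => [r x y|x x1]; first exact: bl.
  exact: bM.
have /choice[S SP] g : exists y, forall h, rp h y = b g h.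
  by apply: (@riesz (b g) (M * rnorm g)) => [r x y|x]; [exact: br|exact: bM'].
have SP' g h : rp (S g) h = b g h by rewrite ripC SP.
have b0 h : b 0 h = 0.
  by have := bl 1 0 0 h; rewrite scale1r addr0 mul1r; lra.
have bZ r g h : b (r%:C%C *: g) h = r * b g h.
  by have := bl r g 0 h; rewrite b0 !addr0.
have SD g h : S (g + h) = S g + S h.
  apply: rip_inj => x; rewrite ripDl !SP'.
  by have := bl 1 g h x; rewrite scale1r mul1r.
have SZ c g : S (c *: g) = c *: S g.
  apply: rip_inj => x.
  have cE (y : H) : c *: y = (complex.Re c)%:C%C *: y + (complex.Im c)%:C%C *: ('i%C *: y).
    by rewrite scalerA -scalerDl [in LHS](complexE c) mulrC.
  rewrite SP' (cE g) bl bZ bi -!SP'.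
  by rewrite [in RHS]cE !(ripDl, ripZl) rip_il.
have Slin : linear S by move=> c g h; rewrite SD SZ.
pose SL : {linear H -> H} := HB.pack S (GRing.isLinear.Build _ _ _ _ S Slin).
have SB : bounded_near SL (nbhs (0 : H)).
  apply/bounded_funP => r.
  exists (`|M| * complex.Re r)%:C%C => h; rewrite !norm_rnorm.
  rewrite lecE /= => /andP[/eqP r0 hr].
  rewrite lecR.
  have [->|S0] := eqVneq (rnorm (S h)) 0.
    by rewrite mulr_ge0// (le_trans _ hr)// rnorm_ge0.
  have Sp : 0 < rnorm (S h) by rewrite lt_def S0 rnorm_ge0.
  (* Tested against the unit vector along [S h], the form returns [rnorm (S h)] itself. *)
  have := bM' h ((rnorm (S h))^-1%:C%C *: S h).
  rewrite {1}rnormE snormZ -rnormE /= expr0n addr0 sqrtr_sqr normfV.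
  rewrite ger0_norm ?rnorm_ge0// mulVf// lexx => /(_ isT).
  rewrite -SP' ripZr -snorm_sqr -rnormE expr2 mulrA mulVf// mul1r.
  rewrite ger0_norm ?rnorm_ge0// => /le_trans; apply.
  by apply: (le_trans (ler_wpM2r (rnorm_ge0 h) (ler_norm M))); exact: ler_wpM2l.
by exists (BOp SB).
Qed.

(** By the parallelogram law |g+h|^2 + |g-h|^2 is at most 4 on the unit ball, which cancels the 4 in
    [polar]. *)
Lemma polar_le1 (Q : H -> R) (M : R) g h : (forall h, `|Q h| <= M * rnorm h ^+ 2) ->
  rnorm g <= 1 -> rnorm h <= 1 -> `|polar Q g h| <= `|M|.
Proof.
move=> QM g1 h1; rewrite /polar.
have p : rnorm (g + h) ^+ 2 + rnorm (g - h) ^+ 2 =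
    2 * rnorm g ^+ 2 + 2 * rnorm h ^+ 2.
  rewrite !rnormE !snorm_sqr !(ripDl, ripDr, ripNl, ripNr).
  by rewrite (ripC _ h g); ring.
have M0 : M * rnorm (g + h) ^+ 2 + M * rnorm (g - h) ^+ 2 <= 4 * `|M|.
  rewrite -mulrDr p -mulrDr mulrA (le_trans (ler_norm _))//.
  rewrite !normrM (ger0_norm (_ : 0 <= 2))// (mulrC 4) -mulrA ler_wpM2l//.
  rewrite ger0_norm ?addr_ge0 ?sqr_ge0//.
  by have := exprn_ile1 2 (rnorm_ge0 g) g1; have := exprn_ile1 2 (rnorm_ge0 h) h1; lra.
rewrite normrM (@ger0_norm _ 4^-1)// ler_pdivrMr// (mulrC _ 4).
apply: le_trans M0; apply: le_trans (ler_normB _ _) _.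
by apply: lerD; exact: QM.
Qed.

Lemma polar_le (Q : H -> R) (M : R) g h : isquad Q ->
  (forall h, `|Q h| <= M * rnorm h ^+ 2) ->
  `|polar Q g h| <= `|M| * rnorm g * rnorm h.
Proof.
move=> q QM; apply: (@ripZ1_scale (polar Q g)) => [r x y|x x1].
  exact: polarPr.
apply: (@ripZ1_scale (polar Q ^~ x)) => [r y z|y y1]; first exact: polarPl.
exact: polar_le1.
Qed.

(** The passage from forms to operators: the values of [F], the operator integrals and [B] are all
    obtained here from scalar data. *)
Lemma quad_bop (Q : H -> R) (M : R) : isquad Q ->
  (forall h, `|Q h| <= M * rnorm h ^+ 2) ->
  exists S : bop H, (forall g h, rp (S g) h = polar Q g h) /\
    forall h, inner (S h) h = (Q h)%:C%C.
Proof.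
move=> q QM.
have [||||S SP] := @form_bop (polar Q) `|M|.
- by move=> *; exact: polarPl.
- by move=> *; exact: polarPr.
- by move=> *; exact: polar_il.
- by move=> g h; exact: polar_le1.
by exists S; split=> // h; rewrite inner_rip !SP polarxx// polar_i.
Qed.

Lemma bop_le (T : bop H) :
  exists2 r, 0 <= r & forall x, rnorm (T x) <= r * rnorm x.
Proof.
have /linear_boundedP/pinfty_ex_gt0[r r0 Tr] := @bop_bounded _ _ T.
move: r0; rewrite ltcE => /andP[/eqP r0 rp].
exists (complex.Re r) => [|x]; first exact: ltW.
have := Tr x; rewrite !norm_rnorm.
by move: r0; case: (r) => a b /= ->; rewrite lecE /= !mul0r subr0 => /andP[].
Qed.

Lemma ex_adj (T : bop H) :
  exists S : bop H, forall x y, inner (T x) y = inner x (S y).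
Proof.
have [r r0 Tr] := bop_le T.
have [||||S SP] := @form_bop (fun y x => rp y (T x)) r.
- by move=> *; rewrite ripDl ripZl.
- by move=> *; rewrite linearD linearZ /= ripDr ripZr.
- by move=> *; rewrite linearZ rip_il.
- move=> g h g1 h1; apply: le_trans (rip_le _ _ _) _; rewrite -!rnormE.
  rewrite -[leRHS]mul1r ler_pM ?rnorm_ge0// (le_trans (Tr h))//.
  by rewrite ler_piMr.
exists S => x y.
rewrite !inner_rip !(ripC _ x) SP (ripC _ y).
congr (_ +i* _)%C.
by rewrite -[in RHS]linearZ /= SP ripC.
Qed.

Lemma adjE (T : bop H) x y : inner (T x) y = inner x (adj T y).
Proof. exact: (getPex (ex_adj T)). Qed.

Lemma adj_unique (T S : bop H) :
  (forall x y, inner (T x) y = inner x (S y)) -> adj T =1 S.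
Proof.
move=> TS y; apply: rip_inj => x; rewrite !(ripC _ _ x) /rip /=.
by rewrite -adjE TS.
Qed.

End Riesz.

(** * Uniform boundedness for quadratic forms *)

Section UniformBoundedness.
Variables (R : realType) (H : hilbertType R).
Implicit Types g h x y : H.

Lemma rnormD g h : rnorm (g + h) <= rnorm g + rnorm h.
Proof. by rewrite !rnormE snormD. Qed.

Lemma rnormB g h : rnorm (g - h) = rnorm (h - g).
Proof. by rewrite !rnormE snormB. Qed.

Lemma rnormZ c h : rnorm (c *: h) = normc c * rnorm h.
Proof. by rewrite !rnormE snormZ. Qed.

(* A Baire category argument: were [Q] unbounded, it would be unbounded on every
   ball by the parallelogram law, so nested balls would shrink to a point where
   [Q] is infinite. *)
Lemma isquad_lsc_bounded (Q : H -> R) : isquad Q -> (forall h, 0 <= Q h) ->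
  (forall c x, c < Q x ->
     exists2 r, 0 < r & forall y, rnorm (y - x) <= r -> c < Q y) ->
  exists M, forall h, Q h <= M * rnorm h ^+ 2.
Proof.
move=> q Q0 lsc; apply: contrapT => /forallNP unb.
have big x (r k : R) : 0 < r -> exists2 y, rnorm (y - x) <= r & k < Q y.
  move=> r0; have /existsNP[h /negP] := unb (`|k| / r ^+ 2); rewrite -ltNge => kh.
  have h0 : rnorm h != 0.
    apply/eqP => /rnorm_eq0 h0; move: kh.
    by rewrite h0 (isquad0 q) rnormE snorm0 expr0n mulr0 ltxx.
  have hp : 0 < rnorm h by rewrite lt_def h0 rnorm_ge0.
  pose g := (r / rnorm h)%:C%C *: h.
  have c2 : normc (r / rnorm h)%:C%C = r / rnorm h.
    by rewrite /= expr0n addr0 sqrtr_sqr ger0_norm// divr_ge0// ltW.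
  have gr : rnorm g = r by rewrite rnormZ c2 divfK.
  have Qg : k < Q g.
    rewrite q.2 c2; apply: le_lt_trans (ler_norm k) _.
    have -> : `|k| = (r / rnorm h) ^+ 2 * (`|k| / r ^+ 2 * rnorm h ^+ 2).
      by field; rewrite h0 gt_eqF.
    by rewrite ltr_pM2l// exprn_gt0// divr_gt0.
  have [xg|xg] := ltP k (Q (x + g)); first by exists (x + g) => //; rewrite addrC addKr gr.
  exists (x - g); first by rewrite addrC addKr rnormE snormN -rnormE gr.
  by have := isquad_parallelogram q x g; have := Q0 x; lra.
(* Positivity of the radius is a premise under the existential, so that [choice] yields a total
   function; for a nonpositive radius any pair will do. *)
have step (p : nat * (H * R)) : exists p' : H * R, 0 < p.2.2 ->
   [/\ 0 < p'.2, p'.2 <= p.1.+1%:R^-1, rnorm (p'.1 - p.2.1) + p'.2 <= p.2.2 &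
   forall y, rnorm (y - p'.1) <= p'.2 -> p.1%:R < Q y].
  case: p => k [x r] /=; have [r0|r0] := ltP 0 r; last first.
    by exists (x, r) => /=; lra.
  have r2 : 0 < r / 2 by rewrite divr_gt0.
  have [x' x'r kx'] := big x _ k%:R r2.
  have [r' r'0 r'P] := lsc _ _ kx'.
  exists (x', Num.min r' (Num.min (r / 2) k.+1%:R^-1)) => _ /=; split.
  - by rewrite !lt_min r'0 r2 invr_gt0 ltr0n.
  - by rewrite !ge_min ?lexx !orbT.
  - by rewrite [leRHS](splitr r) lerD// !ge_min lexx !orbT.
  - by move=> y; rewrite le_min => /andP[/r'P ? _].
have [f fP] := choice step.
pose fix xr (n : nat) : H * R := if n is m.+1 then f (m, xr m) else (0, 1).
have xr0 n : 0 < (xr n).2 by elim: n => [//|n /(fP (n, xr n))[]].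
have xrP n := fP (n, xr n) (xr0 n).
have mono n k : rnorm ((xr (n + k)%N).1 - (xr n).1) + (xr (n + k)%N).2 <= (xr n).2.
  elim: k => [|k IH]; first by rewrite addn0 subrr rnormE snorm0 add0r.
  rewrite addnS; have [_ _ /= h _] := xrP (n + k)%N.
  have := rnormD ((xr (n + k).+1).1 - (xr (n + k)%N).1) ((xr (n + k)%N).1 - (xr n).1).
  by rewrite addrA subrK /=; lra.
have mono' n m : (n <= m)%N -> rnorm ((xr m).1 - (xr n).1) <= (xr n).2.
  by move=> nm; have := mono n (m - n)%N; rewrite subnKC//; have := xr0 m; lra.
have [|l xl] := @rnorm_complete _ _ (fun n => (xr n).1).
  move=> e e0; have e2 : 0 < e / 2 by rewrite divr_gt0.
  have [N _ NP] := near_infty_natSinv_lt (PosNum e2).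
  have {}NP := NP _ (leqnn N); exists N.+1 => m n Nm Nn.
  have [_ /= h _ _] := xrP N; have := mono' _ _ Nm; have := mono' _ _ Nn.
  have := rnormD ((xr m).1 - (xr N.+1).1) ((xr N.+1).1 - (xr n).1).
  rewrite addrA subrK /= (rnormB (f _).1 (xr n).1); move: NP h => /=.
  by set a := N.+1%:R^-1; lra.
have lx n : rnorm (l - (xr n).1) <= (xr n).2.
  have lim : (fun m => rnorm ((xr m).1 - l) + (xr n).2) @ \oo --> 0 + (xr n).2.
    by apply: cvgD => //; exact: cvg_cst.
  rewrite -[leRHS]add0r; apply: (cvgr_to_ge lim); exists n => // m /= /mono' h.
  have := rnormD (l - (xr m).1) ((xr m).1 - (xr n).1).
  by rewrite addrA subrK (rnormB l (xr m).1); lra.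
have [n nl] : exists n, Q l < n%:R.
  by exists (Num.truncn (Q l)).+1; rewrite truncnS_gt.
by have [_ _ _ /(_ l (lx n.+1))] := xrP n; lra.
Qed.

(** Each [q n] is continuous, so [Q], being their pointwise supremum, is lower semicontinuous and
    [isquad_lsc_bounded] applies. The bounds [M n] may blow up with [n]. *)
Lemma isquad_sup_bounded (q : nat -> H -> R) (Q : H -> R) (M : nat -> R) :
  (forall n, isquad (q n)) -> (forall n h, 0 <= q n h <= M n * rnorm h ^+ 2) ->
  (forall n h, q n h <= Q h) -> (forall h, q ^~ h @ \oo --> Q h) ->
  isquad Q /\ exists M', forall h, Q h <= M' * rnorm h ^+ 2.
Proof.
move=> qq qM qQ qlim; have Qq : isquad Q by exact: isquad_cvg qq qlim.
split=> //; apply: isquad_lsc_bounded => // [h|c x cQ].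
  by apply: le_trans (qQ 0%N h); have /andP[] := qM 0%N h.
have [n cn] : exists n, c < q n x.
  have /cvgrPdist_lt/(_ (Q x - c)) := qlim x; rewrite subr_gt0 => /(_ cQ)[N _ hN].
  by exists N; have := hN N (leqnn N); rewrite /= ltr_norml => /andP[_]; lra.
have qn h : `|q n h| <= M n * rnorm h ^+ 2.
  by have /andP[h0 h1] := qM n h; rewrite ger0_norm.
pose a := `|M n| * rnorm x; have a0 : 0 <= a by rewrite mulr_ge0// rnorm_ge0.
(* Moving [x] by [d] lowers [q n] by at most [2 * a * rnorm d], which has to stay below [q n x - c];
   the summand 1 keeps [K] positive when [a = 0]. *)
pose K := 2 * a + 1; have K0 : 0 < K by rewrite ltr_wpDl// mulr_ge0.
exists ((q n x - c) / K / 2); first by rewrite !divr_gt0// subr_gt0.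
move=> y yx; apply: lt_le_trans (qQ n y); set d := y - x in yx.
have -> : y = x + d by rewrite addrC subrK.
rewrite isquadD//; have /andP[qd _] := qM n d.
have := polar_le x d (qq n) qn; have := ler_norm (- polar (q n) x d); rewrite normrN.
have : a * rnorm d <= a * ((q n x - c) / K / 2) by rewrite ler_wpM2l.
rewrite -/a; set e := q n x - c => h1 h2 h3.
have : 2 * (a * (e / K / 2)) < e.
  have -> : 2 * (a * (e / K / 2)) = a * e / K by field; rewrite gt_eqF.
  have e0 : 0 < e by rewrite subr_gt0.
  by rewrite ltr_pdivrMr// mulrC ltr_pM2l// /K; lra.
by move: h1 h2 h3; rewrite /e; lra.
Qed.

End UniformBoundedness.

(** * Moments and Bernstein polynomials *)

Section Moments.
Variable R : realType.
Implicit Types (a : nat -> R) (p q : {poly R}).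

Definition moment a p : R := \sum_(i < size p) p`_i * a i.

Lemma momentE a p n : (size p <= n)%N -> moment a p = \sum_(i < n) p`_i * a i.
Proof.
move=> pn; rewrite /moment -[RHS](big_mkord xpredT (fun i => p`_i * a i)).
rewrite (big_cat_nat (n := size p))//= big_mkord.
rewrite [X in _ = _ + X](_ : _ = 0) ?addr0// big_nat_cond big1// => i.
by move=> /andP[/andP[pi _] _]; rewrite nth_default ?mul0r.
Qed.

Lemma moment_linear a : linear_for *%R (moment a).
Proof.
move=> c p q; set n := maxn (size p) (size q).
rewrite (@momentE a p n) ?leq_maxl// (@momentE a q n) ?leq_maxr//.
rewrite (@momentE a _ n); last first.
  by rewrite (leq_trans (size_polyD _ _))// geq_max leq_maxr (leq_trans (size_scale_leq _ _))// leq_maxl.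
rewrite mulr_sumr -big_split /=; apply: eq_bigr => i _.
by rewrite coefD coefZ mulrDl mulrA.
Qed.

HB.instance Definition _ a :=
  GRing.isLinear.Build R {poly R} R *%R (moment a) (moment_linear a).

Lemma momentXn a n : moment a 'X^n = a n.
Proof.
rewrite (@momentE a _ n.+1) ?size_polyXn// big_ord_recr /= coefXn eqxx mul1r.
rewrite big1 ?add0r// => i _; rewrite coefXn ltn_eqF// mul0r//.
Qed.

Lemma momentMXn a p n : moment a ('X^n * p) = moment (fun i => a (n + i)%N) p.
Proof.
rewrite -{1}(coefK p) poly_def mulr_sumr linear_sum /=; apply: eq_bigr => i _.
by rewrite -scalerAr linearZ /= -exprD momentXn.
Qed.

Lemma momentM a p q :
  moment a (p * q) = moment (fun i => moment (fun j => a (i + j)%N) q) p.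
Proof.
rewrite -{1}(coefK p) poly_def mulr_suml linear_sum /=; apply: eq_bigr => i _.
by rewrite -scalerAl linearZ /= momentMXn.
Qed.

Definition bern N j : {poly R} := 'C(N, j)%:R *: ('X^j * (1 - 'X) ^+ (N - j)).

(** The Bernstein polynomial of order [N] of the function x^m. *)
Definition bernm m N : {poly R} := \sum_(j < N.+1) (j%:R / N%:R) ^+ m *: bern N j.

Lemma bernm0 N : bernm 0 N = 1.
Proof.
transitivity ((1 - 'X + 'X : {poly R}) ^+ N); last by rewrite subrK expr1n.
rewrite exprDn; apply: eq_bigr => j _.
by rewrite expr0 scale1r /bern scaler_nat mulrC.
Qed.

(** The differential equation x(1-x) b' = (j - Nx) b of the Bernstein basis. Divided by [N], it
    trades the factor j/N that separates [bernm m.+1] from [bernm m] for a derivative, whence the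
    recursion [bernmS]. *)
Lemma deriv_bern N j : (j <= N)%N ->
  'X * (1 - 'X) * (bern N j)^`() = j%:R *: bern N j - N%:R *: ('X * bern N j).
Proof.
move=> jN; have DX n : 'X * ('X^n : {poly R})^`() = n%:R *: 'X^n.
  by rewrite derivXn; case: n => [|n]; rewrite ?mulr0n ?mulr0 ?scale0r// mulrnAr -exprS scaler_nat.
have DY n : (1 - 'X) * ((1 - 'X : {poly R}) ^+ n)^`() = - (n%:R *: (1 - 'X) ^+ n).
  rewrite deriv_exp derivB derivX -polyC1 derivC sub0r.
  case: n => [|n]; first by rewrite mulr0n mulr0 scale0r oppr0.
  by rewrite mulrnAr mulN1r mulrN -exprS mulNrn scaler_nat.
rewrite /bern derivZ derivM; set A := 'X^j; set B := (1 - 'X) ^+ _.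
have -> : 'X * (1 - 'X) * ('C(N, j)%:R *: (A^`() * B + A * B^`())) =
    'C(N, j)%:R *: ((1 - 'X) * B * ('X * A^`()) + 'X * A * ((1 - 'X) * B^`())).
  by rewrite -!mul_polyC; ring.
rewrite DX DY -/A -/B natrB// -!mul_polyC !rmorphB /=; ring.
Qed.

Lemma bernmS m N : bernm m.+1 N.+1 =
  'X * bernm m N.+1 + N.+1%:R^-1 *: ('X * (1 - 'X) * (bernm m N.+1)^`()).
Proof.
rewrite /bernm linear_sum /= !mulr_sumr scaler_sumr -big_split /=.
apply: eq_bigr => j _; rewrite derivZ.
have := @deriv_bern N.+1 j (ltn_ord j); move: (bern N.+1 j) => b D.
rewrite -!scalerAr D -!mul_polyC.
have N0 : (N.+1%:R : R) != 0 by rewrite pnatr_eq0.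
have e : (N.+1%:R^-1)%:P * (N.+1%:R)%:P = 1 :> {poly R}.
  by rewrite -polyCM mulVf.
rewrite exprS (mulrC j%:R) !polyCM; set u := (_ ^+ m)%:P.
set v := N.+1%:R^-1%:P in e *; set w := N.+1%:R%:P in e *.
have -> : v * (u * (j%:R%:P * b - w * ('X * b))) =
  v * j%:R%:P * u * b - (v * w) * ('X * (u * b)) by ring.
by rewrite e; ring.
Qed.

(** In [bernmS] one term multiplies by ['X], the other differentiates and then multiplies by a
    quadratic polynomial: each step raises the degree by at most one, independently of [N]. *)
Lemma size_bernm m N : (size (bernm m N.+1) <= m.+1)%N.
Proof.
elim: m => [|m IH]; first by rewrite bernm0 size_poly1.
rewrite bernmS (leq_trans (size_polyD _ _))// geq_max; apply/andP; split.
  by rewrite (leq_trans (size_polyMleq _ _))// size_polyX.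
rewrite (leq_trans (size_scale_leq _ _))//.
have [->|d0] := eqVneq (bernm m N.+1)^`() 0; first by rewrite mulr0 size_poly0.
have p0 : bernm m N.+1 != 0 by apply: contra_neq d0 => ->; rewrite deriv0.
have dp := lt_size_deriv p0; rewrite (leq_trans (size_polyMleq _ _))//.
have : (size ('X * (1 - 'X) : {poly R})%R <= 3)%N.
  have : (size (1 - 'X : {poly R})%R <= 2)%N.
    by rewrite (leq_trans (size_polyD _ _))// size_polyN size_polyX size_poly1.
  move=> h; rewrite (leq_trans (size_polyMleq _ _))// size_polyX.
  by move: h; set n := size _; clearbody n; lia.
by move: IH dp; set x := size _; set y := size _; set z := size _; lia.
Qed.

(** The derivative term of [bernmS] has convergent coefficients and carries the factor [N.+1%:R^-1],
    so only ['X * bernm m N.+1] contributes to the limit. *)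
Lemma cvg_bernm m k : (fun N => (bernm m N.+1)`_k) @ \oo --> (('X^m)`_k : R).
Proof.
elim: m k => [k|m IH k].
  by under eq_fun do rewrite bernm0; exact: cvg_cst.
have cvgX (u : nat -> {poly R}) p : (forall k, (fun N => (u N)`_k) @ \oo --> p`_k) ->
    forall k, (fun N => ('X * u N)`_k) @ \oo --> ('X * p)`_k.
  move=> up [|l]; first by under eq_fun do rewrite coefXM; rewrite coefXM; exact: cvg_cst.
  by under eq_fun do rewrite coefXM; rewrite coefXM; exact: up.
have cvgD1 l : (fun N => (bernm m N.+1)^`()`_l) @ \oo --> (('X^m)^`()`_l : R).
  rewrite coef_deriv -[X in _ --> X]mulr_natr (_ : (fun N => _) =
    fun N => (bernm m N.+1)`_l.+1 * l.+1%:R); first exact: cvgMr_tmp.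
  by apply/funext => N; rewrite coef_deriv mulr_natr.
pose p : {poly R} := 'X^m; pose d : {poly R} := p^`().
have -> : 'X^(m.+1)`_k = ('X * p)`_k + 0 * ('X * (d - 'X * d))`_k :> R.
  by rewrite mul0r addr0 -exprS.
under eq_fun do rewrite bernmS coefD coefZ -mulrA mulrBl mul1r.
apply: cvgD; first exact: cvgX.
apply: cvgM; first exact: cvg_harmonic.
apply: (cvgX _ _) => l; under eq_fun do rewrite coefB; rewrite coefB.
by apply: cvgB => //; exact: cvgX.
Qed.

(** The degrees are bounded by [size_bernm], so the moment is a fixed finite combination of
    coefficients and [cvg_bernm] suffices for an arbitrary sequence [a]. *)
Lemma cvg_moment_bernm a p m :
  (fun N => moment a (p * bernm m N.+1)) @ \oo --> moment a (p * 'X^m).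
Proof.
have E q : (size q <= m.+1)%N ->
    moment a (p * q) = \sum_(i < m.+1) q`_i * moment a (p * 'X^i).
  move=> qm; rewrite -{1}(coefK q) poly_def mulr_sumr linear_sum /=.
  rewrite -(momentE (fun i => moment a (p * 'X^i)) qm) [RHS]/moment; apply: eq_bigr => i _.
  by rewrite -scalerAr linearZ.
rewrite (E 'X^m) ?size_polyXn//.
under eq_fun do rewrite E ?size_bernm//.
by apply: cvgr_sum => i; apply: cvgMr_tmp; exact: cvg_bernm.
Qed.

(** Algebraic certificates of nonnegativity on [0,1]. The cone is closed under products, and a
    linear functional is nonnegative on it as soon as it is so on the generators. *)
Inductive bcone : {poly R} -> Prop :=
| bcone_mono i j : bcone ('X^i * (1 - 'X) ^+ j)
| bconeD p q : bcone p -> bcone q -> bcone (p + q)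
| bconeZ c p : 0 <= c -> bcone p -> bcone (c *: p).

Lemma bconeM p q : bcone p -> bcone q -> bcone (p * q).
Proof.
move=> + bq; elim=> [i j|p1 p2 _ IH1 _ IH2|c p1 c0 _ IH].
- elim: bq => [k l|q1 q2 _ IH1 _ IH2|c q1 c0 _ IH].
  + by rewrite mulrACA -!exprD; exact: bcone_mono.
  + by rewrite mulrDr; exact: bconeD.
  + by rewrite -scalerAr; exact: bconeZ.
- by rewrite mulrDl; exact: bconeD.
- by rewrite -scalerAl; exact: bconeZ.
Qed.

Lemma bcone1 : bcone 1.
Proof. by have := bcone_mono 0 0; rewrite !expr0 mulr1. Qed.

Lemma bconeX n : bcone ('X^n).
Proof. by have := bcone_mono n 0; rewrite expr0 mulr1. Qed.

Lemma bconeY n : bcone ((1 - 'X) ^+ n).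
Proof. by have := bcone_mono 0 n; rewrite expr0 mul1r. Qed.

Lemma bcone0 : bcone 0.
Proof. by rewrite -(scale0r 1); apply: bconeZ => //; exact: bcone1. Qed.

Lemma bcone_sum (I : Type) (r : seq I) (P : pred I) (f : I -> {poly R}) :
  (forall i, bcone (f i)) -> bcone (\sum_(i <- r | P i) f i).
Proof.
by move=> bf; apply: (big_ind bcone) => //; [exact: bcone0|exact: bconeD].
Qed.

Lemma bcone_exp p n : bcone p -> bcone (p ^+ n).
Proof.
by move=> bp; elim: n => [|n IH]; [exact: bcone1|rewrite exprS; exact: bconeM].
Qed.

Lemma bcone_bern N j : bcone (bern N j).
Proof. by apply: bconeZ => //; exact: bcone_mono. Qed.

Lemma one_subX (p : {poly R}) n : 1 - p ^+ n = (1 - p) * \sum_(i < n) p ^+ i.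
Proof. by rewrite -opprB subrX1 -mulNr opprB. Qed.

Lemma one_subXX n : 'X * \sum_(i < n) (1 - 'X) ^+ i = 1 - (1 - 'X) ^+ n :> {poly R}.
Proof. by rewrite one_subX subKr. Qed.

Lemma bcone_1subX n : bcone (1 - (1 - 'X) ^+ n).
Proof.
rewrite -one_subXX; apply: bconeM; first exact: (bconeX 1).
by apply: bcone_sum => i; exact: bconeY.
Qed.

End Moments.

(** * Completely monotone moment forms *)

Section MomentForms.
Variables (R : realType) (V : lmodType R[i]) (s : sip V) (T : {linear V -> V}).
Implicit Types (p q : {poly R}) (u v : V).

Lemma iter_linear n : linear (iter n T).
Proof. by elim: n => [|n IH] c u v //=; rewrite IH linearP. Qed.

(* The form of [p(T^* , T)] under the hereditary calculus x^i |-> T^{*i} T^i. *)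
Definition hform p u v : R := moment (fun i => rip s (iter i T u) (iter i T v)) p.

Lemma hformC p u v : hform p u v = hform p v u.
Proof. by apply: eq_bigr => i _; rewrite ripC. Qed.

Lemma hform_lin p (r : R) u u' v :
  hform p (r%:C%C *: u + u') v = r * hform p u v + hform p u' v.
Proof.
rewrite /hform /moment mulr_sumr -big_split /=; apply: eq_bigr => i _.
by rewrite iter_linear ripDl ripZl; ring.
Qed.

Lemma hformDl p u u' v : hform p (u + u') v = hform p u v + hform p u' v.
Proof. by have := hform_lin p 1 u u' v; rewrite scale1r mul1r. Qed.

Lemma hform0l p v : hform p 0 v = 0.
Proof. by apply: (addrI (hform p 0 v)); rewrite -hformDl !addr0. Qed.

Lemma hformZl p (r : R) u v : hform p (r%:C%C *: u) v = r * hform p u v.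
Proof. by have := hform_lin p r u 0 v; rewrite hform0l !addr0. Qed.

Lemma hform_suml p (I : Type) (r : seq I) (P : pred I) (f : I -> V) v :
  hform p (\sum_(i <- r | P i) f i) v = \sum_(i <- r | P i) hform p (f i) v.
Proof.
by apply: (big_morph (hform p ^~ v)) => [x y|]; rewrite ?hformDl ?hform0l.
Qed.

Lemma hformXM p n u v : hform ('X^n * p) u v = hform p (iter n T u) (iter n T v).
Proof.
rewrite /hform momentMXn; apply: eq_bigr => i _.
by rewrite addnC !iterD.
Qed.

Lemma isquad_hform p : isquad (fun u => hform p u u).
Proof.
apply: isquad_sum => i.
have L : linear (iter i T) := @iter_linear i.
exact: (isquad_ripT s (HB.pack (iter i T) (GRing.isLinear.Build _ _ _ _ _ L))).
Qed.

Hypothesis hform_mono_ge0 : forall i j u, 0 <= hform ('X^i * (1 - 'X) ^+ j) u u.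

Lemma hform_ge0 p u : bcone p -> 0 <= hform p u u.
Proof.
elim=> [i j|p1 p2 _ IH1 _ IH2|c p1 c0 _ IH]; first exact: hform_mono_ge0.
  by rewrite /hform linearD addr_ge0.
by rewrite /hform linearZ mulr_ge0.
Qed.

Lemma hformM p u v : bcone p -> hform p u v ^+ 2 <= hform p u u * hform p v v.
Proof.
move=> bp; apply: discriminant_le => x y.
have := hform_ge0 (x%:C%C *: u + y%:C%C *: v) bp.
rewrite !(hformDl, hformZl) !(hformC _ _ (_ + _)) !(hformDl, hformZl).
rewrite (hformC p v u); lra.
Qed.

(* Positivity of the operator-valued moment sequence; the measure is
   approximated by the discrete ones carried by the Bernstein polynomials. *)
Lemma hform_embry p n (u : nat -> V) : bcone p ->
  0 <= \sum_(k < n) \sum_(l < n) hform ('X^(k + l) * p) (u k) (u l).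
Proof.
(* This is the value at the node j/N of the vector polynomial with coefficients [u k]; there the
   weight (j/N)^(k+l) of [bernm] splits into a factor for each argument. *)
move=> bp; pose w N j := \sum_(k < n) ((j%:R / N%:R) ^+ k)%:C%C *: u k.
have E N : \sum_(k < n) \sum_(l < n) hform (p * bernm R (k + l) N) (u k) (u l) =
    \sum_(j < N.+1) hform (p * bern R N j) (w N j) (w N j).
  have wE (j : 'I_N.+1) : hform (p * bern R N j) (w N j) (w N j) = \sum_(k < n) \sum_(l < n)
     (j%:R / N%:R) ^+ (k + l) * hform (p * bern R N j) (u k) (u l).
    rewrite {1}/w hform_suml; apply: eq_bigr => k _.
    rewrite hformC /w hform_suml; apply: eq_bigr => l _.
    by rewrite hformZl hformC hformZl exprD; ring.
  under [RHS]eq_bigr do rewrite wE.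
  rewrite [RHS]exchange_big; apply: eq_bigr => k _.
  rewrite [RHS]exchange_big; apply: eq_bigr => l _.
  rewrite /hform /bernm mulr_sumr linear_sum /=; apply: eq_bigr => j _.
  by rewrite -scalerAr linearZ.
have lim : (fun N => \sum_(j < N.+2) hform (p * bern R N.+1 j) (w N.+1 j) (w N.+1 j)) @ \oo
    --> \sum_(k < n) \sum_(l < n) hform ('X^(k + l) * p) (u k) (u l).
  under eq_fun do rewrite -E.
  apply: cvgr_sum => k; apply: cvgr_sum => l; rewrite mulrC.
  exact: cvg_moment_bernm.
apply: (cvgr_to_ge lim); apply: nearW => N; apply: sumr_ge0 => j _.
by apply: hform_ge0; apply: bconeM => //; exact: bcone_bern.
Qed.

(* The Bram-Halmos positivity condition.  On the support of [x] away from [0] the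
   form is [\sum x^(k+l-n) <E T^(n-k) h_k, T^(n-l) h_l>], whence [bh_X]; at [0]
   only the term [k = l = 0] survives, and the polynomial [1 - (1 - (1-x)^M)^n]
   localizes at [0] as [M] grows. *)
Definition bhform n (h : nat -> V) p : R :=
  \sum_(k < n) \sum_(l < n) hform p (iter l T (h k)) (iter k T (h l)).

Lemma bh_X n h p : bcone p -> 0 <= bhform n h ('X^n * p).
Proof.
move=> bp; rewrite /bhform.
apply: le_trans (hform_embry n (fun k => iter (n - k) T (h k)) bp) _.
apply: ler_sum => k _; apply: ler_sum => l _; rewrite le_eqVlt; apply/orP; left.
rewrite !hformXM -!iterD; apply/eqP; congr (hform p (iter _ T _) (iter _ T _)).
  by have := ltn_ord k; lia.
by have := ltn_ord l; lia.
Qed.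

Lemma bhformD n h p q : bhform n h (p + q) = bhform n h p + bhform n h q.
Proof.
rewrite /bhform -big_split; apply: eq_bigr => k _ /=.
by rewrite -big_split; apply: eq_bigr => l _ /=; rewrite /hform linearD.
Qed.

Section Localize.
Variables (n : nat) (p : {poly R}).
Hypothesis bp : bcone p.
Let y M : {poly R} := (1 - 'X) ^+ M.
(** It agrees with [p] at 0 and tends to 0 on ]0,1] as [M] grows, while the remainder
    [p - loc M = p * (1 - y M) ^+ n] is divisible by ['X^n], as [bh_X] demands. *)
Let loc M : {poly R} := p * (1 - (1 - y M) ^+ n).

Let bcone_1y M : bcone (1 - y M). Proof. exact: bcone_1subX. Qed.

Let locE M : loc M = p * (y M * \sum_(j < n) (1 - y M) ^+ j).
Proof.
by rewrite /loc one_subX subKr.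
Qed.

Let bcone_loc M : bcone (loc M).
Proof.
rewrite locE; apply: bconeM => //; apply: bconeM; first exact: bconeY.
by apply: bcone_sum => j; exact: bcone_exp.
Qed.

Let loc_le M u : hform (loc M) u u <= hform p u u.
Proof.
rewrite -subr_ge0 /hform -linearB; apply: hform_ge0.
rewrite /loc mulrBr mulr1 opprB addrC subrK; apply: bconeM => //.
exact: bcone_exp.
Qed.

Let locX_le M u : hform (loc M) (T u) (T u) <= n%:R * hform p u u / M.+1%:R.
Proof.
have -> : hform (loc M) (T u) (T u) = hform ('X * loc M) u u.
  by rewrite -[X in X * _]expr1 hformXM.
(* Bernoulli's inequality 1 - (1-y)^n <= ny, with the difference written as an element of the
   cone. *)
have h1 : hform ('X * loc M) u u <= n%:R * hform ('X * p * y M) u u.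
  rewrite -subr_ge0.
  have -> : n%:R * hform ('X * p * y M) u u - hform ('X * loc M) u u =
      hform ('X * p * y M * \sum_(j < n) (1 - (1 - y M) ^+ j)) u u.
    rewrite big_split /= sumr_const card_ord sumrN mulrBr mulr_natr.
    by rewrite /hform linearB linearMn /= mulr_natl locE -!mulrA.
  apply: hform_ge0; apply: bconeM.
    apply: bconeM; last exact: bconeY.
    by apply: bconeM => //; exact: (bconeX _ 1).
  apply: bcone_sum => j; rewrite one_subX subKr.
  apply: bconeM; first exact: bconeY.
  by apply: bcone_sum => i; exact: bcone_exp.
(* On [0,1], (M+1) x (1-x)^M <= x sum_(i <= M) (1-x)^i = 1 - (1-x)^(M+1) <= 1; both gaps are kept as
   elements of the cone. *)
have h2 : hform ('X * p * y M) u u * M.+1%:R <= hform p u u.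
  rewrite mulr_natr -subr_ge0.
  have -> : hform p u u - hform ('X * p * y M) u u *+ M.+1 =
    hform (p * y M.+1 + p * 'X * \sum_(i < M.+1) (y i - y M)) u u.
    rewrite /hform -linearMn -linearB /=; congr moment.
    rewrite big_split /= sumr_const card_ord mulrDr addrA.
    rewrite -(mulrA p 'X (\sum_(i < M.+1) y i)) one_subXX mulNrn mulrN mulrnAr -/(y _).
    by move: (y M) (y M.+1) => a b; rewrite (mulrC 'X p); ring.
  apply: hform_ge0; apply: bconeD; first by apply: bconeM => //; exact: bconeY.
  apply: bconeM; first by apply: bconeM => //; exact: (bconeX _ 1).
  apply: bcone_sum => i; have : (i <= M)%N := leq_ord i.
  move: (nat_of_ord i) => k kM; rewrite /y -(subnKC kM) exprD -[X in X - _]mulr1 -mulrBr.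
  by apply: bconeM; [exact: bconeY|exact: bcone_1subX].
by apply: le_trans h1 _; rewrite -[leRHS]mulrA ler_wpM2l// ler_pdivlMr.
Qed.

(** One factor [T] is enough: in the Cauchy-Schwarz inequality for [loc M] the side of [T u] decays
    like 1/(M+1), and the side of [v] is bounded by [loc_le]. *)
Let cvg_loc u v : (fun M => hform (loc M) (T u) v) @ \oo --> (0 : R).
Proof.
pose K := n%:R * hform p u u * hform p v v.
have sq M : hform (loc M) (T u) v ^+ 2 <= K * M.+1%:R^-1.
  apply: le_trans (hformM _ _ (bcone_loc M)) _.
  by rewrite /K mulrAC; apply: ler_pM; rewrite ?hform_ge0 ?locX_le ?loc_le.
have K0 : 0 <= K by rewrite /K !mulr_ge0 ?hform_ge0.
apply/cvgrPdist_lt => e e0.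
have lim : (fun M => K * M.+1%:R^-1) @ \oo --> K * 0.
  by apply: cvgMl_tmp; exact: cvg_harmonic.
rewrite mulr0 in lim.
have e2 : 0 < e ^+ 2 by rewrite exprn_gt0.
move/cvgrPdist_lt : lim => /(_ _ e2); apply: filterS => M.
rewrite !sub0r !normrN (ger0_norm (mulr_ge0 K0 (_ : 0 <= M.+1%:R^-1)))//.
move=> KM; rewrite -(@ltr_pXn2r _ 2)// ?nnegrE ?ltW// -normrX ger0_norm ?sqr_ge0//.
exact: le_lt_trans (sq M) KM.
Qed.

Lemma bhform_ge0 h : 0 <= bhform n h p.
Proof.
(* The term [k = l = 0], which is nonnegative, is discarded; in every other term [T] acts on at
   least one argument, so [cvg_loc] applies. *)
pose t M k l := if (k == 0%N) && (l == 0%N) then 0 else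
  hform (loc M) (iter l T (h k)) (iter k T (h l)).
have lim : (fun M => \sum_(k < n) \sum_(l < n) t M k l) @ \oo -->
    \sum_(k < n) \sum_(l < n) (0 : R).
  apply: cvgr_sum => k; apply: cvgr_sum => l; rewrite /t.
  case: (nat_of_ord l) (nat_of_ord k) => [|l'] [|k'] /=; first exact: cvg_cst.
  - by under eq_fun do rewrite hformC; exact: cvg_loc.
  - exact: cvg_loc.
  - exact: cvg_loc.
rewrite big1 in lim; last by move=> k _; rewrite big1.
apply: (cvgr_to_le lim); apply: nearW => M.
have -> : p = 'X^n * (p * (\sum_(i < M) (1 - 'X) ^+ i) ^+ n) + loc M.
  by rewrite mulrCA -exprMn one_subXX /loc mulrBr mulr1 addrC subrK.
rewrite bhformD -[leLHS]add0r; apply: lerD.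
  apply: bh_X; apply: bconeM => //; apply: bcone_exp; apply: bcone_sum => i.
  exact: bconeY.
apply: ler_sum => k _; apply: ler_sum => l _; rewrite /t.
case: ifP => // /andP[/eqP-> /eqP->] /=; exact: hform_ge0.
Qed.

End Localize.

End MomentForms.

(** * Completion of a semi-inner product space *)

Section Completion.
Variables (R : realType) (V : lmodType R[i]) (s : sip V).
Implicit Types (v w : nat -> V) (f g : V -> R[i]).

Definition scauchy v := forall e : R, 0 < e -> exists N, forall m n,
  (N <= m)%N -> (N <= n)%N -> snorm s (v m - v n) < e.

Definition represents v f := scauchy v /\ forall x,
  (fun n => complex.Re (s (v n) x)) @ \oo --> complex.Re (f x) /\
  (fun n => complex.Im (s (v n) x)) @ \oo --> complex.Im (f x).

Lemma normc_Re (z : R[i]) : `|complex.Re z| <= normc z.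
Proof. by rewrite -lecR -normc_normE normc_ge_Re. Qed.

Lemma normc_Im (z : R[i]) : `|complex.Im z| <= normc z.
Proof.
by rewrite -(@ler_pXn2r _ 2)// ?nnegrE ?normc_ge0// real_normK ?num_real// normc_sqr lerDr sqr_ge0.
Qed.

Lemma scauchy_bounded v : scauchy v -> exists2 B, 0 < B & forall n, snorm s (v n) <= B.
Proof.
move=> /(_ 1 ltr01)[N vN].
pose B := \sum_(i < N.+1) snorm s (v i) + 1.
have B0 : 0 <= \sum_(i < N.+1) snorm s (v i).
  by apply: sumr_ge0 => i _; exact: snorm_ge0.
have BN i : (i < N.+1)%N -> snorm s (v i) <= \sum_(i < N.+1) snorm s (v i).
  move=> iN; rewrite (bigD1 (Ordinal iN))//= lerDl.
  by apply: sumr_ge0 => k _; exact: snorm_ge0.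
exists B => [|n]; first by rewrite ltr_wpDl.
have [Nn|nN] := leqP N n; last by rewrite (le_trans (BN _ _)) ?lerDl// ltnW.
rewrite -(subrK (v N) (v n)) (le_trans (snormD _ _ _))// addrC lerD//.
  exact: BN.
exact/ltW/vN.
Qed.

Lemma scauchyP (c : R[i]) v w : scauchy v -> scauchy w ->
  scauchy (fun n => c *: v n + w n).
Proof.
move=> vC wC e e0; have e2 : 0 < e / 2 by rewrite divr_gt0.
have c1 : 0 < normc c + 1 by rewrite ltr_wpDl// normc_ge0.
have [N1 h1] := vC (e / 2 / (normc c + 1)) (divr_gt0 e2 c1).
have [N2 h2] := wC _ e2; exists (maxn N1 N2) => m n.
rewrite !geq_max => /andP[m1 m2] /andP[n1 n2].
rewrite opprD addrACA -scalerBr (le_lt_trans (snormD _ _ _))//.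
rewrite [ltRHS](splitr e) ler_ltD ?h2// snormZ.
have := h1 _ _ m1 n1; rewrite ltr_pdivlMr// mulrC => /ltW; apply: le_trans.
by rewrite ler_wpM2r ?snorm_ge0// lerDl.
Qed.

Lemma scauchy_cst x : scauchy (fun=> x).
Proof. by move=> e e0; exists 0%N => m n _ _; rewrite subrr snorm0. Qed.

Lemma represents_cst x : represents (fun=> x) (s x).
Proof.
by split=> [|y]; [exact: scauchy_cst|split; exact: cvg_cst].
Qed.

Lemma representsP (c : R[i]) v w f g : represents v f -> represents w g ->
  represents (fun n => c *: v n + w n) (fun x => c * f x + g x).
Proof.
move=> [vC vf] [wC wg]; split=> [|x]; first exact: scauchyP.
have [f1 f2] := vf x; have [g1 g2] := wg x; split.
  rewrite cReD cReM (_ : (fun n => _) = fun n => complex.Re c * complex.Re (s (v n) x)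
    - complex.Im c * complex.Im (s (v n) x) + complex.Re (s (w n) x)).
    by apply: cvgD => //; apply: cvgB; apply: cvgMl_tmp.
  by apply/funext => n; rewrite sipDl sipZl cReD cReM.
rewrite cImD cImM (_ : (fun n => _) = fun n => complex.Re c * complex.Im (s (v n) x)
  + complex.Im c * complex.Re (s (v n) x) + complex.Im (s (w n) x)).
  by apply: cvgD => //; apply: cvgD; apply: cvgMl_tmp.
by apply/funext => n; rewrite sipDl sipZl cImD cImM.
Qed.

Lemma cvg_cauchyr (u : nat -> R) : (forall e : R, 0 < e -> exists N, forall m n,
  (N <= m)%N -> (N <= n)%N -> `|u m - u n| < e) -> cvgn u.
Proof.
move=> uC; apply/cauchy_cvgP/cauchy_exP => e e0.
have [N uN] := uC e e0; exists (u N); exists N => // n /= Nn.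
exact: uN.
Qed.

Lemma sip_cauchy v w : scauchy v -> scauchy w -> forall e : R, 0 < e ->
  exists N, forall m n, (N <= m)%N -> (N <= n)%N ->
  normc (s (v m) (w m) - s (v n) (w n)) < e.
Proof.
move=> vC wC e e0; have [B B0 vB] := scauchy_bounded vC.
have [C C0 wC'] := scauchy_bounded wC.
have eB : 0 < e / 2 / B by rewrite !divr_gt0.
have eC : 0 < e / 2 / C by rewrite !divr_gt0.
have [N1 h1] := vC _ eC; have [N2 h2] := wC _ eB.
exists (maxn N1 N2) => m n.
rewrite !geq_max => /andP[m1 m2] /andP[n1 n2].
have -> : s (v m) (w m) - s (v n) (w n) = s (v m - v n) (w m) + s (v n) (w m - w n).
  by rewrite sipDl sipNl sipDr -(scaleN1r (w n)) sipZr rmorphN1 mulN1r; ring.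
rewrite (le_lt_trans (le_normcD _ _))// [ltRHS](splitr e).
rewrite (le_lt_trans (lerD (sip_le _ _ _) (sip_le _ _ _)))//.
apply: (@le_lt_trans _ _ (snorm s (v m - v n) * C + B * snorm s (w m - w n))).
  by apply: lerD; [apply: ler_wpM2l|apply: ler_wpM2r]; rewrite ?snorm_ge0.
apply: ltrD; first by rewrite -ltr_pdivlMr// h1.
by rewrite mulrC -ltr_pdivlMr// h2.
Qed.

Lemma sip_cvg v w : scauchy v -> scauchy w ->
  cvgn (fun n => complex.Re (s (v n) (w n)) : R) /\
  cvgn (fun n => complex.Im (s (v n) (w n)) : R).
Proof.
move=> vC wC; have h := sip_cauchy vC wC.
split; apply: cvg_cauchyr => e /h[N hN]; exists N => m n Nm Nn;
  rewrite -?cReB -?cImB; apply: le_lt_trans (hN _ _ Nm Nn).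
  exact: normc_Re.
exact: normc_Im.
Qed.

Lemma represents_ex v : scauchy v -> exists f, represents v f.
Proof.
move=> vC; exists (fun x => (limn (fun n => complex.Re (s (v n) x) : R) +i*
  limn (fun n => complex.Im (s (v n) x) : R))%C).
split=> // x; have [h1 h2] := sip_cvg vC (scauchy_cst x).
by split; [exact: h1|exact: h2].
Qed.

(** From |v_n|^2 = (v_n, v_n - v_N) + (v_n, v_N): the first product is small since [v] is Cauchy and
    bounded, the second tends to 0 for fixed [N]. Hence a functional determines the Cauchy sequence
    behind it up to null sequences. *)
Lemma snorm_cvg0 v : scauchy v -> (forall x, (fun n => rip s (v n) x) @ \oo --> (0 : R)) ->
  (fun n => snorm s (v n)) @ \oo --> (0 : R).
Proof.
move=> vC v0; have [B B0 vB] := scauchy_bounded vC.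
apply/cvgrPdist_lt => e e0.
have e2 : 0 < e ^+ 2 / 2 by rewrite divr_gt0// exprn_gt0.
have eB : 0 < e ^+ 2 / 2 / B by rewrite divr_gt0.
have [N hN] := vC _ eB.
have /cvgrPdist_lt/(_ _ e2)[M _ hM] := v0 (v N).
exists (maxn N M) => // n /=; rewrite geq_max => /andP[Nn Mn].
rewrite sub0r normrN ger0_norm ?snorm_ge0//.
rewrite -(@ltr_pXn2r _ 2)// ?nnegrE ?snorm_ge0 ?ltW// snorm_sqr.
rewrite -[X in rip s _ X](subrK (v N)) ripDr [ltRHS]splitr ltrD//.
  rewrite (le_lt_trans (ler_norm _))// (le_lt_trans (rip_le _ _ _))//.
  apply: (@le_lt_trans _ _ (B * snorm s (v n - v N))).
    by apply: ler_wpM2r; rewrite ?snorm_ge0.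
  by rewrite mulrC -ltr_pdivlMr// hN.
by have := hM _ Mn; rewrite /= sub0r normrN; apply: le_lt_trans; exact: ler_norm.
Qed.

Lemma represents_diff v v' f : represents v f -> represents v' f ->
  (fun n => snorm s (v n - v' n)) @ \oo --> (0 : R).
Proof.
move=> vf vf'; have := representsP (-1) vf' vf.
under eq_fun do rewrite scaleN1r addrC; move=> [dC d0].
apply: snorm_cvg0 => // x; have [+ _] := d0 x.
by rewrite mulN1r addNr.
Qed.

(** Independence of the representatives: it frees [kip] from the sequences chosen by [rep]. *)
Lemma rip_cvg_unique v v' w w' f g (l : R) :
  represents v f -> represents v' f -> represents w g -> represents w' g ->
  (fun n => rip s (v n) (w n)) @ \oo --> l ->
  (fun n => rip s (v' n) (w' n)) @ \oo --> l.
Proof.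
move=> vf vf' wg wg' vwl.
have [B B0 vB] := scauchy_bounded vf'.1.
have [C C0 wC] := scauchy_bounded wg.1.
have dv := represents_diff vf vf'; have dw := represents_diff wg wg'.
have lim : (fun n => snorm s (v n - v' n) * C + B * snorm s (w n - w' n)) @ \oo --> (0 * C + B * 0).
  by apply: cvgD; [apply: cvgMr_tmp|apply: cvgMl_tmp].
rewrite mul0r mulr0 addr0 in lim.
have lim0 : (fun n => rip s (v n) (w n) - rip s (v' n) (w' n)) @ \oo --> (0 : R).
  apply/cvgrPdist_lt => e e0; move/cvgrPdist_lt : lim => /(_ _ e0).
  apply: filterS => n; rewrite !sub0r !normrN; apply: le_lt_trans.
  have -> : rip s (v n) (w n) - rip s (v' n) (w' n) =
      rip s (v n - v' n) (w n) + rip s (v' n) (w n - w' n).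
    by rewrite ripDl ripNl ripDr ripNr; ring.
  rewrite (le_trans (ler_normD _ _))// [leRHS]ger0_norm; last first.
    by rewrite addr_ge0// mulr_ge0 ?snorm_ge0 ?ltW.
  rewrite (le_trans (lerD (rip_le _ _ _) (rip_le _ _ _)))//.
  by apply: lerD; [apply: ler_wpM2l|apply: ler_wpM2r]; rewrite ?snorm_ge0.
rewrite -[l]subr0 (_ : (fun n => _) = fun n => rip s (v n) (w n) -
  (rip s (v n) (w n) - rip s (v' n) (w' n))); first exact: cvgB.
by apply/funext => n; ring.
Qed.

(* The completion avoids quotients: a Cauchy sequence [v] is replaced by the
   functional [lim_n s (v n)] that it defines. *)
Definition compl_pred : {pred V -> R[i]^o} :=
  fun f => `[< exists v, represents v f >].

Record compl := Compl { compl_fun :> V -> R[i]^o ; compl_funP : compl_fun \in compl_pred }.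
HB.instance Definition _ := [isSub for compl_fun].
HB.instance Definition _ := [Choice of compl by <:].

Lemma compl_submod : submod_closed compl_pred.
Proof.
split; first by apply/asboolP; exists (fun=> 0); have := represents_cst 0;
  rewrite (_ : s 0 = 0)//; apply/funext => x; exact: sip0l.
move=> c f g /asboolP[v vf] /asboolP[w wg]; apply/asboolP.
by exists (fun n => c *: v n + w n); exact: representsP.
Qed.

HB.instance Definition _ := GRing.isSubmodClosed.Build _ _ compl_pred compl_submod.
HB.instance Definition _ := [SubChoice_isSubLmodule of compl by <:].

Definition rep (f : compl) : nat -> V := projT1 (cid (asboolW (compl_funP f))).

Lemma repP (f : compl) : represents (rep f) f.
Proof. exact: (projT2 (cid (asboolW (compl_funP f)))). Qed.

Definition kip (f g : compl) : R[i] :=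
  (limn (fun n => complex.Re (s (rep f n) (rep g n)) : R) +i*
   limn (fun n => complex.Im (s (rep f n) (rep g n)) : R))%C.

Lemma kip_Re v w (f g : compl) : represents v f -> represents w g ->
  (fun n => rip s (v n) (w n)) @ \oo --> complex.Re (kip f g).
Proof.
move=> vf wg; apply: rip_cvg_unique (repP f) vf (repP g) wg _.
exact: (sip_cvg (repP f).1 (repP g).1).1.
Qed.

Lemma kip_Im v w (f g : compl) : represents v f -> represents w g ->
  (fun n => rip s (v n) ('i%C *: w n)) @ \oo --> complex.Im (kip f g).
Proof.
have rep_i u (h : compl) : represents u h -> represents (fun n => 'i%C *: u n) ('i%C *: h : compl).
  move=> uh; have := representsP 'i%C uh (represents_cst 0).
  rewrite (_ : (fun n => _) = fun n => 'i%C *: u n); last first.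
    by apply/funext => n; rewrite addr0.
  rewrite (_ : (fun x => _) = ('i%C *: h : compl))//.
  by apply/funext => x; rewrite sip0l addr0.
move=> vf wg; apply: rip_cvg_unique (repP f) vf (rep_i _ _ (repP g)) (rep_i _ _ wg) _.
rewrite (_ : (fun n => _) = fun n => complex.Im (s (rep f n) (rep g n))).
  exact: (sip_cvg (repP f).1 (repP g).1).2.
by apply/funext => n; rewrite (sip_rip s (rep f n) (rep g n)).
Qed.

Lemma cvgr_unique (u : nat -> R) (a b : R) : u @ \oo --> a -> u @ \oo --> b -> a = b.
Proof. exact: (cvg_unique (@Rhausdorff R)). Qed.

Lemma represents_lin (c : R[i]) v w (f g : compl) : represents v f ->
  represents w g -> represents (fun n => c *: v n + w n) (c *: f + g : compl).
Proof. exact: representsP. Qed.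

Lemma kip_linear h : linear_for *%R (kip ^~ h).
Proof.
move=> c f g; have F := represents_lin c (repP f) (repP g).
have H := repP h; apply: complex_eq.
  apply: cvgr_unique (kip_Re F H) _; rewrite cReD cReM.
  rewrite (_ : (fun n => _) = fun n => complex.Re c * rip s (rep f n) (rep h n)
    - complex.Im c * rip s (rep f n) ('i%C *: rep h n) + rip s (rep g n) (rep h n)).
    apply: cvgD; last exact: kip_Re (repP g) H.
    by apply: cvgB; apply: cvgMl_tmp; [exact: kip_Re (repP f) H|exact: kip_Im (repP f) H].
  apply/funext => n; rewrite ripDl; congr (_ + _).
  by rewrite /rip sipZl cReM (sip_rip s (rep f n) (rep h n)).
apply: cvgr_unique (kip_Im F H) _; rewrite cImD cImM.
rewrite (_ : (fun n => _) = fun n => complex.Re c * rip s (rep f n) ('i%C *: rep h n)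
  + complex.Im c * rip s (rep f n) (rep h n) + rip s (rep g n) ('i%C *: rep h n)).
  apply: cvgD; last exact: kip_Im (repP g) H.
  by apply: cvgD; apply: cvgMl_tmp; [exact: kip_Im (repP f) H|exact: kip_Re (repP f) H].
apply/funext => n; rewrite ripDl; congr (_ + _).
by rewrite /rip !(sipZl, sipZr) !(cReM, cImM) !(cReJ, cImJ) /=; ring.
Qed.

Lemma kip_conj (f g : compl) : kip f g = (kip g f)^*.
Proof.
have F := repP f; have G := repP g.
apply: complex_eq; rewrite ?cReJ ?cImJ.
  apply: cvgr_unique (kip_Re F G) _.
  by under eq_fun do rewrite ripC; exact: kip_Re.
apply: cvgr_unique (kip_Im F G) _.
rewrite (_ : (fun n => _) = fun n => - rip s (rep g n) ('i%C *: rep f n)).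
  by apply: cvgN; exact: kip_Im.
by apply/funext => n; rewrite ripC rip_il.
Qed.

Lemma kip_ge0 (f : compl) : 0 <= kip f f.
Proof.
have := kip_conj f f => /(congr1 (@complex.Im R)); rewrite cImJ => I0.
rewrite lecE; apply/andP; split.
  by apply/eqP; move: I0; set z := complex.Im _; move=> I0; change (z = 0); lra.
apply: (cvgr_to_ge (kip_Re (repP f) (repP f))); apply: nearW => n.
exact: rip_ge0.
Qed.

Definition ksip : sip compl := Sip kip_linear kip_conj kip_ge0.

Lemma cvg_snorm v (f : compl) : represents v f ->
  (fun n => rip s (v n) (v n)) @ \oo --> snorm ksip f ^+ 2.
Proof. by move=> vf; rewrite snorm_sqr; exact: kip_Re. Qed.

(** By Cauchy-Schwarz a sequence whose seminorm tends to 0 defines the zero functional; this does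
    the work of the quotient by null vectors. *)
Lemma ksnorm_eq0 (f : compl) : snorm ksip f = 0 -> f = 0.
Proof.
move=> f0; have F := repP f.
have key y (a : R) : (fun n => rip s (rep f n) y) @ \oo --> a -> a = 0.
  move=> ya; have a2 : (fun n => rip s (rep f n) y * rip s (rep f n) y) @ \oo --> a * a.
    exact: cvgM.
  have b2 : (fun n => rip s (rep f n) (rep f n) * rip s y y) @ \oo --> 0 * rip s y y.
    by apply: cvgMr_tmp; have := cvg_snorm F; rewrite f0 expr0n.
  have : a * a <= 0 * rip s y y.
    apply: (ler_cvg_to a2 b2); apply: nearW => n; rewrite -expr2; exact: ripM.
  rewrite mul0r -expr2 => a0; apply/eqP; rewrite -sqrf_eq0 eq_le a0 sqr_ge0//.
apply: val_inj; apply/funext => y /=; have [h1 h2] := F.2 y.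
apply: complex_eq; first exact: key h1.
apply: (key ('i%C *: y)); rewrite (_ : (fun n => _) = fun n => complex.Im (s (rep f n) y))//.
by apply/funext => n; rewrite [in RHS]sip_rip.
Qed.

Lemma knormD (f g : compl) :
  (snorm ksip (f + g))%:C%C <= (snorm ksip f)%:C%C + (snorm ksip g)%:C%C.
Proof. by rewrite -rmorphD lecR snormD. Qed.

Lemma knormZ (c : R[i]) (f : compl) :
  (snorm ksip (c *: f))%:C%C = `|c| * (snorm ksip f)%:C%C.
Proof. by rewrite snormZ normc_normE -rmorphM. Qed.

Lemma knorm_eq0 (f : compl) : (snorm ksip f)%:C%C = 0 -> f = 0.
Proof. by move=> [] /ksnorm_eq0. Qed.

HB.instance Definition _ := Lmodule_isNormed.Build R[i] compl knormD knormZ knorm_eq0.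

Lemma compl_normE (f : compl) : `|f| = (snorm ksip f)%:C%C.
Proof. by []. Qed.

Lemma ball_complE (f g : compl) (e : R) :
  ball f e%:C%C g <-> snorm ksip (f - g) < e.
Proof.
have -> : ball f e%:C%C g = (`|f - g| < e%:C%C) :> Prop by rewrite -ball_normE.
by rewrite compl_normE ltcR.
Qed.

Lemma emb_mem x : (s x : V -> R[i]^o) \in compl_pred.
Proof. by apply/asboolP; exists (fun=> x); exact: represents_cst. Qed.

Definition emb x : compl := Compl (emb_mem x).

Lemma emb_norm v (f : compl) n : represents v f ->
  (fun m => snorm s (v m - v n)) @ \oo --> snorm ksip (f - emb (v n)).
Proof.
move=> vf; have h := represents_lin (-1) (represents_cst (v n) : represents _ (emb (v n))) vf.
have -> : f - emb (v n) = -1 *: emb (v n) + f by rewrite scaleN1r addrC.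
rewrite (_ : (fun m => _) = fun m => Num.sqrt (rip s (-1 *: v n + v m) (-1 *: v n + v m))).
  rewrite -[X in _ --> X]ger0_norm ?snorm_ge0// -sqrtr_sqr.
  apply: (continuous_cvg _ (@sqrt_continuous _ _)); exact: cvg_snorm h.
by apply/funext => m; rewrite scaleN1r addrC.
Qed.

Lemma emb_dense (f : compl) (e : R) : 0 < e -> exists x, snorm ksip (f - emb x) <= e.
Proof.
move=> e0; have [vC _] := repP f; have [N hN] := vC _ e0; exists (rep f N).
have lim := @emb_norm (rep f) f N (repP f).
apply: (cvgr_to_le lim); exists N => // m /= Nm.
exact/ltW/hN.
Qed.

Lemma embB x y : emb x - emb y = emb (x - y).
Proof. by apply: val_inj; apply/funext => z /=; rewrite sipDl sipNl. Qed.

Lemma snorm_emb x : snorm ksip (emb x) = snorm s x.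
Proof.
have h : represents (fun=> x) (emb x) by exact: represents_cst.
by rewrite /snorm; congr Num.sqrt; apply: cvgr_unique (kip_Re h h) _; exact: cvg_cst.
Qed.

(** Density gives for every [k] a vector of [V] whose ball of radius 1/(k+1) belongs to [F]. Two
    such balls meet, so these vectors form a Cauchy sequence in [V], and the functional it
    represents is the limit. *)
Lemma compl_complete (F : set_system compl) : ProperFilter F -> cauchy F -> cvg F.
Proof.
move=> FF /cauchyP FC.
have /choice[x xP] (k : nat) : exists x, F (ball (emb x) (k.+1%:R^-1)%:C%C).
  have k0 : (0 : R) < k.+1%:R^-1 / 2 by rewrite divr_gt0.
  have k0' : (0 : R[i]) < (k.+1%:R^-1 / 2 : R)%:C%C by rewrite ltcR.
  have [f Ff] := FC _ k0'; have [x fx] := emb_dense f k0; exists x.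
  apply: filterS Ff => g /ball_complE fg; apply/ball_complE.
  rewrite -(subrK f (emb x)) -addrA (le_lt_trans (snormD _ _ _))//.
  rewrite snormB [ltRHS]splitr; exact: (ler_ltD fx fg).
have xx k l : snorm s (x k - x l) < k.+1%:R^-1 + l.+1%:R^-1.
  have [g [gk gl]] := @filter_ex _ _ FF _ (filterI (xP k) (xP l)).
  move: gk gl => /ball_complE gk /ball_complE gl.
  rewrite -snorm_emb -embB -(subrK g (emb (x k))) -addrA (le_lt_trans (snormD _ _ _))//.
  rewrite (snormB _ g); exact: (ltrD gk gl).
have small (e : R) : 0 < e -> exists N, forall n, (N <= n)%N -> n.+1%:R^-1 < e.
  by move=> e0; have [N _ NP] := near_infty_natSinv_lt (PosNum e0); exists N => n /NP.
have xC : scauchy x.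
  move=> e e0; have e2 : 0 < e / 2 by rewrite divr_gt0.
  have [N NP] := small _ e2; exists N => m n Nm Nn.
  by rewrite (lt_trans (xx _ _))// [ltRHS]splitr ltrD// NP.
have [f0 f0P] := represents_ex xC.
have f0m : (f0 : V -> R[i]^o) \in compl_pred by apply/asboolP; exists x.
pose f : compl := Compl f0m.
apply/cvg_ex; exists f; apply/cvg_ballP => e e0.
have eE : e = (complex.Re e)%:C%C.
  by move: e0; rewrite ltcE; case: e => a b /= /andP[/eqP-> _].
move: e0; rewrite eE ltcR; move: (complex.Re e) => {eE}{}e e0.
have e2 : 0 < e / 2 by rewrite divr_gt0.
have [N1 h1] := small _ e2; have [N2 h2] := xC _ e2.
pose k := maxn N1 N2.
apply: filterS (xP k) => g /ball_complE gk; apply/ball_complE.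
rewrite -(subrK (emb (x k)) f) -addrA (le_lt_trans (snormD _ _ _))//.
rewrite [ltRHS]splitr; apply: ler_ltD; last first.
  by apply: lt_trans gk _; apply: h1; exact: leq_maxl.
have lim := @emb_norm x f k f0P.
apply: (cvgr_to_le lim); exists N2 => // m /= Nm.
by apply: ltW; apply: h2 => //; exact: leq_maxr.
Qed.

HB.instance Definition _ := Uniform_isComplete.Build compl compl_complete.

Lemma kip_norm (f : compl) : kip f f = `|f| ^+ 2.
Proof. by rewrite compl_normE -rmorphXn; exact: (snorm_sip ksip f). Qed.

HB.instance Definition _ := isHilbert.Build R compl kip_linear kip_conj kip_norm.

End Completion.

(** * Construction of the normal extension *)

Section Lift.
Variables (R : realType) (V : lmodType R[i]) (s : sip V) (A A' : {linear V -> V}).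
Hypothesis AA' : forall u v, s (A u) v = s u (A' v).
Hypothesis A1 : forall u, snorm s (A u) <= snorm s u.

Lemma represents_lift (v : nat -> V) (f : V -> R[i]) : represents s v f ->
  represents s (A \o v) (f \o A').
Proof.
move=> [vC vf]; split=> [e e0|x /=].
  have [N h] := vC e e0; exists N => m n Nm Nn /=.
  by rewrite -linearB; apply: le_lt_trans (A1 _) (h _ _ Nm Nn).
have [f1 f2] := vf (A' x).
by split; under eq_fun do rewrite AA'.
Qed.

Lemma lift_mem (f : compl s) : (f \o A' : V -> R[i]^o) \in @compl_pred _ _ s.
Proof.
by apply/asboolP; exists (A \o rep f); apply: represents_lift; exact: repP.
Qed.

(** Since s(Av, x) = s(v, A'x), the extension of [A] to functionals is composition with its adjoint
    [A'], and no limit has to be taken. *)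
Definition lift_fun f : compl s := Compl (lift_mem f).

Lemma lift_linear : linear lift_fun.
Proof. by move=> c f g; apply: val_inj; apply/funext. Qed.

Definition lift_lin : {linear compl s -> compl s} :=
  HB.pack lift_fun (GRing.isLinear.Build _ _ _ _ _ lift_linear).

Lemma lift_snorm (f : compl s) : snorm (ksip s) (lift_fun f) <= snorm (ksip s) f.
Proof.
have F := repP f; have L : represents s _ (lift_fun f) := represents_lift F.
apply: ler_wsqrtr; apply: (ler_cvg_to (kip_Re L L) (kip_Re F F)).
apply: nearW => n; rewrite /= -!snorm_sqr.
by rewrite ler_pXn2r// ?nnegrE ?snorm_ge0//; exact: A1.
Qed.

Lemma lift_bounded : bounded_near lift_lin (nbhs (0 : compl s)).
Proof.
apply/bounded_funP => r; exists r => f; apply: le_trans.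
by rewrite !compl_normE lecR; exact: lift_snorm.
Qed.

Definition lift_bop : bop (compl s) := BOp lift_bounded.

End Lift.

Lemma lift_adj (R : realType) (V : lmodType R[i]) (s : sip V) (A A' : {linear V -> V})
  (AA' : forall u v, s (A u) v = s u (A' v))
  (AA : forall u v, s (A' u) v = s u (A v))
  (A1 : forall u, snorm s (A u) <= snorm s u)
  (A'1 : forall u, snorm s (A' u) <= snorm s u) (f g : compl s) :
  inner (lift_bop AA' A1 f) g = inner f (lift_bop AA A'1 g).
Proof.
have F := repP f; have G := repP g.
have F' : represents s _ (lift_fun AA' A1 f) := represents_lift AA' A1 F.
have G' : represents s _ (lift_fun AA A'1 g) := represents_lift AA A'1 G.
change (kip (lift_fun AA' A1 f) g = kip f (lift_fun AA A'1 g)).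
apply: complex_eq.
  apply: cvgr_unique (kip_Re F' G) _.
  rewrite (_ : (fun n => _) = fun n => rip s (rep f n) ((A' \o rep g) n)).
    exact: kip_Re F G'.
  by apply/funext => n; rewrite /rip AA'.
apply: cvgr_unique (kip_Im F' G) _.
rewrite (_ : (fun n => _) = fun n => rip s (rep f n) ('i%C *: (A' \o rep g) n)).
  exact: kip_Im F G'.
by apply/funext => n; rewrite /rip AA' linearZ.
Qed.

(** * The pre-Hilbert space of finitely supported sequences *)

Section Dilation.
Variables (R : realType) (H : hilbertType R) (T : bop H).
Local Notation hs := (hsip H).
Hypothesis hform_mono_ge0 :
  forall i j u, 0 <= hform hs T ('X^i * (1 - 'X) ^+ j) u u.

Definition fs_pred : {pred nat -> H} :=
  fun u => `[< exists N, forall n, (N <= n)%N -> u n = 0 >].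

Record fsupp := Fsupp { fs_fun :> nat -> H ; fs_funP : fs_fun \in fs_pred }.
HB.instance Definition _ := [isSub for fs_fun].
HB.instance Definition _ := [Choice of fsupp by <:].

Lemma fs_submod : submod_closed fs_pred.
Proof.
split; first by apply/asboolP; exists 0%N.
move=> c u v /asboolP[M uM] /asboolP[N vN]; apply/asboolP.
exists (maxn M N) => n; rewrite geq_max => /andP[Mn Nn].
by rewrite !fctE uM// vN// scaler0 addr0.
Qed.

HB.instance Definition _ := GRing.isSubmodClosed.Build R[i] (nat -> H) fs_pred fs_submod.
HB.instance Definition _ := [SubChoice_isSubLmodule of fsupp by <:].

Lemma fs_bound (u : fsupp) : exists N, forall n, (N <= n)%N -> u n = 0.
Proof. exact: (asboolW (fs_funP u)). Qed.

Definition fs_size u := projT1 (cid (fs_bound u)).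

Lemma fs_sizeP u n : (fs_size u <= n)%N -> u n = 0.
Proof. exact: (projT2 (cid (fs_bound u))). Qed.

(* The finitely supported sequence [u] stands for the vector [\sum_k N^{*k} u_k],
   where [N] is the normal extension of [T] to be constructed. *)
Definition bip_upto n (u v : nat -> H) : R[i] :=
  \sum_(k < n) \sum_(l < n) inner (iter l T (u k)) (iter k T (v l)).

Definition bip (u v : fsupp) := bip_upto (maxn (fs_size u) (fs_size v)) u v.

Lemma iterT0 n : iter n T 0 = 0.
Proof. by elim: n => //= n ->; rewrite linear0. Qed.

Lemma inner0l (x : H) : inner 0 x = 0. Proof. exact: (sip0l hs). Qed.

Lemma inner0r (x : H) : inner x 0 = 0.
Proof. by rewrite inner_conj inner0l conjC0. Qed.

Lemma bip_uptoS n m (u v : nat -> H) : (n <= m)%N ->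
  (forall k, (n <= k)%N -> u k = 0) -> (forall k, (n <= k)%N -> v k = 0) ->
  bip_upto n u v = bip_upto m u v.
Proof.
move=> nm un vn; rewrite /bip_upto.
rewrite (big_ord_widen m (fun k => \sum_(l < n) inner (iter l T (u k)) (iter k T (v l))) nm).
rewrite big_mkcond; apply: eq_bigr => k _; case: ifPn => [kn|].
  rewrite (big_ord_widen m (fun l => inner (iter l T (u k)) (iter k T (v l))) nm).
  rewrite big_mkcond; apply: eq_bigr => l _; case: ifPn => //.
  by rewrite -leqNgt => nl; rewrite (vn l nl) iterT0 inner0r.
rewrite -leqNgt => nk; rewrite big1// => l _.
by rewrite (un k nk) iterT0 inner0l.
Qed.

Lemma bipE n (u v : fsupp) : (forall k, (n <= k)%N -> u k = 0) ->
  (forall k, (n <= k)%N -> v k = 0) -> bip u v = bip_upto n u v.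
Proof.
move=> un vn; set N := maxn (fs_size u) (fs_size v).
have uN k : (N <= k)%N -> u k = 0 by rewrite geq_max => /andP[/fs_sizeP].
have vN k : (N <= k)%N -> v k = 0 by rewrite geq_max => /andP[_ /fs_sizeP].
rewrite /bip -/N (@bip_uptoS N (maxn N n)) ?leq_maxl//.
by rewrite [RHS](@bip_uptoS n (maxn N n)) ?leq_maxr.
Qed.

Lemma iterTP n (c : R[i]) x y : iter n T (c *: x + y) = c *: iter n T x + iter n T y.
Proof. exact: iter_linear. Qed.

Lemma bip_linear w : linear_for *%R (bip ^~ w).
Proof.
move=> c u v; pose n := maxn (fs_size u) (maxn (fs_size v) (fs_size w)).
have un k : (n <= k)%N -> u k = 0 by rewrite geq_max => /andP[/fs_sizeP].
have vn k : (n <= k)%N -> v k = 0 by rewrite !geq_max => /and3P[_ /fs_sizeP].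
have wn k : (n <= k)%N -> w k = 0 by rewrite !geq_max => /and3P[_ _ /fs_sizeP].
have cn k : (n <= k)%N -> (c *: u + v : fsupp) k = 0.
  by move=> nk; rewrite /= !fctE un// vn// scaler0 addr0.
rewrite (bipE cn wn) (bipE un wn) (bipE vn wn) /bip_upto mulr_sumr -big_split.
apply: eq_bigr => k _; rewrite /= mulr_sumr -big_split; apply: eq_bigr => l _.
by rewrite /= !fctE iterTP inner_linear.
Qed.

Lemma bip_conj u v : bip u v = (bip v u)^*.
Proof.
rewrite /bip maxnC /bip_upto rmorph_sum /= exchange_big /=; apply: eq_bigr => k _.
rewrite rmorph_sum /=; apply: eq_bigr => l _; exact: inner_conj.
Qed.

Lemma bip_upto_Re n (u : nat -> H) : complex.Re (bip_upto n u u) = bhform hs T n u 1.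
Proof.
have ReS m (F : 'I_m -> R[i]) : complex.Re (\sum_(i < m) F i) = \sum_(i < m) complex.Re (F i).
  by apply: (big_morph (@complex.Re R)) => [x y|]; rewrite ?cReD.
rewrite /bip_upto /bhform ReS; apply: eq_bigr => k _; rewrite ReS; apply: eq_bigr => l _.
by rewrite /hform -(expr0 'X) momentXn.
Qed.

Lemma bip_ge0 u : 0 <= bip u u.
Proof.
have := bip_conj u u => /(congr1 (@complex.Im R)); rewrite cImJ => I0.
rewrite lecE; apply/andP; split.
  by apply/eqP; move: I0; set z := complex.Im _; move=> I0; change (z = 0); lra.
by rewrite /bip bip_upto_Re; apply: bhform_ge0 => //; exact: bcone1.
Qed.

Definition bsip : sip fsupp := Sip bip_linear bip_conj bip_ge0.

Lemma opT_mem (u : fsupp) : (fun k => T (u k)) \in fs_pred.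
Proof.
by apply/asboolP; exists (fs_size u) => n /fs_sizeP ->; rewrite linear0.
Qed.

Lemma shift_mem (u : fsupp) : (fun k => if k is k'.+1 then u k' else 0) \in fs_pred.
Proof.
by apply/asboolP; exists (fs_size u).+1 => -[|n]//; exact: fs_sizeP.
Qed.

(** As [u] stands for \sum_k N^{*k} u_k, the operator N must act entrywise by [T], for it commutes
    with its adjoint and extends [T]; the adjoint must act as [shift]. That the two commute exactly
    is the normality of N. *)
Definition opT u := Fsupp (opT_mem u).
Definition shift u := Fsupp (shift_mem u).

Lemma opT_linear : linear opT.
Proof.
by move=> c u v; apply: val_inj; apply/funext => k /=; rewrite !fctE linearP.
Qed.

Lemma shift_linear : linear shift.
Proof.
move=> c u v; apply: val_inj; apply/funext => -[|k] //=.
by rewrite !fctE scaler0 addr0.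
Qed.

Definition opTL : {linear fsupp -> fsupp} :=
  HB.pack opT (GRing.isLinear.Build _ _ _ _ _ opT_linear).
Definition shiftL : {linear fsupp -> fsupp} :=
  HB.pack shift (GRing.isLinear.Build _ _ _ _ _ shift_linear).

Lemma opT_shift u : opT (shift u) = shift (opT u).
Proof.
by apply: val_inj; apply/funext => -[|k] //=; rewrite linear0.
Qed.

Lemma opT_adj u v : bsip (opTL u) v = bsip u (shiftL v).
Proof.
pose n := maxn (fs_size u) (fs_size v).
have un k : (n <= k)%N -> u k = 0 by rewrite geq_max => /andP[/fs_sizeP].
have vn k : (n <= k)%N -> v k = 0 by rewrite geq_max => /andP[_ /fs_sizeP].
rewrite /= (@bipE n) => [|k nk|]//; last by rewrite /= un// linear0.
(* The shift lengthens the support by one. The additional outer term [k = n] vanishes with [u n],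
   the inner term [l = 0] with the leading zero of the shift. *)
rewrite (@bipE n.+1); first last.
- by case=> // k nk; exact: vn.
- by move=> k /ltnW; exact: un.
rewrite /bip_upto big_ord_recr /= [X in _ = _ + X]big1 ?addr0; last first.
  by move=> l _; rewrite un// iterT0 inner0l.
apply: eq_bigr => k _; rewrite big_ord_recl /= iterT0 inner0r add0r.
by apply: eq_bigr => l _; rewrite -iterSr.
Qed.

Lemma shift_adj u v : bsip (shiftL u) v = bsip u (opTL v).
Proof. by rewrite sip_conj -opT_adj -sip_conj. Qed.

Lemma bhform_bip n (u : nat -> H) :
  bhform hs T n u 'X = complex.Re (bip_upto n (fun k => T (u k)) (fun k => T (u k))).
Proof.
rewrite bip_upto_Re; apply: eq_bigr => k _; apply: eq_bigr => l _.
by rewrite -['X]mulr1 -['X]expr1 hformXM /= -!iterSr.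
Qed.

(** The difference of the squares is the Bram-Halmos form with weight [1 - 'X], which is why
    [bhform_ge0] is proved for all weights in [bcone]. *)
Lemma opT_le u : snorm bsip (opTL u) <= snorm bsip u.
Proof.
apply: ler_wsqrtr; have un k : (fs_size u <= k)%N -> u k = 0 by exact: fs_sizeP.
have Tun k : (fs_size u <= k)%N -> opT u k = 0 by move=> /un /= ->; rewrite linear0.
have -> : rip bsip (opTL u) (opTL u) = bhform hs T (fs_size u) u 'X.
  by rewrite bhform_bip /rip /= (bipE Tun Tun).
have -> : rip bsip u u = bhform hs T (fs_size u) u 1.
  by rewrite -bip_upto_Re /rip /= (bipE un un).
rewrite -subr_ge0.
have -> : bhform hs T (fs_size u) u 1 - bhform hs T (fs_size u) u 'X =
    bhform hs T (fs_size u) u (1 - 'X).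
  by apply/eqP; rewrite subr_eq -bhformD subrK.
by apply: bhform_ge0 => //; exact: (bconeY _ 1).
Qed.

(** Commutation and adjointness give [shiftL u] the same seminorm as [opTL u]. *)
Lemma shift_le u : snorm bsip (shiftL u) <= snorm bsip u.
Proof.
apply: le_trans (opT_le u); rewrite /snorm /rip shift_adj.
have -> : opTL (shiftL u) = shiftL (opTL u) by exact: opT_shift.
by rewrite opT_adj.
Qed.

Lemma start_mem (h : H) : (fun k => if k is 0%N then h else 0) \in fs_pred.
Proof. by apply/asboolP; exists 1%N => -[]. Qed.

Definition start h := Fsupp (start_mem h).

Lemma start_bip g h : bsip (start g) (start h) = inner g h.
Proof.
rewrite /= (@bipE 1) => [|[]//|[]//].
by rewrite /bip_upto !big_ord_recl !big_ord0 !addr0.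
Qed.

Definition start_emb h : compl bsip := emb bsip (start h).

Lemma start_emb_linear : linear start_emb.
Proof.
move=> c g h; apply: val_inj; apply/funext => v /=.
have -> : start (c *: g + h) = c *: start g + start h.
  by apply: val_inj; apply/funext => -[|k] //=; rewrite !fctE scaler0 addr0.
exact: bip_linear.
Qed.

Lemma subnormal_of_hform : subnormal T.
Proof.
pose J : {linear H -> compl bsip} :=
  HB.pack start_emb (GRing.isLinear.Build _ _ _ _ _ start_emb_linear).
pose N : bop (compl bsip) := lift_bop opT_adj opT_le.
pose N' : bop (compl bsip) := lift_bop shift_adj shift_le.
have adjN : adj N =1 N' by apply: adj_unique => f g; exact: lift_adj.
exists (compl bsip), J, N; split.
- move=> h; rewrite compl_normE norm_rnorm /= snorm_emb rnormE.
  by rewrite /snorm /rip start_bip.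
- move=> f; rewrite !adjN; apply: val_inj; apply/funext => v /=.
  by rewrite opT_shift.
- move=> h; apply: val_inj; apply/funext => v /=.
  rewrite -[RHS]/(bsip (start h) (shiftL v)) -opT_adj.
  have -> // : start (T h) = opT (start h).
  by apply: val_inj; apply/funext => -[|k] //=; rewrite linear0.
Qed.

End Dilation.

(** * Conditionally positive definite operators *)

Section Contraction.
Variables (R : realType) (H : hilbertType R) (T : bop H).

Lemma rnorm0 : rnorm (0 : H) = 0.
Proof. by rewrite rnormE snorm0. Qed.

Lemma contraction_opP : contraction_op T <-> forall h, rnorm (T h) <= rnorm h.
Proof.
rewrite /contraction_op /opnorm; set A := [set _ | _ in _]; split=> [A1 h|T1].
  have [r r0 Tr] := bop_le T.
  (* The supremum of an unbounded set is a default value, so [A1] says something only once [A] is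
     known to be bounded. *)
  have A_sup : has_sup A.
    split; first by exists (rnorm (T 0)), 0 => //=; rewrite rnorm0.
    exists r => _ [g /= g1 <-]; apply: le_trans (Tr g) _.
    by rewrite -[leRHS]mulr1 ler_wpM2l.
  have T1 g : rnorm g <= 1 -> rnorm (T g) <= 1.
    move=> g1; apply: le_trans A1.
    by apply: ub_le_sup; [exact: A_sup.2|exists g].
  have [h0|h0] := eqVneq (rnorm h) 0.
    by rewrite (rnorm_eq0 h0) linear0 rnorm0.
  have hp : 0 < rnorm h by rewrite lt_def h0 rnorm_ge0.
  pose c : R[i] := ((rnorm h)^-1)%:C%C.
  have cE : normc c = (rnorm h)^-1.
    by rewrite /= expr0n addr0 sqrtr_sqr ger0_norm// invr_ge0 ltW.
  have := T1 (c *: h); rewrite linearZ !rnormZ cE mulVf// lexx => /(_ isT).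
  rewrite mulrC ler_pdivrMr//.
  by rewrite mul1r.
apply: ge_sup; first by exists (rnorm (T 0)), 0 => //=; rewrite rnorm0.
by move=> _ [g /= g1 <-]; exact: le_trans (T1 g) g1.
Qed.

End Contraction.

Section InnerSums.
Variables (R : realType) (H : hilbertType R).

Lemma inner_suml (I : Type) (r : seq I) (P : pred I) (f : I -> H) (x : H) :
  inner (\sum_(i <- r | P i) f i) x = \sum_(i <- r | P i) inner (f i) x.
Proof.
by apply: (big_morph (inner^~ x)) => [a b|]; [exact: (sipDl (hsip H))|exact: inner0l].
Qed.

Lemma inner_sumr (I : Type) (r : seq I) (P : pred I) (f : I -> H) (x : H) :
  inner x (\sum_(i <- r | P i) f i) = \sum_(i <- r | P i) inner x (f i).
Proof.
apply: (big_morph (inner x)) => [a b|]; [exact: (sipDr (hsip H))|exact: inner0r].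
Qed.

End InnerSums.

(** By normality the products N^{*i} N^i are selfadjoint and multiply like powers, so the Hankel
    matrix of the squared norms is a Gram matrix. *)
Lemma normal_moment (R : realType) (K : hilbertType R) (N : bop K) x i j :
  normal_op N ->
  inner (iter i (adj N) (iter i N x)) (iter j (adj N) (iter j N x)) =
  ((rnorm (iter (i + j) N x)) ^+ 2)%:C%C.
Proof.
move=> nN; have aE a b : inner (adj N a) b = inner a (N b).
  by rewrite inner_conj -adjE -inner_conj.
have aiE n a b : inner (iter n (adj N) a) b = inner a (iter n N b).
  by elim: n a b => //= n IH a b; rewrite aE IH -iterSr.
have iaE n a b : inner (iter n N a) b = inner a (iter n (adj N) b).
  by elim: n a b => //= n IH a b; rewrite adjE IH -iterSr.
have com1 n y : iter n (adj N) (N y) = N (iter n (adj N) y).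
  by elim: n => //= n ->; rewrite nN.
have com m n y : iter m N (iter n (adj N) y) = iter n (adj N) (iter m N y).
  by elim: m => //= m ->; rewrite com1.
by rewrite aiE com -iaE -!iterD (addnC j i) inner_norm norm_rnorm -rmorphXn.
Qed.

Lemma subnormal_cpd (R : realType) (H : hilbertType R) (T : bop H) :
  subnormal T -> cpd_op T.
Proof.
move=> [K [J [N [Jn nN JT]]]] h k lam _.
have JTn n : J (iter n T h) = iter n N (J h).
  by elim: n => //= n IH; rewrite JT IH.
pose y i := iter i (adj N) (iter i N (J h)).
have -> : \sum_(i < k.+1) \sum_(j < k.+1)
    (rnorm (iter (i + j) T h) ^+ 2)%:C%C * lam i * (lam j)^* =
  inner (\sum_(i < k.+1) lam i *: y i) (\sum_(i < k.+1) lam i *: y i).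
  rewrite inner_suml; apply: eq_bigr => i _; rewrite inner_sumr; apply: eq_bigr => j _.
  have -> : inner (lam i *: y i) (lam j *: y j) = lam i * ((lam j)^* * inner (y i) (y j)).
    by rewrite [LHS](sipZl (hsip K)) [X in _ * X](sipZr (hsip K)).
  rewrite normal_moment// -JTn.
  have -> : rnorm (J (iter (i + j) T h)) = rnorm (iter (i + j) T h).
    by rewrite /rnorm Jn.
  by rewrite -mulrA mulrC -mulrA.
exact: inner_ge0.
Qed.

Section CpdContraction.
Variables (R : realType) (H : hilbertType R) (T : bop H).
Local Notation gam h := (fun n => rnorm (iter n T h) ^+ 2 : R).
Local Notation L h p := (hform (hsip H) T p h h).

Lemma contraction_cvg_series h : contraction_op T ->
  cvgn (series (fun n => rnorm (iter n.+1 T h) ^+ 2 - rnorm (iter n T h) ^+ 2 : R)).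
Proof.
move=> /contraction_opP T1.
have g0 n : 0 <= gam h n by exact: sqr_ge0.
have gS : nonincreasing_seq (gam h).
  apply/nonincreasing_seqP => n /=.
  by rewrite ler_pXn2r ?nnegrE ?rnorm_ge0.
have gc : cvgn (gam h).
  apply: nonincreasing_is_cvgn => //; exists 0 => _ [n _ <-]; exact: g0.
rewrite (_ : series _ = fun n => gam h n - gam h 0%N).
  by apply: is_cvgB => //; exact: is_cvg_cst.
by apply/funext => n; rewrite /series /= telescope_sumr.
Qed.

Hypothesis cT : cpd_op T.

Lemma L_gam h p : L h p = moment (gam h) p.
Proof. by apply: eq_bigr => i _; rewrite -snorm_sqr -rnormE. Qed.

Lemma cpd_sqr h (q : {poly R}) : q.[1] = 0 -> 0 <= L h (q * q).
Proof.
(* With the coefficients of [q] as scalars, the constraint on their sum reads q(1) = 0. As [cpd_seq]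
   has [k.+1] indices, [k := size q] adds one zero coefficient and covers [q = 0]. *)
move=> q1; have := cT h (k := size q) (lambda := fun i => (q`_i)%:C%C).
have sq : (size q <= (size q).+1)%N by [].
have -> : \sum_(i < (size q).+1) (q`_i)%:C%C = 0 :> R[i].
  rewrite -rmorph_sum; suff -> : \sum_(i < (size q).+1) q`_i = 0 by [].
  transitivity q.[1]; last exact: q1.
  by rewrite (horner_coef_wide _ sq); apply: eq_bigr => i _; rewrite expr1n mulr1.
move=> /(_ erefl).
have -> : \sum_(i < (size q).+1) \sum_(j < (size q).+1)
    (rnorm (iter (i + j) T h) ^+ 2)%:C%C * (q`_i)%:C%C * ((q`_j)%:C%C)^* = (L h (q * q))%:C%C.
  rewrite L_gam momentM (momentE _ sq) rmorph_sum /=; apply: eq_bigr => i _.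
  rewrite (momentE _ sq) rmorphM rmorph_sum /= mulr_sumr; apply: eq_bigr => j _.
  by rewrite [X in _ * X = _]conjc_real -!rmorphM /=; congr (_%:C)%C; ring.
by rewrite lecR.
Qed.

Hypothesis dT : forall h, (fun n => rnorm (iter n.+1 T h) ^+ 2 - rnorm (iter n T h) ^+ 2 : R)
  @ \oo --> (0 : R).

Lemma L_XM h n p : L h ('X^n * p) = L (iter n T h) p.
Proof. exact: hformXM. Qed.

Lemma L_cvg0 h (r : {poly R}) : (fun n => L h ('X^n * ((1 - 'X) * r))) @ \oo --> (0 : R).
Proof.
have E n : L h ('X^n * ((1 - 'X) * r)) = \sum_(i < size r) r`_i *
   - (gam h (i + n).+1 - gam h (i + n)%N).
  rewrite L_gam mulrA mulrC momentM; apply: eq_bigr => i _; congr (_ * _).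
  rewrite mulrBr mulr1 -exprSr linearB /= !momentXn addnS; ring.
have lim : (fun n => \sum_(i < size r) r`_i * - (gam h (i + n).+1 - gam h (i + n)%N))
    @ \oo --> \sum_(i < size r) r`_i * - (0 : R).
  apply: cvgr_sum => i; apply: cvgMl_tmp; apply: cvgN.
  rewrite (_ : (fun n => _) = fun n => (fun n => gam h n.+1 - gam h n) (n + i)%N).
    by rewrite (cvg_shiftn i (fun n => gam h n.+1 - gam h n)); exact: dT.
  by apply/funext => n; rewrite addnC.
rewrite big1 in lim; last by move=> i _; rewrite oppr0 mulr0.
by under eq_fun do rewrite E.
Qed.

Lemma L_odd h m : 0 <= L h ((1 - 'X) ^+ (m.*2.+1)).
Proof.
pose c n := L h ('X^n * (1 - 'X) ^+ (m.*2.+1)).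
have cS : nonincreasing_seq c.
  apply/nonincreasing_seqP => n; rewrite -subr_ge0.
  (* The factor ['X^n] is absorbed into the vector, so that a pure square vanishing at 1 remains and
     conditional positivity is applied at [iter n T h]. *)
  have -> : c n - c n.+1 = L (iter n T h) ((1 - 'X) ^+ m.+1 * (1 - 'X) ^+ m.+1).
    rewrite -L_XM /c /hform -linearB /=; congr moment.
    rewrite -exprD addnn doubleS (exprS 'X) (exprS _ m.*2.+1).
    by move: ((1 - 'X) ^+ m.*2.+1) => z; ring.
  by apply: cpd_sqr; rewrite horner_exp !hornerE subrr expr0n.
have c0 : c @ \oo --> (0 : R) by rewrite /c exprS; exact: L_cvg0.
have := nonincreasing_cvgn_ge cS (cvgP _ c0) 0.
by rewrite (cvg_lim _ c0)// /c expr0 mul1r.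
Qed.

Lemma cpd_hform_mono_ge0 i j h : 0 <= L h ('X^i * (1 - 'X) ^+ j).
Proof.
rewrite L_XM; move: (iter i T h) => {}h; rewrite -(odd_double_half j).
case: (odd j); first exact: L_odd.
case: j./2 => [|m].
  by rewrite expr0 -(expr0 'X) L_gam momentXn /= sqr_ge0.
rewrite add0n -addnn exprD; apply: cpd_sqr.
by rewrite horner_exp !hornerE subrr expr0n.
Qed.

End CpdContraction.

(** * Integration against a semispectral measure *)

Import HBNNSimple.

Section MeasureFamily.
Variables (R : realType) (H : hilbertType R).
Local Notation RT := (measurableTypeR R).
Variables (m : H -> {measure set RT -> \bar R}) (M : R).
Hypothesis mq : forall A : set RT, measurable A -> isquad (fun h => fine (m h A)).
Hypothesis mM : forall h, (m h setT <= (M * rnorm h ^+ 2)%:E)%E.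

Lemma mfam_fin h (A : set RT) : measurable A -> m h A \is a fin_num.
Proof.
move=> mA; rewrite ge0_fin_numE// (@le_lt_trans _ _ (m h setT))//.
  by apply: le_measure => //; rewrite inE.
by rewrite (le_lt_trans (mM h))// ltry.
Qed.

Lemma mfam_le h (A : set RT) : measurable A -> fine (m h A) <= M * rnorm h ^+ 2.
Proof.
move=> mA; rewrite -lee_fin fineK ?mfam_fin// (le_trans _ (mM h))//.
by apply: le_measure => //; rewrite inE.
Qed.

Lemma sintegral_isquad (f : {nnsfun RT >-> R}) :
  isquad (fun h => fine (sintegral (m h) f)) /\
  exists C, forall h, fine (sintegral (m h) f) <= C * rnorm h ^+ 2.
Proof.
have E h : fine (sintegral (m h) f) =
    \sum_(x <- fset_set (range f)) x * fine (m h (f @^-1` [set x])).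
  rewrite sintegralE fsbig_finite//= (eq_bigr (fun x => (x * fine (m h (f @^-1` [set x])))%:E)).
    by rewrite sumEFin.
  by move=> x _; rewrite EFinM fineK// mfam_fin.
split.
  by under eq_fun do rewrite E; apply: isquad_sum => x; exact: mq.
exists (\sum_(x <- fset_set (range f)) `|x| * M) => h; rewrite E mulr_suml.
apply: ler_sum => x _; rewrite -mulrA.
apply: (@le_trans _ _ (`|x| * fine (m h (f @^-1` [set x])))).
  by rewrite ler_wpM2r ?fine_ge0// ler_norm.
by rewrite ler_wpM2l// mfam_le.
Qed.

(** Simple functions increasing to [zeta] give bounded forms whose constants may tend to infinity
    when [zeta] is unbounded; [isquad_sup_bounded] still bounds the limit. *)
Lemma integral_isquad (D : set RT) (zeta : RT -> R) : measurable D ->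
  measurable_fun D zeta -> (forall x, D x -> 0 <= zeta x) ->
  (forall h, (m h).-integrable D (EFin \o zeta)) ->
  isquad (fun h => \int[m h]_(x in D) zeta x) /\
  exists C, forall h, \int[m h]_(x in D) zeta x <= C * rnorm h ^+ 2.
Proof.
move=> mD mz z0 iz.
pose f : RT -> \bar R := EFin \o zeta.
have mf : measurable_fun D f by exact/measurable_EFinP.
pose g := nnsfun_approx mD mf.
have fz0 x : D x -> (0 <= f x)%E by move=> Dx; rewrite lee_fin z0.
pose phi n : {nnsfun RT >-> R} := proj_nnsfun (g n) mD.
have E n h : (\int[m h]_(x in D) (g n x)%:E)%E = sintegral (m h) (phi n).
  by rewrite integral_nnsfun// mrestrict.
have gz n x : D x -> ((g n x)%:E <= (zeta x)%:E)%E.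
  move=> Dx; have c := cvg_nnsfun_approx mD mf fz0 Dx.
  have -> : (zeta x)%:E = limn (EFin \o (g ^~ x)) by rewrite (cvg_lim _ c).
  apply: lime_ge; first exact: (cvgP _ c).
  exists n => // k /= nk; rewrite lee_fin.
  by have /lefP := nd_nnsfun_approx mD mf nk; exact.
have lim h : (fun n => (\int[m h]_(x in D) (g n x)%:E)%E) @ \oo -->
    (\int[m h]_(x in D) (zeta x)%:E)%E.
  have := @cvg_monotone_convergence _ RT R (m h) D mD (fun n x => (g n x)%:E).
  move=> /(_ _ _ _); rewrite (eq_integral (EFin \o zeta)); last first.
    move=> x; rewrite inE => Dx.
    exact: (cvg_lim (@ereal_hausdorff R) (cvg_nnsfun_approx mD mf fz0 Dx)).
  apply.
  - move=> n; apply/measurable_EFinP; exact: measurable_funTS.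
  - by move=> n x Dx; rewrite lee_fin.
  - move=> x Dx n k nk; rewrite lee_fin.
    by have /lefP := nd_nnsfun_approx mD mf nk; exact.
have zfin h : (\int[m h]_(x in D) (zeta x)%:E)%E \is a fin_num.
  exact: integrable_fin_num.
pose q n h := fine (sintegral (m h) (phi n)).
have /choice[C CP] n := (sintegral_isquad (phi n)).2.
apply: (@isquad_sup_bounded _ _ q _ C) => [n|n h|n h|h].
- exact: (sintegral_isquad (phi n)).1.
- by rewrite CP andbT; apply: fine_ge0; exact: sintegral_ge0.
- have gq : (\int[m h]_(x in D) (g n x)%:E <= \int[m h]_(x in D) (zeta x)%:E)%E.
    apply: ge0_le_integral => //.
    + by move=> x Dx; rewrite lee_fin.
    + by apply/measurable_EFinP; exact: measurable_funTS.
    + exact: gz.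
  have -> : q n h = fine (\int[m h]_(x in D) (g n x)%:E)%E by rewrite E.
  rewrite /Rintegral fine_le//.
  rewrite ge0_fin_numE; last by apply: integral_ge0 => x Dx; rewrite lee_fin.
  by rewrite (le_lt_trans gq)// -ge0_fin_numE// integral_ge0.
- apply: fine_cvg; rewrite fineK//.
  by under eq_fun do rewrite -E; exact: lim.
Qed.

End MeasureFamily.

Section OperatorIntegral.
Variables (R : realType) (H : hilbertType R) (F : semispectral H).

Lemma inner_ssm h (D : set R) : measurable D -> D `<=` Rplus R ->
  inner (F D h) h = (complex.Re (inner (F D h) h))%:C%C.
Proof.
move=> mD DR; have := ssm_ge0 F mD DR h; rewrite lecE.
by case: (inner _ _) => a b /= /andP[/eqP-> _].
Qed.

Lemma ssm_scalarE h (D : set R) : measurable D ->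
  ssm_scalar F h D = (complex.Re (inner (F (D `&` Rplus R) h) h))%:E.
Proof. by move=> mD; rewrite /ssm_scalar asboolT. Qed.

Lemma ssm_scalar_isquad (D : set R) : measurable D ->
  isquad (fun h => fine (ssm_scalar F h D)).
Proof.
move=> mD; rewrite (_ : (fun h => _) = fun h => rip (hsip H) (F (D `&` Rplus R) h) h).
  exact: isquad_sip.
by apply/funext => h; rewrite ssm_scalarE.
Qed.

Lemma ssm_scalar_le :
  exists M, forall h, (ssm_scalar F h setT <= (M * rnorm h ^+ 2)%:E)%E.
Proof.
have [r r0 rF] := bop_le (F (setT `&` Rplus R)); exists r => h.
rewrite ssm_scalarE// lee_fin; apply: le_trans (ler_norm _) _.
apply: le_trans (rip_le (hsip H) _ _) _; rewrite -!rnormE expr2 mulrA.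
by rewrite ler_wpM2r// rnorm_ge0.
Qed.

(** As [opint] is a [get], its specification rests on exhibiting an operator with these diagonal
    values; [quad_bop] provides one. *)
Lemma opintP (D : set R) (zeta : R -> R) : measurable D ->
  measurable_fun D zeta -> (forall x, D x -> 0 <= zeta x) ->
  (forall h, (ssm_scalar F h).-integrable D (EFin \o zeta)) ->
  forall h, inner (opint F D zeta h) h = (\int[ssm_scalar F h]_(x in D) zeta x)%:C%C.
Proof.
move=> mD mz z0 iz; have [M FM] := ssm_scalar_le.
have [Qq [C QC]] := integral_isquad (m := ssm_scalar F) ssm_scalar_isquad FM mD mz z0 iz.
have [|S [_ SP]] := quad_bop Qq (M := C).
  by move=> h; rewrite ger0_norm//; apply: Rintegral_ge0.
have ex : exists S : bop H, [set S : bop H |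
    forall h, inner (S h) h = (\int[ssm_scalar F h]_(x in D) zeta x)%:C%C] S by exists S.
exact: (getPex ex).
Qed.

End OperatorIntegral.

Section FormEquality.
Variables (R : realType) (H : hilbertType R).

(** Complex polarization. It is stated for linear functions because the two sides of the identities
    to be proved are sums and iterates that are not packaged as [bop]. *)
Lemma quad_inj (f g : H -> H) : linear f -> linear g ->
  (forall h, inner (f h) h = inner (g h) h) -> f =1 g.
Proof.
move=> lf lg fg x; apply: rip_inj => y.
have addl (k : H -> H) u v : linear k -> k (u + v) = k u + k v.
  by move=> lk; have := lk 1 u v; rewrite !scale1r.
have scl (k : H -> H) c u : linear k -> k (c *: u) = c *: k u.
  move=> lk; have k0 : k 0 = 0 by apply: (addrI (k 0)); rewrite -addl// !addr0.
  by have := lk c u 0; rewrite k0 !addr0.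
pose d u v := rip (hsip H) (f u) v - rip (hsip H) (g u) v.
have dDl u u' v : d (u + u') v = d u v + d u' v.
  by rewrite /d !addl// !ripDl; ring.
have dDr u v v' : d u (v + v') = d u v + d u v' by rewrite /d !ripDr; ring.
have d0 h : d h h = 0 by rewrite /d /rip /= fg subrr.
have di h : d h ('i%C *: h) = 0.
  by have := fg h; rewrite !inner_rip => -[_ e]; rewrite /d e subrr.
have dil u v : d ('i%C *: u) v = - d u ('i%C *: v).
  by rewrite /d !scl// !rip_il; ring.
have A u v : d u v + d v u = 0.
  by have := d0 (u + v); rewrite dDl !dDr !d0; lra.
have B u v : d u ('i%C *: v) + d v ('i%C *: u) = 0.
  by have := di (u + v); rewrite scalerDr dDl !dDr !di; lra.
(* [A] at ('i u, v) and [B] at (u, v) give the difference and the sum of the same two numbers. *)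
have c0 u v : d u ('i%C *: v) = 0.
  by have := A ('i%C *: u) v; have := B u v; rewrite dil; lra.
have := c0 x (- ('i%C *: y)).
rewrite scalerN scalerA -expr2 sqr_i scaleN1r opprK /d => /eqP.
by rewrite subr_eq0 => /eqP.
Qed.

End FormEquality.

Section SemispectralOf.
Variables (R : realType) (H : hilbertType R).
Local Notation RT := (measurableTypeR R).
Variables (m : H -> {measure set RT -> \bar R}) (M : R).
Hypothesis mq : forall A : set RT, measurable A -> isquad (fun h => fine (m h A)).
Hypothesis mM : forall h, (m h setT <= (M * rnorm h ^+ 2)%:E)%E.

Lemma cvg_complex (u : nat -> R[i]) (l : R[i]) :
  (fun n => complex.Re (u n)) @ \oo --> complex.Re l ->
  (fun n => complex.Im (u n)) @ \oo --> complex.Im l ->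
  (u : nat -> R[i]^o) @ \oo --> (l : R[i]^o).
Proof.
move=> re im; apply/cvgrPdist_lt => e e0.
have eE : e = (complex.Re e)%:C%C.
  by move: e0; rewrite ltcE; case: e => a b /= /andP[/eqP-> _].
move: e0; rewrite eE ltcR; move: (complex.Re e) => {eE}{}e e0.
have e2 : 0 < e / 2 by rewrite divr_gt0.
move/cvgrPdist_lt : re => /(_ _ e2); move/cvgrPdist_lt : im => /(_ _ e2).
apply: filterS2 => n i1 r1; rewrite normc_normE ltcR.
have -> : l - u n = (complex.Re (l - u n))%:C%C + 'i%C * (complex.Im (l - u n))%:C%C.
  exact: complexE.
rewrite (le_lt_trans (le_normcD _ _))// normcM cReB cImB.
have -> : normc ('i%C : R[i]) = 1 by rewrite /= expr0n expr1n add0r sqrtr1.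
have nE (x : R) : normc x%:C%C = `|x| by rewrite /= expr0n addr0 sqrtr_sqr.
by rewrite mul1r !nE [ltRHS]splitr ltrD.
Qed.

(** Weak sigma-additivity off the diagonal is inherited from the diagonal: by [polar], the real part
    of (F(.)g, h) is a combination of the measures at g+h and g-h, and the imaginary part uses 'i h
    in place of h. *)
Lemma semispectral_of : exists F : semispectral H,
  forall D : set R, measurable D -> forall h, inner (F D h) h = (fine (m h D))%:C%C.
Proof.
have /choice[F FP] (D : set R) : exists S : bop H, measurable D ->
    (forall g h, rip (hsip H) (S g) h = polar (fun x => fine (m x D)) g h) /\
    forall h, inner (S h) h = (fine (m h D))%:C%C.
  have [mD|nD] := pselect (measurable D); last by exists (bop0 H) => /nD.
  have [|S SP] := quad_bop (mq mD) (M := M); last by exists S.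
  by move=> h; rewrite ger0_norm ?fine_ge0//; apply: mfam_le mM _ _ mD.
have F0 (D : set R) : measurable D -> D `<=` Rplus R -> pos_op (F D).
  by move=> mD _ h; rewrite (FP D mD).2 ler0c fine_ge0.
have Fs (A : (set R)^nat) : (forall i, measurable (A i)) -> (forall i, A i `<=` Rplus R) ->
    trivIset setT A -> forall g h : H,
    (fun n => \sum_(0 <= i < n) inner (F (A i) g) h : R[i]^o) @ \oo -->
    (inner (F (\bigcup_i A i) g) h : R[i]^o).
  move=> mA _ tA g h.
  have mU : measurable (\bigcup_i A i) by exact: bigcupT_measurable.
  have S1 x : (fun n => \sum_(0 <= i < n) fine (m x (A i))) @ \oo -->
      fine (m x (\bigcup_i A i)).
    have -> : (fun n => \sum_(0 <= i < n) fine (m x (A i))) =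
        fine \o (fun n => (\sum_(0 <= i < n) m x (A i))%E).
      apply/funext => n /=; rewrite sum_fine// => i _.
      exact: mfam_fin mM _ _ (mA i).
    apply: fine_cvg; rewrite fineK ?(mfam_fin mM)//.
    exact: measure_semi_sigma_additive.
  have S2 y : (fun n => \sum_(0 <= i < n) rip (hsip H) (F (A i) g) y) @ \oo -->
      rip (hsip H) (F (\bigcup_i A i) g) y.
    rewrite (FP _ mU).1 /polar (_ : (fun n => _) = fun n =>
      (\sum_(0 <= i < n) fine (m (g + y) (A i)) - \sum_(0 <= i < n) fine (m (g - y) (A i))) / 4).
      by apply: cvgMr_tmp; apply: cvgB; exact: S1.
    apply/funext => n; rewrite -sumrB mulr_suml; apply: eq_bigr => i _.
    by rewrite (FP _ (mA i)).1.
  have ReS n : complex.Re (\sum_(0 <= i < n) inner (F (A i) g) h) =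
      \sum_(0 <= i < n) rip (hsip H) (F (A i) g) h.
    by apply: (big_morph (@complex.Re R)) => [x y|]; rewrite ?cReD.
  have ImS n : complex.Im (\sum_(0 <= i < n) inner (F (A i) g) h) =
      \sum_(0 <= i < n) rip (hsip H) (F (A i) g) ('i%C *: h).
    rewrite (big_morph (@complex.Im R) (id1 := 0) (op1 := +%R)) => [|x y|]; rewrite ?cImD//.
    by apply: eq_bigr => i _; rewrite [in LHS]inner_rip.
  apply: cvg_complex; first by under eq_fun do rewrite ReS; exact: S2.
  under eq_fun do rewrite ImS.
  by rewrite [X in complex.Im X]inner_rip; exact: S2.
exists (Semispectral F0 Fs) => D mD h; exact: (FP D mD).2.
Qed.

End SemispectralOf.

(** * The Hausdorff moment problem *)

Section UltraLimit.
Variable R : realType.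

Definition ultra_nat : set_system nat :=
  projT1 (cid (ultraFilterLemma eventually_filter)).

Lemma ultra_natP : UltraFilter ultra_nat /\ \oo `<=` ultra_nat.
Proof. exact: (projT2 (cid (ultraFilterLemma eventually_filter))). Qed.

Global Instance ultra_nat_ultra : UltraFilter ultra_nat := ultra_natP.1.

Definition ulim (u : nat -> R) : R := lim (u @ ultra_nat).

(** Compactness of the segment gives a cluster point, and an ultrafilter converges to each of its
    cluster points. *)
Lemma cvg_ulim (u : nat -> R) (A B : R) : (forall n, A <= u n <= B) ->
  u @ ultra_nat --> ulim u.
Proof.
move=> uAB; have [p [_ pc]] : `[A, B]%classic `&` cluster (u @ ultra_nat) !=set0.
  apply: segment_compact; have : \forall n \near ultra_nat, `[A, B]%classic (u n).
    by apply: nearW => n; rewrite /= in_itv /=.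
  exact.
suff up : u @ ultra_nat --> p by rewrite /ulim (cvg_lim (@Rhausdorff R) up).
move=> V Vp; have [//|nV] := in_ultra_setVsetC (u @^-1` V) ultra_nat_ultra.
have : (u @ ultra_nat) (~` V) by [].
by move=> /pc/(_ Vp)[x []].
Qed.

Lemma ulim_unique (u : nat -> R) (l : R) : u @ \oo --> l -> u @ ultra_nat --> l.
Proof. by move=> ul V /ul; exact: ultra_natP.2. Qed.

End UltraLimit.

Section Hausdorff.
Variables (R : realType) (a : nat -> R).
Hypothesis a_ge0 : forall p, bcone p -> 0 <= moment a p.

(** The mass at the node j/(N+1) of a discrete measure approximating the sought one; [bern_tail t N]
    is then its mass on ]t, +oo[. *)
Definition bern_weight N j : R := moment a (bern R N.+1 j).

Definition bern_tail (t : R) N : R :=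
  \sum_(j < N.+2) (t < j%:R / N.+1%:R)%R%:R * bern_weight N j.

Lemma bern_weight_ge0 N j : 0 <= bern_weight N j.
Proof. by apply: a_ge0; exact: bcone_bern. Qed.

Lemma bern_weight_sum N : \sum_(j < N.+2) bern_weight N j = a 0%N.
Proof.
rewrite -linear_sum /=.
have -> : \sum_(j < N.+2) bern R N.+1 j = bernm R 0 N.+1.
  by apply: eq_bigr => j _; rewrite expr0 scale1r.
by rewrite bernm0 -(expr0 'X) momentXn.
Qed.

Lemma bern_tail_bd t N : 0 <= bern_tail t N <= a 0%N.
Proof.
rewrite -(bern_weight_sum N); apply/andP; split.
  by apply: sumr_ge0 => j _; rewrite mulr_ge0 ?bern_weight_ge0.
apply: ler_sum => j _; rewrite -[leRHS]mul1r ler_wpM2r ?bern_weight_ge0//.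
by case: (_ < _).
Qed.

(* A limit along an ultrafilter needs no extraction of a subsequence, so it is
   linear in [a] and will depend on vectors as a quadratic form. *)
Definition lim_tail t := ulim (bern_tail t).

Lemma cvg_lim_tail t : bern_tail t @ ultra_nat --> lim_tail t.
Proof. exact: cvg_ulim (bern_tail_bd t). Qed.

Lemma lim_tail_ge0 t : 0 <= lim_tail t.
Proof.
apply: (cvgr_to_ge (@cvg_lim_tail t)); apply: nearW => N.
by have /andP[] := bern_tail_bd t N.
Qed.

Lemma lim_tail_le t : lim_tail t <= a 0%N.
Proof.
apply: (cvgr_to_le (@cvg_lim_tail t)); apply: nearW => N.
by have /andP[] := bern_tail_bd t N.
Qed.

Lemma lim_tail_nincr s t : s <= t -> lim_tail t <= lim_tail s.
Proof.
move=> st; apply: (ler_cvg_to (@cvg_lim_tail t) (@cvg_lim_tail s)).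
apply: nearW => N; apply: ler_sum => j _; rewrite ler_wpM2r ?bern_weight_ge0//.
by case: (ltP t) => // /(le_lt_trans st) ->.
Qed.

Lemma lim_tail0 t : 1 <= t -> lim_tail t = 0.
Proof.
move=> t1; apply: (cvg_unique (@Rhausdorff R) (@cvg_lim_tail t)).
rewrite (_ : bern_tail t = fun=> 0); first exact: cvg_cst.
apply/funext => N; rewrite /bern_tail big1// => j _.
rewrite ltNge (le_trans _ t1) ?mul0r// ler_pdivrMr// mul1r ler_nat.
by rewrite -ltnS.
Qed.

Lemma lim_tail1 t : t < 0 -> lim_tail t = a 0%N.
Proof.
move=> t0; apply: (cvg_unique (@Rhausdorff R) (@cvg_lim_tail t)).
rewrite (_ : bern_tail t = fun=> a 0%N); first exact: cvg_cst.
apply/funext => N; rewrite -(bern_weight_sum N); apply: eq_bigr => j _.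
by rewrite (lt_le_trans t0) ?mul1r// divr_ge0.
Qed.

(** A Helly-type limit such as [lim_tail] is monotone but may fail to be right-continuous. Its right
    limit is not, and stays within the bounds [tail_le] and [le_tail]. *)
Definition tail t := limn (fun m => lim_tail (t + m.+1%:R^-1)).

Lemma cvg_tail t : (fun m => lim_tail (t + m.+1%:R^-1)) @ \oo --> tail t.
Proof.
apply: nondecreasing_is_cvgn.
  apply/nondecreasing_seqP => m; apply: lim_tail_nincr.
  by rewrite lerD2l lef_pV2 ?posrE// ler_nat.
by exists (a 0%N) => _ [m _ <-]; exact: lim_tail_le.
Qed.

Lemma tail_le t : tail t <= lim_tail t.
Proof.
apply: (cvgr_to_le (@cvg_tail t)); apply: nearW => m; apply: lim_tail_nincr.
by rewrite lerDl invr_ge0.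
Qed.

Lemma le_tail s t : s < t -> lim_tail t <= tail s.
Proof.
move=> st; apply: (cvgr_to_ge (@cvg_tail s)).
have st0 : 0 < t - s by rewrite subr_gt0.
have [N _ hN] := near_infty_natSinv_lt (PosNum st0); exists N => // m /hN /= h.
by apply: lim_tail_nincr; rewrite -lerBrDl ltW.
Qed.

Lemma tail_nincr s t : s <= t -> tail t <= tail s.
Proof.
rewrite le_eqVlt => /predU1P[->//|st].
exact: le_trans (tail_le t) (le_tail st).
Qed.

Lemma tail0 t : 1 <= t -> tail t = 0.
Proof.
move=> t1; apply/eqP; rewrite eq_le -{1}(lim_tail0 t1) tail_le /=.
have t2 : 1 <= t + 1 by rewrite (le_trans t1)// lerDl.
by rewrite -(lim_tail0 t2) le_tail// ltrDl.
Qed.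

Lemma tail1 t : t < 0 -> tail t = a 0%N.
Proof.
move=> t0; apply/eqP; rewrite eq_le -{1}(lim_tail1 t0) tail_le /=.
have t2 : t / 2 < 0 by lra.
by rewrite -(lim_tail1 t2) le_tail//; lra.
Qed.

(** A distribution function up to an additive constant, which a Stieltjes measure ignores. *)
Definition hcdf t : R := - tail t.

Lemma hcdf_nd : nondecreasing hcdf.
Proof. by move=> s t st; rewrite lerN2; exact: tail_nincr. Qed.

Lemma hcdf_rc : right_continuous hcdf.
Proof.
move=> t; apply: cvgN; apply/cvgrPdist_le => e e0.
have /cvgrPdist_le/(_ _ e0)[m _ hm] := @cvg_tail t.
have {hm} hm := hm m (leqnn m).
near=> s; have ts : t < s by near: s; exact: nbhs_right_gt.
have sm : s < t + m.+1%:R^-1 by near: s; apply: nbhs_right_lt; rewrite ltrDl.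
have h1 := le_tail sm; have h2 := tail_nincr (ltW ts).
have := hm; rewrite /= !ger0_norm ?subr_ge0//; last first.
  by apply: le_tail; rewrite ltrDl.
by apply: le_trans; rewrite lerB.
Unshelve. all: by end_near. Qed.

HB.instance Definition _ := isCumulative.Build R _ R hcdf hcdf_nd hcdf_rc.

Definition hmeas := lebesgue_stieltjes_measure hcdf.
HB.instance Definition _ := Measure.on hmeas.

Lemma hmeas_oc (s t : R) : s <= t -> hmeas `]s, t]%classic = (tail s - tail t)%:E.
Proof.
move=> st; rewrite /hmeas /lebesgue_stieltjes_measure /measure_extension /=.
rewrite measurable_mu_extE /=; last exact: is_ocitv.
by rewrite wlength_itv_bnd// /hcdf opprK addrC.
Qed.

Lemma hmeasT : hmeas setT = (a 0%N)%:E.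
Proof.
pose A n : set (measurableTypeR R) := `]- n.+1%:R, n.+1%:R]%classic.
have mA n : measurable (A n) by exact: measurable_itv.
have UA : \bigcup_n A n = setT.
  rewrite -subTset => x _; exists (Num.truncn `|x|) => //=.
  rewrite /A /= in_itv /= ltrNl; apply/andP; split.
    by rewrite (le_lt_trans (ler_norm _))// normrN truncnS_gt.
  by rewrite (le_trans (ler_norm _))// ltW// truncnS_gt.
have := @nondecreasing_cvg_mu _ _ R hmeas A mA.
rewrite UA => /(_ measurableT) h.
have {h} h : hmeas \o A @ \oo --> hmeas setT.
  apply: h => m n mn; apply/subsetPset => x; rewrite /A /= !in_itv /= => /andP[x1 x2].
  apply/andP; split; first by rewrite (le_lt_trans _ x1)// lerN2 ler_nat.
  by rewrite (le_trans x2)// ler_nat.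
apply: (cvg_unique (@ereal_hausdorff R) h).
rewrite (_ : _ \o _ = fun=> (a 0%N)%:E); first exact: cvg_cst.
apply/funext => n /=; rewrite hmeas_oc; last by rewrite (@le_trans _ _ 0)// oppr_le0.
by rewrite tail1 ?oppr_lt0// tail0 ?subr0// ler1n.
Qed.

Lemma hmeas_fin (A : set (measurableTypeR R)) : measurable A -> hmeas A \is a fin_num.
Proof.
move=> mA; rewrite ge0_fin_numE// (@le_lt_trans _ _ (hmeas setT))//.
  by apply: le_measure => //; rewrite inE.
by rewrite hmeasT ltry.
Qed.

Local Notation I01 := (`[0 : R, 1]%classic : set (measurableTypeR R)).

Lemma hmeasC01 : hmeas (~` I01) = 0%E.
Proof.
(* The point 0 may carry mass, so [0,1] is approached by half-open intervals that start to the left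
   of 0. *)
pose A n : set (measurableTypeR R) := ~` `](- n.+1%:R^-1), 1]%classic.
have mA n : measurable (A n) by apply: measurableC; exact: measurable_itv.
have n0 n : (0 : R) < n.+1%:R^-1 by rewrite invr_gt0.
have A0 n : hmeas (A n) = 0%E.
  have mI : measurable (`](- n.+1%:R^-1 : R), 1]%classic : set (measurableTypeR R)).
    exact: measurable_itv.
  have I1 : hmeas `](- n.+1%:R^-1), 1]%classic = (a 0%N)%:E.
    rewrite hmeas_oc; last by have := n0 n; set e := n.+1%:R^-1; lra.
    by rewrite tail1 ?oppr_lt0// tail0// subr0.
  have := measureU hmeas mI (mA n) (setICr _).
  rewrite /= setUv hmeasT I1 -(fineK (hmeas_fin (mA n))) -EFinD => -[e].
  by congr (_%:E); lra.
have UA : \bigcup_n A n = ~` I01.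
  rewrite /A -setC_bigcap; congr (~` _); apply/seteqP; split=> x /=.
    move=> h; rewrite in_itv /=; apply/andP; split; last first.
      by have := h 0%N Logic.I; rewrite /= in_itv /= => /andP[].
    rewrite leNgt; apply/negP => x0; have x0' : 0 < - x by lra.
    have [N _ hN] := near_infty_natSinv_lt (PosNum x0').
    have := hN N (leqnn N); have := h N Logic.I; rewrite /= in_itv /= => /andP[+ _].
    by set e := N.+1%:R^-1; lra.
  rewrite in_itv /= => /andP[x0 x1] n _ /=; rewrite in_itv /= x1 andbT.
  by rewrite (lt_le_trans _ x0)// oppr_lt0.
have := @nondecreasing_cvg_mu _ _ R hmeas A mA.
rewrite UA => /(_ (measurableC (measurable_itv _))) h.
have {h} h : hmeas \o A @ \oo --> hmeas (~` I01).
  apply: h => m n mn; apply/subsetPset; apply: subsetC => x /=.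
  rewrite !in_itv /= => /andP[x1 ->]; rewrite andbT (le_lt_trans _ x1)// lerN2.
  by rewrite lef_pV2 ?posrE// ler_nat.
apply: (cvg_unique (@ereal_hausdorff R) h).
rewrite (_ : _ \o _ = fun=> 0%E); first exact: cvg_cst.
by apply/funext => n /=; exact: A0.
Qed.

Section Moment.
Variables n M : nat.
Let x (i : nat) : R := i%:R / M.+1%:R.
(** Increments of the power on the grid. Abel summation encloses y^(n+1) between the step functions
    with jumps [d i] at [x i.+1] and at [x i] ([lower], [upper]), and integrating a step function
    yields tails. *)
Let d i : R := x i.+1 ^+ n.+1 - x i ^+ n.+1.

Let x_ge0 i : 0 <= x i. Proof. by rewrite divr_ge0. Qed.

Let xS i : x i < x i.+1.
Proof. by rewrite ltr_pM2r ?invr_gt0// ltr_nat. Qed.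

Let xM : x M.+1 = 1. Proof. by rewrite /x divff. Qed.

Let x_le1 i : (i <= M.+1)%N -> x i <= 1.
Proof. by move=> iM; rewrite ler_pdivrMr// mul1r ler_nat. Qed.

Let d_ge0 i : 0 <= d i.
Proof. by rewrite subr_ge0 ler_pXn2r ?nnegrE// ltW. Qed.

Let d_le i : (i < M.+1)%N -> d i <= n.+1%:R / M.+1%:R.
Proof.
move=> iM; rewrite /d subrXX.
have -> : x i.+1 - x i = M.+1%:R^-1.
  by rewrite /x -mulrBl -natrB// subSn// subnn mul1r.
rewrite mulrC ler_pM2r ?invr_gt0//.
rewrite -[leRHS](_ : \sum_(j < n.+1) 1 = _); last by rewrite sumr_const card_ord.
apply: ler_sum => j _; rewrite mulr_ile1 ?exprn_ge0 ?exprn_ile1 ?x_le1//.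
exact: ltnW.
Qed.

Let sum_d k : \sum_(i < k) d i = x k ^+ n.+1.
Proof.
rewrite -(big_mkord xpredT d) telescope_sumr//.
by rewrite /x mul0r expr0n subr0.
Qed.

Let upper y : 0 <= y <= 1 -> y ^+ n.+1 <= \sum_(i < M.+1) d i * (x i < y)%R%:R.
Proof.
move=> /andP[y0 y1]; have : y <= x M.+1 by rewrite xM.
elim: M.+1 => [|k IH] yk.
  have -> : y = 0 by apply/eqP; rewrite eq_le y0 andbT (le_trans yk)// /x mul0r.
  by rewrite expr0n big_ord0.
rewrite big_ord_recr /=; have [yk'|ky] := leP y (x k).
  by apply: (le_trans (IH yk')); rewrite lerDl mulr_ge0.
have xk (i : 'I_k) : x i < y.
  by rewrite (le_lt_trans _ ky)// ler_pM2r ?invr_gt0// ler_nat ltnW.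
rewrite (eq_bigr (fun i : 'I_k => d i)) => [|i _]; last by rewrite xk mulr1.
by rewrite mulr1 sum_d /d addrC subrK ler_pXn2r ?nnegrE.
Qed.

Let lower y : 0 <= y -> \sum_(i < M.+1) d i * (x i.+1 < y)%R%:R <= y ^+ n.+1.
Proof.
move=> y0; elim: M.+1 => [|k IH]; first by rewrite big_ord0 exprn_ge0.
rewrite big_ord_recr /=; have [ky|yk] := ltP (x k.+1) y; last first.
  by rewrite mulr0 addr0.
have xk (i : 'I_k) : x i.+1 < y.
  by rewrite (le_lt_trans _ ky)// ler_pM2r ?invr_gt0// ler_nat ltnS ltnW.
rewrite (eq_bigr (fun i : 'I_k => d i)) => [|i _]; last by rewrite xk mulr1.
by rewrite mulr1 sum_d /d addrC subrK ler_pXn2r ?nnegrE// ltW.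
Qed.

Let up := \sum_(i < M.+1) d i * lim_tail (x i).
(** The index [i.+2] pays for [le_tail], which compares [lim_tail] with [tail] only at a strictly
    smaller point. Thus [lo] and [up] enclose both [a n.+1] and the integral. *)
Let lo := \sum_(i < M.+1) d i * lim_tail (x i.+2).

Let a_up_lo : lo <= a n.+1 <= up.
Proof.
pose I N := \sum_(j < N.+2) (j%:R / N.+1%:R) ^+ n.+1 * bern_weight N j.
have Ilim : I @ ultra_nat --> a n.+1.
  apply: ulim_unique; have := @cvg_moment_bernm R a 1 n.+1.
  rewrite mul1r momentXn; apply: cvg_trans; apply: near_eq_cvg; apply: nearW => N.
  by rewrite mul1r linear_sum /=; apply: eq_bigr => j _; rewrite linearZ.
have y01 N (j : 'I_N.+2) : 0 <= (j%:R / N.+1%:R : R) <= 1.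
  by rewrite divr_ge0//= ler_pdivrMr// mul1r ler_nat -ltnS.
have swap N (t : nat -> R) : \sum_(j < N.+2)
    (\sum_(i < M.+1) d i * (t i < j%:R / N.+1%:R)%R%:R) * bern_weight N j =
    \sum_(i < M.+1) d i * bern_tail (t i) N.
  under eq_bigr do rewrite mulr_suml; rewrite exchange_big /=.
  by apply: eq_bigr => i _; rewrite mulr_sumr; apply: eq_bigr => j _; rewrite mulrA.
have tlim (t : nat -> R) : (fun N => \sum_(i < M.+1) d i * bern_tail (t i) N) @ ultra_nat
    --> \sum_(i < M.+1) d i * lim_tail (t i).
  by apply: cvgr_sum => i; apply: cvgMl_tmp; exact: cvg_lim_tail.
apply/andP; split.
  apply: (@le_trans _ _ (\sum_(i < M.+1) d i * lim_tail (x i.+1))).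
    by apply: ler_sum => i _; rewrite ler_wpM2l// lim_tail_nincr// ltW.
  apply: (ler_cvg_to (tlim (fun i => x i.+1)) Ilim); apply: nearW => N.
  rewrite -(swap N (fun i => x i.+1)); apply: ler_sum => j _; rewrite ler_wpM2r ?bern_weight_ge0//.
  by apply: lower; have /andP[] := y01 N j.
apply: (ler_cvg_to Ilim (tlim x)); apply: nearW => N.
rewrite -(swap N x); apply: ler_sum => j _; rewrite ler_wpM2r ?bern_weight_ge0//.
exact: upper.
Qed.

(** Each [d i] is at most (n+1)/(M+1), and the differences of [lim_tail] telescope; the shift by two
    grid points makes two telescoping sums, each at most [a 0]. *)
Let up_lo : up - lo <= 2 * a 0%N * (n.+1%:R / M.+1%:R).
Proof.
have tel (s : nat -> R) : (forall i, 0 <= s i <= a 0%N) ->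
    \sum_(i < M.+1) (s i - s i.+1) <= a 0%N.
  move=> s0; rewrite (eq_bigr (fun i : 'I_M.+1 => - (s i.+1 - s i))) => [|i _]; last by rewrite opprB.
  rewrite sumrN -(big_mkord xpredT (fun i => s i.+1 - s i)) telescope_sumr//.
  by have /andP[_ h] := s0 0%N; have /andP[h' _] := s0 M.+1; lra.
have lb t : 0 <= lim_tail t <= a 0%N by rewrite lim_tail_ge0 lim_tail_le.
rewrite /up /lo -sumrB.
apply: (@le_trans _ _ (\sum_(i < M.+1) (n.+1%:R / M.+1%:R) * (lim_tail (x i) - lim_tail (x i.+2)))).
  apply: ler_sum => i _; rewrite -mulrBr ler_wpM2r ?d_le// subr_ge0.
  by apply: lim_tail_nincr; rewrite ltW// (lt_trans (xS _)).
rewrite -mulr_sumr mulrC ler_wpM2r ?divr_ge0//.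
have t1 := tel (fun i => lim_tail (x i)) (fun i => lb _).
have t2 := tel (fun i => lim_tail (x i.+1)) (fun i => lb _).
have -> : \sum_(i < M.+1) (lim_tail (x i) - lim_tail (x i.+2)) =
  \sum_(i < M.+1) (lim_tail (x i) - lim_tail (x i.+1)) +
  \sum_(i < M.+1) (lim_tail (x i.+1) - lim_tail (x i.+2)).
  by rewrite -big_split /=; apply: eq_bigr => i _; ring.
by move: t1 t2; lra.
Qed.

Let int_step (t : nat -> R) : (forall i, (i < M.+1)%N -> 0 <= t i) ->
  (\int[hmeas]_(y in I01) (\sum_(i < M.+1) d i * (t i < y)%R%:R)%:E =
   (\sum_(i < M.+1) d i * tail (t i))%:E)%E.
Proof.
move=> t0.
have E y : (\sum_(i < M.+1) d i * (t i < y)%R%:R)%:E =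
    (\sum_(i < M.+1) (d i)%:E * (\1_(`]t i, +oo[%classic) y)%:E)%E.
  rewrite -sumEFin; apply: eq_bigr => i _; rewrite EFinM indicE mem_setE in_itv /=.
  by rewrite andbT.
under eq_integral do rewrite E.
have mI i : measurable (`]t i, +oo[%classic : set (measurableTypeR R)).
  exact: measurable_itv.
have m01 : measurable I01 by exact: measurable_itv.
rewrite ge0_integral_sum//; last 2 first.
- move=> i; apply/measurable_EFinP; exact: measurable_funM.
- by move=> i y _; rewrite -EFinM lee_fin mulr_ge0.
rewrite -sumEFin; apply: eq_bigr => i _.
rewrite ge0_integralZl_EFin//; last first.
  by apply/measurable_EFinP; exact: measurable_indic.
rewrite integral_indic//= EFinM; congr (_ * _)%E.
have [t1|t1] := ltP 1 (t i).
  rewrite (_ : _ `&` _ = set0) ?measure0 ?tail0 ?ltW//.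
  rewrite -subset0 => y [] /=; rewrite !in_itv /= andbT => ty /andP[_ y1].
  by have := lt_le_trans (lt_trans t1 ty) y1; rewrite ltxx.
rewrite (_ : _ `&` _ = `]t i, 1]%classic).
  by rewrite hmeas_oc// (tail0 (lexx 1)) subr0.
apply/seteqP; split=> y /=; rewrite !in_itv /= ?andbT.
  by move=> [ty /andP[_ y1]]; rewrite ty.
move=> /andP[ty ->]; split=> //.
by rewrite andbT (le_trans (t0 i (ltn_ord i)))// ltW.
Qed.

Let J := (\int[hmeas]_(y in I01) (y ^+ n.+1)%:E)%E.

Let mpow k : measurable_fun I01 (fun y : measurableTypeR R => (y ^+ k)%:E).
Proof. by apply/measurable_EFinP; apply: measurable_funX; exact: measurable_id. Qed.

Let mstep (t : nat -> R) : measurable_fun I01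
  (fun y : measurableTypeR R => (\sum_(i < M.+1) d i * (t i < y)%R%:R)%:E).
Proof.
apply/measurable_EFinP; apply: measurable_sum => i.
apply: measurable_funM => //.
rewrite (_ : (fun y => _) = \1_(`]t i, +oo[%classic)).
  by apply: measurable_indic; exact: measurable_itv.
by apply/funext => y; rewrite indicE mem_setE in_itv /= andbT.
Qed.

Let J_le : (J <= up%:E)%E.
Proof.
apply: (@le_trans _ _ (\sum_(i < M.+1) d i * tail (x i))%:E).
  rewrite -int_step//; apply: ge0_le_integral.
  - exact: measurable_itv.
  - by move=> y /=; rewrite in_itv /= => /andP[y0 _]; rewrite lee_fin exprn_ge0.
  - exact: (@mpow n.+1).
  - exact: (@mstep x).
  - by move=> y /=; rewrite in_itv /= => y01; rewrite lee_fin upper.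
by rewrite lee_fin; apply: ler_sum => i _; rewrite ler_wpM2l// tail_le.
Qed.

Let le_J : (lo%:E <= J)%E.
Proof.
apply: (@le_trans _ _ (\sum_(i < M.+1) d i * tail (x i.+1))%:E).
  by rewrite lee_fin; apply: ler_sum => i _; rewrite ler_wpM2l// le_tail.
rewrite -(int_step (t := fun i => x i.+1))//; apply: ge0_le_integral.
- exact: measurable_itv.
- by move=> y _; rewrite lee_fin sumr_ge0// => i _; rewrite mulr_ge0.
- exact: (@mstep (fun i => x i.+1)).
- exact: (@mpow n.+1).
- by move=> y /=; rewrite in_itv /= => /andP[y0 _]; rewrite lee_fin lower.
Qed.

Lemma hmeas_moment_approx : J \is a fin_num /\
  `|fine J - a n.+1| <= 2 * a 0%N * (n.+1%:R / M.+1%:R).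
Proof.
have Jf : J \is a fin_num.
  rewrite fin_numElt (lt_le_trans _ le_J) ?ltNyr//.
  by rewrite (le_lt_trans J_le) ?ltry.
split=> //; move: J_le le_J; rewrite -(fineK Jf) !lee_fin => h1 h2.
have /andP[] := a_up_lo; have := up_lo; move: h1 h2.
move: (fine J) up lo (2 * a 0%N * _) => j u l e h1 h2 h3 h4 h5.
by rewrite ler_norml /=; apply/andP; split; lra.
Qed.

End Moment.

Lemma hmeas_moment k : (\int[hmeas]_(y in I01) (y ^+ k)%:E = (a k)%:E)%E.
Proof.
case: k => [|n].
  under eq_integral do rewrite expr0.
  rewrite integral_cst/=; last exact: measurable_itv.
  have m01 : measurable I01 by exact: measurable_itv.
  have := measureU hmeas m01 (measurableC m01) (setICr _).
  by rewrite /= setUv hmeasC01 adde0 hmeasT mul1e => <-.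
have [Jf _] := hmeas_moment_approx n 0.
rewrite -(fineK Jf); congr (_%:E).
set J := (\int[_]_(_ in _) _)%E in Jf *.
have lim : (fun M => 2 * a 0%N * n.+1%:R * M.+1%:R^-1) @ \oo --> 2 * a 0%N * n.+1%:R * 0.
  by apply: cvgMl_tmp; exact: cvg_harmonic.
have : `|fine J - a n.+1| <= 2 * a 0%N * n.+1%:R * 0.
  apply: (cvgr_to_ge lim); apply: nearW => M.
  by rewrite -mulrA; exact: (hmeas_moment_approx n M).2.
by rewrite mulr0 normr_le0 subr_eq0 => /eqP.
Qed.

End Hausdorff.

(** * The semispectral measure of the second differences *)

Section LevyMeasure.
Variables (R : realType) (H : hilbertType R) (T : bop H).
Local Notation RT := (measurableTypeR R).
Local Notation L h p := (hform (hsip H) T p h h).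
Hypothesis L_ge0 : forall i j h, 0 <= L h ('X^i * (1 - 'X) ^+ j).

Definition ddiff h n : R := L h ((1 - 'X) ^+ 2 * 'X^n).

Lemma moment_ddiff h p : moment (ddiff h) p = L h ((1 - 'X) ^+ 2 * p).
Proof.
rewrite -[in RHS](coefK p) poly_def mulr_sumr /hform linear_sum /=.
by apply: eq_bigr => i _; rewrite -scalerAr linearZ.
Qed.

Lemma moment_ddiff_ge0 h p : bcone p -> 0 <= moment (ddiff h) p.
Proof.
move=> bp; rewrite moment_ddiff; apply: hform_ge0 => //.
by apply: bconeM => //; exact: bconeY.
Qed.

Definition dmeas h := hmeas (@moment_ddiff_ge0 h).

Lemma isquad_bern_weight N j : isquad (fun h => bern_weight (ddiff h) N j).
Proof.
rewrite (_ : (fun h => _) = fun h => L h ((1 - 'X) ^+ 2 * bern R N.+1 j)).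
  exact: isquad_hform.
by apply/funext => h; exact: moment_ddiff.
Qed.

Lemma isquad_tail t : isquad (fun h => tail (ddiff h) t).
Proof.
have lt s : isquad (fun h => lim_tail (ddiff h) s).
  apply: (@isquad_cvg _ _ _ ultra_nat _ (fun N h => bern_tail (ddiff h) s N)).
    by move=> N; apply: isquad_sum => j; exact: isquad_bern_weight.
  by move=> h; exact: (@cvg_lim_tail _ _ (@moment_ddiff_ge0 h) s).
apply: (@isquad_cvg _ _ _ \oo _ (fun m h => lim_tail (ddiff h) (t + m.+1%:R^-1))).
  by move=> m; exact: lt.
by move=> h; exact: (@cvg_tail _ _ (@moment_ddiff_ge0 h) t).
Qed.

Lemma dmeasT h : dmeas h setT = (ddiff h 0)%:E.
Proof. exact: hmeasT. Qed.

Lemma ddiff0_le h : ddiff h 0 <= rnorm h ^+ 2.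
Proof.
rewrite rnormE snorm_sqr.
have -> : rip (hsip H) h h = L h 1 by rewrite /hform -(expr0 'X) momentXn.
rewrite /ddiff expr0 mulr1 -subr_ge0 /hform -linearB; apply: hform_ge0 => //.
exact: bcone_1subX.
Qed.

Lemma dmeas_le h : (dmeas h setT <= (1 * rnorm h ^+ 2)%:E)%E.
Proof. by rewrite dmeasT lee_fin mul1r ddiff0_le. Qed.

(** On half-open intervals the measure is a difference of tails. As [isquad] passes to linear
    combinations and limits, the sets with this property form a Dynkin system, and these intervals
    are a generating pi-system. *)
Lemma isquad_dmeas (D : set RT) : measurable D -> isquad (fun h => fine (dmeas h D)).
Proof.
have mT : isquad (fun h => fine (dmeas h setT)).
  rewrite (_ : (fun h => _) = ddiff^~ 0%N); last by apply/funext => h; rewrite dmeasT.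
  exact: isquad_hform.
have fin h (A : set RT) : measurable A -> dmeas h A \is a fin_num by exact: hmeas_fin.
pose G : set (set RT) := [set A | exists x, A = `]x.1, x.2]%classic].
have GE : @measurable _ RT = <<s G>>.
  rewrite /measurable /=; congr (<<s _ >>); apply/seteqP; split => A.
    by move=> [x _ <-]; exists x.
  by move=> [x ->]; exists x.
rewrite GE; apply: (@dynkin_induction _ RT G (fun A => isquad (fun h => fine (dmeas h A))) GE) => {D}.
- move=> A B [x ->] [y ->]; exists (Num.max x.1 y.1, Num.min x.2 y.2) => /=.
  apply/seteqP; split => z /=; rewrite !in_itv /= gt_max le_min.
    by move=> [/andP[-> ->] /andP[-> ->]].
  by move=> /andP[/andP[-> ->] /andP[-> ->]].
- exact: mT.
- move=> A [[s t] /= ->]; have [st|ts] := leP s t; last first.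
    rewrite set_itv_ge ?bnd_simp -?leNgt ?ltW//.
    rewrite (_ : (fun h => _) = fun=> 0); first exact: isquad_cst0.
    by apply/funext => h; exact: (congr1 fine (measure0 (dmeas h))).
  rewrite (_ : (fun h => _) = fun h => 1 * tail (ddiff h) s + (-1) * tail (ddiff h) t).
    by apply: isquadDZ; exact: isquad_tail.
  by apply/funext => h; rewrite mul1r mulN1r /dmeas hmeas_oc.
- move=> S mS qS.
  rewrite (_ : (fun h => _) = fun h => 1 * fine (dmeas h setT) + (-1) * fine (dmeas h S)).
    exact: isquadDZ.
  apply/funext => h; have e : dmeas h setT = (dmeas h S + dmeas h (~` S))%E.
    by rewrite -(setUv S); exact: (measureU (dmeas h) mS (measurableC mS) (setICr _)).
  rewrite e fineD ?fin//; last exact: measurableC.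
  by rewrite mul1r mulN1r addrC addKr.
- move=> F mF tF qF.
  apply: (@isquad_cvg _ _ _ \oo _ (fun n h => \sum_(i < n) 1 * fine (dmeas h (F i)))).
    by move=> n; apply: isquad_sum => i; exact: qF.
  move=> h; rewrite (_ : (fun n => _) = fine \o (fun n => \sum_(0 <= i < n) dmeas h (F i))%E).
    apply: fine_cvg; rewrite fineK ?fin//; last exact: bigcupT_measurable.
    apply: measure_semi_sigma_additive => //; exact: bigcupT_measurable.
  apply/funext => n /=; rewrite -sum_fine => [|i _]; last exact: fin.
  by rewrite big_mkord; apply: eq_bigr => i _; rewrite mul1r.
Qed.

Lemma quad_eq0 (S : bop H) : (forall h, inner (S h) h = 0) -> S =1 \0.
Proof.
move=> S0; apply: quad_inj => [c x y|c x y|h]; first exact: linearP.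
  by rewrite /= scaler0 addr0.
by rewrite S0 /= inner0l.
Qed.

Hypothesis ddiff0 : forall h, ddiff h @ \oo --> (0 : R).

Local Notation sing1 := ([set 1%R : R] : set RT).
Local Notation I01 := (`[0%R : R, 1%R]%classic : set RT).

(** Every power x^n equals 1 at x = 1, so the mass there is below every moment [ddiff h n], and
    these tend to 0. *)
Lemma dmeas1 h : dmeas h sing1 = 0%E.
Proof.
have m1 : measurable sing1 by exact: measurable_set1.
have le n : (dmeas h sing1 <= (ddiff h n)%:E)%E.
  rewrite -(hmeas_moment (@moment_ddiff_ge0 h)).
  have -> : dmeas h sing1 = (\int[dmeas h]_(x in I01) (\1_sing1 x)%:E)%E.
    have mI : measurable I01 by exact: measurable_itv.
    rewrite integral_indic// (_ : sing1 `&` I01 = sing1)//.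
    by apply/setIidPl => x -> /=; rewrite in_itv /= lexx ler01.
  apply: ge0_le_integral.
  - exact: measurable_itv.
  - by move=> x _; rewrite lee_fin.
  - by apply/measurable_EFinP; exact: measurable_indic.
  - by apply/measurable_EFinP; apply: measurable_funX; exact: measurable_id.
  move=> x /=; rewrite in_itv /= lee_fin indicE => /andP[x0 _].
  case: (boolP (x \in _)) => [|_]; last exact: exprn_ge0.
  by rewrite inE => ->; rewrite expr1n.
have fin : dmeas h sing1 \is a fin_num by exact: hmeas_fin.
apply/eqP; rewrite eq_le measure_ge0 andbT -(fineK fin) lee_fin.
apply: (cvgr_to_ge (@ddiff0 h)); apply: nearW => n.
by rewrite -lee_fin fineK.
Qed.

Lemma dmeas1y h : dmeas h (`[1%R : R, +oo[%classic : set RT) = 0%E.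
Proof.
have m1 : measurable sing1 by exact: measurable_set1.
have mC : measurable (~` I01) by apply: measurableC; exact: measurable_itv.
apply/eqP; rewrite eq_le measure_ge0 andbT.
apply: (@le_trans _ _ (dmeas h (sing1 `|` ~` I01))).
  apply: le_measure; rewrite ?inE; [exact: measurable_itv|exact: measurableU|].
  move=> x /=; rewrite in_itv /= andbT le_eqVlt => /predU1P[<-|x1]; first by left.
  by right => /=; rewrite in_itv /= => /andP[_]; rewrite leNgt x1.
apply: (@le_trans _ _ (dmeas h sing1 + dmeas h (~` I01))%E).
  exact: (measureU2 (dmeas h) m1 mC).
by rewrite dmeas1 (_ : dmeas h (~` I01) = 0%E) ?adde0//; exact: hmeasC01.
Qed.

Lemma levy_semispectral : exists F : semispectral H,
  [/\ F [set 1] =1 \0, F `[1, +oo[%classic =1 \0 &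
  forall h k, (\int[ssm_scalar F h]_(x in (`[0%R : R, 1%R[%classic : set RT))
    (x ^+ k)%:E = (ddiff h k)%:E)%E].
Proof.
have [F FP] := semispectral_of (m := dmeas) isquad_dmeas dmeas_le; exists F; split.
- apply: quad_eq0 => h; rewrite FP; last exact: measurable_set1.
  by congr (_%:C)%C; exact: (congr1 fine (dmeas1 h)).
- apply: quad_eq0 => h; rewrite FP; last exact: measurable_itv.
  by congr (_%:C)%C; exact: (congr1 fine (dmeas1y h)).
move=> h k; rewrite (@eq_measure_integral _ _ _ _ (dmeas h)); last first.
  move=> A mA A01; suff : ssm_scalar F h A = dmeas h A by [].
  rewrite ssm_scalarE// (_ : A `&` Rplus R = A).
    by rewrite FP//= fineK//; exact: hmeas_fin.
  by apply/setIidPl => x /A01 /=; rewrite /Rplus /= !in_itv /= => /andP[->].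
rewrite -(hmeas_moment (@moment_ddiff_ge0 h)).
have mo : measurable (`[0%R : R, 1%R[%classic : set RT) by exact: measurable_itv.
have m1 : measurable sing1 by exact: measurable_set1.
have mk (D : set RT) : measurable_fun D (fun x : RT => (x ^+ k)%:E).
  by apply/measurable_EFinP; apply: measurable_funX; exact: measurable_id.
have -> : I01 = (`[0%R : R, 1%R[%classic `|` sing1 : set RT).
  by rewrite setUitv1// bnd_simp.
rewrite ge0_integral_setU//; last 2 first.
- move=> x [/=|->]; last by rewrite expr1n lee_fin.
  by rewrite in_itv /= => /andP[x0 _]; rewrite lee_fin exprn_ge0.
- by apply/disj_set2P; rewrite -subset0 => x [] /=; rewrite in_itv /= => /andP[_ +] e; rewrite e ltxx.
rewrite [X in (_ + X)%E](null_set_integral (mu := dmeas h))//.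
  by rewrite adde0.
exact: dmeas1.
Qed.

End LevyMeasure.

(** * The two integral representations *)

Section ScalarIntegrals.
Variables (R : realType) (H : hilbertType R) (F : semispectral H).
Local Notation RT := (measurableTypeR R).
Local Notation I := (`[0%R : R, 1%R[%classic : set RT).
Local Notation RP := (Rplus R : set RT).
Local Notation nu h := (ssm_scalar F h : {measure set RT -> \bar R}).

Definition rinv (x : R) : R := (1 - x)^-1.
Definition rquo n (x : R) : R := (1 - x ^+ n) / (1 - x) ^+ 2.

Lemma measurable_I : measurable I. Proof. exact: measurable_itv. Qed.
Lemma measurable_RP : measurable RP. Proof. exact: measurable_itv. Qed.
Hint Resolve measurable_I measurable_RP : core.

Lemma measurable_rinv (D : set RT) : measurable_fun D (rinv : RT -> R).
Proof.
apply: measurable_funTS.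
have mo (A : set R) : open A -> (forall x, A x -> x != 1) ->
    measurable_fun (A : set RT) (rinv : RT -> R).
  move=> oA A1; apply: open_continuous_measurable_fun => // x; rewrite inE => Ax.
  have x1 : 1 - x != 0 by rewrite subr_eq0 eq_sym A1.
  have c : (fun y : R => 1 - y) @ x --> 1 - x.
    by apply: cvgB; [exact: cvg_cst|exact: cvg_id].
  exact: (cvgV x1 c).
have mN := mo `]-oo, 1[%classic (interval_open _ _).
have mY := mo `]1, +oo[%classic (interval_open _ _).
have -> : [set: RT] = (`]-oo, 1[%classic `|` [set 1 : R]) `|` `]1, +oo[%classic.
  apply/esym/seteqP; split=> // x _ /=; rewrite !in_itv /= andbT.
  by case: (ltgtP x 1); [left; left|right|left; right].
apply/measurable_funU; [|exact: measurable_itv|split].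
- by apply: measurableU; [exact: measurable_itv|exact: measurable_set1].
- apply/measurable_funU; [exact: measurable_itv|exact: measurable_set1|split].
    by apply: mN => // x /=; rewrite in_itv /= => x1; rewrite lt_eqF.
  exact: measurable_fun_set1.
by apply: mY => // x /=; rewrite in_itv /= andbT => x1; rewrite gt_eqF.
Qed.

Lemma measurable_rquo n (D : set RT) : measurable_fun D (rquo n : RT -> R).
Proof.
rewrite (_ : rquo n = fun x => (1 - x ^+ n) * rinv x ^+ 2).
  apply: measurable_funM; last by apply: measurable_funX; exact: measurable_rinv.
  apply: measurable_funB; first exact: measurable_cst.
  by apply: measurable_funX; exact: measurable_id.
by apply/funext => x; rewrite /rquo /rinv exprVn.
Qed.

Lemma measurable_horner p (D : set RT) : measurable_fun D (fun x : RT => p.[x : R]).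
Proof.
rewrite (_ : (fun x => _) = fun x : RT => \sum_(i < size p) p`_i * (x : R) ^+ i).
  apply: measurable_sum => i; apply: measurable_funM; first exact: measurable_cst.
  by apply: measurable_funX; exact: measurable_id.
by apply/funext => x; rewrite horner_coef.
Qed.

Lemma integrable_sumZ h (D : set RT) n (c : 'I_n -> R) (f : 'I_n -> R -> R) :
  measurable D -> (forall i, (nu h).-integrable D (EFin \o f i)) ->
  (nu h).-integrable D (EFin \o (fun x => \sum_i c i * f i x)) /\
  \int[nu h]_(x in D) (\sum_i c i * f i x) = \sum_i c i * \int[nu h]_(x in D) f i x.
Proof.
move=> mD fi; elim: n c f fi => [|n IH] c f fi.
  split.
    rewrite (_ : _ \o _ = cst 0%E); last by apply/funext => x /=; rewrite big_ord0.
    exact: integrable0.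
  rewrite big_ord0 (@eq_Rintegral _ _ _ (nu h) D (fun=> 0)).
    by rewrite /Rintegral integral0.
  by move=> x _; rewrite big_ord0.
have [I1 I2] := IH (fun i => c (lift ord0 i)) (fun i => f (lift ord0 i)) (fun i => fi _).
have Z : (nu h).-integrable D (EFin \o (fun x => c ord0 * f ord0 x)).
  exact: (integrableZl mD (c ord0) (fi ord0)).
split.
  rewrite (_ : _ \o _ = (EFin \o (fun x => c ord0 * f ord0 x)) \+
    (EFin \o (fun x => \sum_(i < n) c (lift ord0 i) * f (lift ord0 i) x))).
    exact: integrableD.
  by apply/funext => x /=; rewrite big_ord_recl EFinD.
rewrite big_ord_recl -I2 -RintegralZl// -RintegralD//.
by apply: eq_Rintegral => x _; rewrite big_ord_recl.
Qed.

Hypothesis F1y : F `[1, +oo[%classic =1 \0.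

Lemma RPDI : RP `\` `[1, +oo[%classic = I.
Proof.
apply/seteqP; split=> x /=; rewrite /Rplus /= !in_itv /= !andbT.
  by move=> [-> /negP]; rewrite -ltNge.
by move=> /andP[-> x1]; split=> //; apply/negP; rewrite -ltNge.
Qed.

Lemma nu1y h : ssm_scalar F h `[1, +oo[%classic = 0%E.
Proof.
rewrite ssm_scalarE; last exact: measurable_itv.
rewrite (_ : _ `&` _ = `[1, +oo[%classic); first by rewrite F1y /= inner0l.
apply/setIidPl => x /=; rewrite /Rplus /= !in_itv /= !andbT; exact: le_trans.
Qed.

Lemma integrable_RP h (f : RT -> R) : measurable_fun RP f ->
  (nu h).-integrable I (EFin \o f) -> (nu h).-integrable RP (EFin \o f) /\
  \int[nu h]_(x in RP) f x = \int[nu h]_(x in I) f x.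
Proof.
move=> mf fi; have m1 : measurable (`[1%R : R, +oo[%classic : set RT) by exact: measurable_itv.
have fi' : (nu h).-integrable RP (EFin \o f).
  apply/(negligible_integrable m1 _ _ (nu1y h)) => //; first exact/measurable_EFinP.
  by rewrite RPDI.
split=> //; rewrite /Rintegral (negligible_integral m1 _ fi' (nu1y h))//.
by rewrite RPDI.
Qed.

Lemma I_lt1 (x : R) : I x -> 0 < 1 - x.
Proof. by rewrite /= in_itv /= => /andP[_]; lra. Qed.

Lemma I_ge0 (x : R) : I x -> 0 <= x.
Proof. by rewrite /= in_itv /= => /andP[]. Qed.

Lemma rquo_ge0 n x : I x -> 0 <= rquo n x.
Proof.
move=> Ix; rewrite divr_ge0 ?sqr_ge0// subr_ge0 exprn_ile1 ?I_ge0//.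
by have := I_lt1 Ix; lra.
Qed.

Lemma rinv_ge0 x : I x -> 0 <= rinv x.
Proof. by move=> /I_lt1/ltW; rewrite invr_ge0. Qed.

(** The quotient is 1/(1-x) times a geometric sum of [n] terms in [0,1]; integrability of 1/(1-x)
    thus carries over to every [rquo n]. *)
Lemma rquo_le n x : I x -> rquo n x <= n%:R * rinv x.
Proof.
move=> Ix; have x1 := I_lt1 Ix.
have -> : rquo n x = rinv x * \sum_(i < n) x ^+ i.
  rewrite /rquo /rinv -(opprB (x ^+ n) 1) subrX1.
  by field; rewrite gt_eqF.
rewrite mulrC ler_wpM2r ?rinv_ge0// (_ : n%:R = \sum_(i < n) 1).
  by apply: ler_sum => i _; rewrite exprn_ile1 ?I_ge0//; lra.
by rewrite sumr_const card_ord.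
Qed.

(** [Qpoly R n] is the quotient by (x-1)^2 of x^n minus its tangent at 1; the induction adds a
    geometric sum at each step. *)
Lemma Qpoly_mul n : (1 - 'X) ^+ 2 * Qpoly R n = 'X^n - 1 - n%:R *: ('X - 1).
Proof.
have QS k : Qpoly R k.+1 = Qpoly R k + \sum_(j < k) 'X^j.
  rewrite /Qpoly /=; case: k => [|k]; first by rewrite !big_ord0 addr0.
  rewrite /= [LHS]big_ord_recr /= [X in _ = _ + X]big_ord_recr /= addrA -big_split /=.
  congr (_ + _).
    apply: eq_bigr => j _; rewrite -[X in _ = _ + X]scale1r -scalerDl; congr (_ *: _).
    by rewrite natr1; congr (_%:R); have := ltn_ord j; lia.
  rewrite -[RHS]scale1r; congr (_ *: _).
  by rewrite (_ : (k.+2 - k - 1)%N = 1%N)//; lia.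
elim: n => [|n IH]; first by rewrite /Qpoly big_ord0 mulr0 expr0 subrr scale0r subr0.
rewrite QS mulrDr IH expr2 -mulrA.
have -> : (1 - 'X) * \sum_(j < n) 'X^j = 1 - 'X^n :> {poly R} by rewrite one_subX.
by rewrite exprS -(natr1 n) scalerDl scale1r; ring.
Qed.

Lemma Qpoly_horner n x : I x -> (Qpoly R n).[x] = n%:R * rinv x - rquo n x.
Proof.
move=> /I_lt1 x1; have := congr1 (horner^~ x) (Qpoly_mul n).
rewrite !hornerE => e.
have x2 : (1 - x) ^+ 2 != 0 by rewrite expf_eq0 /= gt_eqF.
apply: (mulfI x2); rewrite e /rinv /rquo; field; rewrite gt_eqF//.
Qed.

Lemma Qpoly_ge0 n x : 0 <= x -> 0 <= (Qpoly R n).[x].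
Proof.
move=> x0; rewrite horner_sum sumr_ge0// => j _.
by rewrite hornerZ hornerXn mulr_ge0// exprn_ge0.
Qed.

Hypothesis rinv_int : forall h, (nu h).-integrable I (EFin \o rinv).

Lemma rquo_int h n : (nu h).-integrable I (EFin \o rquo n).
Proof.
apply: (le_integrable measurable_I _ _ (integrableZl measurable_I n%:R (rinv_int h))).
  by apply/measurable_EFinP; exact: measurable_rquo.
move=> x Ix; rewrite lee_fin /= !ger0_norm ?rquo_ge0 ?mulr_ge0 ?rinv_ge0//.
exact: rquo_le.
Qed.

Lemma Qpoly_int h n : (nu h).-integrable RP (EFin \o (fun x => (Qpoly R n).[x])) /\
  \int[nu h]_(x in RP) (Qpoly R n).[x] =
  n%:R * \int[nu h]_(x in I) rinv x - \int[nu h]_(x in I) rquo n x.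
Proof.
have Z : (nu h).-integrable I (EFin \o (fun x => n%:R * rinv x)).
  exact: (integrableZl measurable_I n%:R (rinv_int h)).
have Qi : (nu h).-integrable I (EFin \o (fun x => (Qpoly R n).[x])).
  apply: (eq_integrable measurable_I _ _ _ (integrableB measurable_I Z (rquo_int h n))).
  by move=> x; rewrite inE => Ix /=; rewrite Qpoly_horner// EFinB.
have [Qi' ->] := integrable_RP (measurable_horner (Qpoly R n) (D := RP)) Qi.
split=> //; rewrite -RintegralZl// -RintegralB//; last exact: rquo_int.
by apply: eq_Rintegral => x; rewrite inE => /Qpoly_horner.
Qed.

Lemma inner_opint_rinv h :
  inner (opint F I rinv h) h = (\int[nu h]_(x in I) rinv x)%:C%C.
Proof.
by apply: opintP => //; [exact: measurable_rinv|exact: rinv_ge0].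
Qed.

Lemma inner_opint_rquo n h :
  inner (opint F I (rquo n) h) h = (\int[nu h]_(x in I) rquo n x)%:C%C.
Proof.
apply: opintP => //; [exact: measurable_rquo|exact: rquo_ge0|].
by move=> g; exact: rquo_int.
Qed.

Lemma inner_opint_Qpoly n h : inner (opint F RP (fun x => (Qpoly R n).[x]) h) h =
  (n%:R * \int[nu h]_(x in I) rinv x - \int[nu h]_(x in I) rquo n x)%:C%C.
Proof.
rewrite -(Qpoly_int h n).2; apply: opintP => //; first exact: measurable_horner.
  by move=> x; rewrite /Rplus /= in_itv /= andbT; exact: Qpoly_ge0.
by move=> g; exact: (Qpoly_int g n).1.
Qed.

End ScalarIntegrals.

Section IterAdjoint.
Variables (R : realType) (H : hilbertType R) (T : bop H).

Lemma inner_iter_adj n h :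
  inner (iter n (adj T) (iter n T h)) h = (rnorm (iter n T h) ^+ 2)%:C%C.
Proof.
have aE x y : inner (iter n (adj T) x) y = inner x (iter n T y).
  elim: n x y => //= n IH x y; rewrite inner_conj -adjE -inner_conj IH.
  by rewrite -iterSr.
by rewrite aE inner_norm norm_rnorm -rmorphXn.
Qed.

Lemma linear_iter_adj n : linear (fun h => iter n (adj T) (iter n T h)).
Proof. by move=> c x y; rewrite !iter_linear. Qed.

Lemma linearDf (f g : H -> H) : linear f -> linear g -> linear (fun h => f h + g h).
Proof. by move=> lf lg c x y; rewrite lf lg scalerDr addrACA. Qed.

Lemma linearNf (f : H -> H) : linear f -> linear (fun h => - f h).
Proof. by move=> lf c x y; rewrite lf scalerN opprD. Qed.

Lemma linearMnf (f : H -> H) n : linear f -> linear (fun h => f h *+ n).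
Proof. by move=> lf c x y; rewrite lf mulrnDl scalerMnr. Qed.

Lemma linear_idf : linear (fun h : H => h). Proof. by []. Qed.

Lemma linear_bop (S : bop H) : linear (fun h => S h).
Proof. by move=> c x y; rewrite linearP. Qed.

Lemma innerDl (x y z : H) : inner (x + y) z = inner x z + inner y z.
Proof. exact: (sipDl (hsip H)). Qed.

Lemma innerNl (x z : H) : inner (- x) z = - inner x z.
Proof. exact: (sipNl (hsip H)). Qed.

Lemma innerMnl (x z : H) n : inner (x *+ n) z = inner x z *+ n.
Proof. by elim: n => [|n IH]; [exact: inner0l|rewrite !mulrS innerDl IH]. Qed.

End IterAdjoint.

(** * From the representation (vi) to positivity of the moments *)

Section FromIntegral.
Variables (R : realType) (H : hilbertType R) (T : bop H) (F : semispectral H).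
Local Notation RT := (measurableTypeR R).
Local Notation I := (`[0%R : R, 1%R[%classic : set RT).
Local Notation nu h := (ssm_scalar F h : {measure set RT -> \bar R}).
Local Notation L h p := (hform (hsip H) T p h h).
Hypothesis F1y : F `[1, +oo[%classic =1 \0.
Hypothesis rinv_int : forall h, (nu h).-integrable I (EFin \o rinv (R := R)).
Hypothesis powE : forall n h, iter n (adj T) (iter n T h) =
  h - opint F `[0, 1[ (fun x => (1 - x ^+ n) / (1 - x) ^+ 2) h.

Lemma sqr_rnorm_iter n h :
  rnorm (iter n T h) ^+ 2 = rnorm h ^+ 2 - \int[nu h]_(x in I) rquo n x.
Proof.
have /(congr1 (fun g => inner g h)) := powE n h.
rewrite inner_iter_adj innerDl innerNl.
rewrite [X in _ - X](inner_opint_rquo rinv_int n h) inner_norm norm_rnorm.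
by rewrite -rmorphXn -rmorphB /= => -[].
Qed.

Lemma hform_rquo p h : L h p = p.[1] * rnorm h ^+ 2 +
  \int[nu h]_(x in I) \sum_(i < size p) - p`_i * rquo i x.
Proof.
have [_ ->] := integrable_sumZ (fun i : 'I_(size p) => - p`_i)
  (measurable_itv _) (fun i : 'I_(size p) => rquo_int rinv_int h i).
rewrite L_gam /moment horner_coef mulr_suml -big_split /=; apply: eq_bigr => i _.
by rewrite sqr_rnorm_iter expr1n mulr1; ring.
Qed.

Lemma sum_rquo (p : {poly R}) (x : R) :
  \sum_(i < size p) - p`_i * rquo i x = (p.[x] - p.[1]) / (1 - x) ^+ 2.
Proof.
rewrite !horner_coef -sumrB mulr_suml; apply: eq_bigr => i _.
by rewrite /rquo expr1n; ring.
Qed.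

(** For [j = 0] the value is a squared norm. Otherwise the polynomial vanishes at 1, the boundary
    term disappears and a nonnegative integrand is left. *)
Lemma integral_hform_ge0 i j h : 0 <= L h ('X^i * (1 - 'X) ^+ j).
Proof.
case: j => [|j]; first by rewrite expr0 mulr1 L_gam momentXn sqr_ge0.
set p := _ * _; have p1 : p.[1] = 0 by rewrite /p !hornerE subrr expr0n /= mulr0.
rewrite hform_rquo p1 mul0r add0r; apply: Rintegral_ge0 => x Ix.
rewrite sum_rquo p1 subr0 divr_ge0 ?sqr_ge0// /p !hornerE.
by rewrite mulr_ge0// exprn_ge0 ?(I_ge0 Ix)// ltW// (I_lt1 Ix).
Qed.

Lemma integral_contraction : contraction_op T.
Proof.
apply/contraction_opP => h; rewrite -(@ler_pXn2r _ 2) ?nnegrE ?rnorm_ge0//.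
rewrite (sqr_rnorm_iter 1) lerBlDr lerDl; apply: Rintegral_ge0 => x.
exact: rquo_ge0.
Qed.

End FromIntegral.

Section MonotoneLimit.
Variables (R : realType).
Local Notation RT := (measurableTypeR R).
Variables (mu : {measure set RT -> \bar R}) (D : set RT) (mD : measurable D).

Lemma monotone_integrable (f : nat -> RT -> R) (g : RT -> R) (C : R) :
  measurable_fun D g -> (forall n, mu.-integrable D (EFin \o f n)) ->
  (forall n x, D x -> 0 <= f n x) ->
  (forall x, D x -> nondecreasing_seq (f ^~ x)) ->
  (forall x, D x -> f ^~ x @ \oo --> g x) ->
  (forall n, \int[mu]_(x in D) f n x <= C) ->
  mu.-integrable D (EFin \o g) /\
  (fun n => \int[mu]_(x in D) f n x) @ \oo --> \int[mu]_(x in D) g x.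
Proof.
move=> mg fi f0 fnd fg fC.
have lim : (fun n => (\int[mu]_(x in D) (f n x)%:E)%E) @ \oo -->
    (\int[mu]_(x in D) (g x)%:E)%E.
  have := @cvg_monotone_convergence _ RT R mu D mD (fun n x => (f n x)%:E).
  move=> /(_ _ _ _); rewrite (eq_integral (EFin \o g)); last first.
    move=> x; rewrite inE => Dx; apply: (cvg_lim (@ereal_hausdorff R)).
    by apply: cvg_EFin; [exact: nearW|exact: fg].
  apply.
  - by move=> n; exact: (measurable_int mu (fi n)).
  - by move=> n x Dx; rewrite lee_fin f0.
  - by move=> x Dx n k nk; rewrite lee_fin fnd.
have g0 x : D x -> 0 <= g x.
  by move=> Dx; apply: (cvgr_to_ge (fg x Dx)); apply: nearW => n; exact: f0.
have fE n : (\int[mu]_(x in D) (f n x)%:E)%E = (\int[mu]_(x in D) f n x)%:E.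
  by rewrite /Rintegral fineK//; exact: integrable_fin_num (fi n).
have gC : (\int[mu]_(x in D) (g x)%:E <= C%:E)%E.
  apply: (cvge_to_le lim); apply: nearW => n; rewrite fE lee_fin; exact: fC.
have gi : mu.-integrable D (EFin \o g).
  apply/integrableP; split; first exact/measurable_EFinP.
  rewrite (eq_integral (EFin \o g)).
    by apply: le_lt_trans gC _; rewrite ltry.
  by move=> x; rewrite inE => Dx /=; rewrite ger0_norm ?g0.
split=> //; apply: fine_cvg; rewrite /Rintegral fineK; first exact: lim.
exact: integrable_fin_num gi.
Qed.

End MonotoneLimit.

(** * From positivity of the moments to the representation (v) *)

Section ToIntegral.
Variables (R : realType) (H : hilbertType R) (T : bop H) (F : semispectral H).
Local Notation RT := (measurableTypeR R).
Local Notation I := (`[0%R : R, 1%R[%classic : set RT).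
Local Notation nu h := (ssm_scalar F h : {measure set RT -> \bar R}).
Local Notation L h p := (hform (hsip H) T p h h).
Hypothesis dT : forall h, (fun n => rnorm (iter n.+1 T h) ^+ 2 - rnorm (iter n T h) ^+ 2 : R)
  @ \oo --> (0 : R).
Hypothesis L_ge0 : forall i j h, 0 <= L h ('X^i * (1 - 'X) ^+ j).

Lemma ddiff_cvg0 h : ddiff T h @ \oo --> (0 : R).
Proof.
rewrite (_ : ddiff T h = fun n => L h ('X^n * ((1 - 'X) * (1 - 'X)))).
  exact: L_cvg0.
by apply/funext => n; rewrite /ddiff mulrC expr2.
Qed.

Hypothesis F1y : F `[1, +oo[%classic =1 \0.
Hypothesis momF : forall h k, (\int[ssm_scalar F h]_(x in I) (x ^+ k)%:E = (ddiff T h k)%:E)%E.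

Lemma poly_int h p : (nu h).-integrable I (EFin \o horner p) /\
  \int[nu h]_(x in I) p.[x] = L h ((1 - 'X) ^+ 2 * p).
Proof.
have mI : measurable I by exact: measurable_itv.
have Xi (i : 'I_(size p)) : (nu h).-integrable I (EFin \o (fun x => x ^+ i)).
  apply/integrableP; split.
    by apply/measurable_EFinP; apply: measurable_funX; exact: measurable_id.
  rewrite (eq_integral (fun x : RT => (x ^+ i)%:E)).
    by rewrite momF ltry.
  by move=> x; rewrite inE => Ix /=; rewrite ger0_norm// exprn_ge0// (I_ge0 Ix).
have [I1 I2] := integrable_sumZ (fun i : 'I_(size p) => p`_i) mI Xi.
have pE : (fun x : R => \sum_(i < size p) p`_i * x ^+ i) = horner p.
  by apply/funext => x; rewrite horner_coef.
rewrite pE in I1; split=> //; rewrite -moment_ddiff.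
transitivity (\int[nu h]_(x in I) (fun x : R => \sum_(i < size p) p`_i * x ^+ i) x).
  by rewrite pE.
rewrite I2; apply: eq_bigr => i _; congr (_ * _).
by rewrite /Rintegral momF.
Qed.

(** The geometric sums s_n increase to 1/(1-x), and (1-x)^2 s_n = (1-x) - x^n (1-x). The last term
    is nonnegative under L, which bounds the integrals, and tends to 0, which identifies their
    limit. *)
Lemma rinv_int_levy h : (nu h).-integrable I (EFin \o rinv (R := R)) /\
  \int[nu h]_(x in I) rinv x = L h (1 - 'X).
Proof.
have mI : measurable I by exact: measurable_itv.
pose s n : {poly R} := \sum_(i < n) 'X^i.
have sE n : \int[nu h]_(x in I) (s n).[x] = L h (1 - 'X) - L h ('X^n * ((1 - 'X) * 1)).
  rewrite (poly_int h _).2 expr2 -mulrA -one_subX mulrC /hform -linearB /=.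
  by congr (moment _ _); ring.
have sx n (x : R) : (s n).[x] = \sum_(i < n) x ^+ i.
  by rewrite horner_sum; apply: eq_bigr => i _; rewrite hornerXn.
have [|n|n x Ix|x Ix|x Ix|n|ri rc] := @monotone_integrable R (nu h) I mI
  (fun n => horner (s n)) (@rinv R) (L h (1 - 'X)).
- exact: measurable_rinv.
- exact: (poly_int h _).1.
- by rewrite sx sumr_ge0// => i _; rewrite exprn_ge0// (I_ge0 Ix).
- apply/nondecreasing_seqP => n; rewrite !sx big_ord_recr /= lerDl.
  by rewrite exprn_ge0// (I_ge0 Ix).
- rewrite (_ : (fun n => _) = fun n => (1 - x ^+ n) * rinv x).
    rewrite -[X in _ --> X]mul1r -[X in X * _](subr0 1).
    apply: cvgMr_tmp; apply: cvgB; first exact: cvg_cst.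
    by apply: cvg_expr; rewrite ger0_norm ?(I_ge0 Ix)//; have := I_lt1 Ix; lra.
  apply/funext => n; rewrite sx /rinv -(opprB _ 1) subrX1; field.
  by rewrite gt_eqF// (I_lt1 Ix).
- rewrite sE lerBlDr lerDl; have := L_ge0 n 1 h.
  by rewrite expr1 mulr1.
split=> //; apply: (cvg_unique _ rc) => //.
have : (fun n => L h (1 - 'X) - L h ('X^n * ((1 - 'X) * 1))) @ \oo --> L h (1 - 'X) - 0.
  by apply: cvgB; [exact: cvg_cst|exact: L_cvg0].
by rewrite subr0 -(funext sE).
Qed.

Let rinv_int h : (nu h).-integrable I (EFin \o rinv (R := R)) := (rinv_int_levy h).1.

Lemma rquo_int_levy h n : \int[nu h]_(x in I) rquo n x = L h (1 - 'X^n).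
Proof.
have [Qi Qe] := poly_int h (Qpoly R n).
have := (Qpoly_int F1y rinv_int h n).2.
rewrite (integrable_RP F1y (measurable_horner _ (D := _)) Qi).2 Qe Qpoly_mul.
rewrite (rinv_int_levy h).2 /hform linearB linearZ /= !linearB /=.
set d := \int[_]_(_ in _) _; set a := moment _ 'X; lra.
Qed.

Lemma hform_powX h n : L h 'X^n = rnorm (iter n T h) ^+ 2.
Proof. by rewrite L_gam momentXn. Qed.

Lemma hform_one h : L h 1 = rnorm h ^+ 2.
Proof. by rewrite -(expr0 'X) hform_powX. Qed.

(** The functions [rquo n] increase to 1/(1-x)^2, and their integrals |h|^2 - |T^n h|^2 never exceed
    |h|^2. *)
Lemma rinv2_int h : (nu h).-integrable I (EFin \o (fun x => ((1 - x) ^+ 2)^-1)).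
Proof.
have mI : measurable I by exact: measurable_itv.
have [|n|n x Ix|x Ix|x Ix|n|//] := @monotone_integrable R (nu h) I mI (fun n => @rquo R n)
  (fun x => ((1 - x) ^+ 2)^-1) (rnorm h ^+ 2).
- rewrite (_ : (fun x => _) = fun x : RT => rinv x ^+ 2).
    by apply: measurable_funX; exact: measurable_rinv.
  by apply/funext => x; rewrite /rinv exprVn.
- exact: rquo_int.
- exact: rquo_ge0.
- apply/nondecreasing_seqP => n; rewrite /rquo ler_wpM2r ?invr_ge0 ?sqr_ge0//.
  rewrite lerB// exprS ler_piMl ?exprn_ge0 ?(I_ge0 Ix)//.
  by have := I_lt1 Ix; lra.
- rewrite /rquo -[X in _ --> X]mul1r -[X in X * _](subr0 1).
  apply: cvgMr_tmp; apply: cvgB; first exact: cvg_cst.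
  by apply: cvg_expr; rewrite ger0_norm ?(I_ge0 Ix)//; have := I_lt1 Ix; lra.
rewrite rquo_int_levy /hform linearB /= -!/(hform _ _ _ _ _) hform_one hform_powX.
by rewrite lerBlDr lerDl sqr_ge0.
Qed.

Lemma ssm0_le (A B : set R) : measurable A -> measurable B -> A `<=` B ->
  B `<=` Rplus R -> F B =1 \0 -> F A =1 \0.
Proof.
move=> mA mB AB BR FB; apply: quad_eq0 => h.
have AR : A `<=` Rplus R by exact: subset_trans BR.
rewrite inner_ssm//; congr (_%:C)%C.
have : (nu h A <= nu h B)%E by apply: le_measure => //; rewrite inE.
have -> : nu h B = 0%E.
  suff : ssm_scalar F h B = 0%E by [].
  by rewrite ssm_scalarE// (setIidl BR) FB /= inner0l.
have -> : nu h A = (complex.Re (inner (F A h) h))%:E.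
  suff : ssm_scalar F h A = (complex.Re (inner (F A h) h))%:E by [].
  by rewrite ssm_scalarE// (setIidl AR).
rewrite lee_fin => le0; apply/eqP; rewrite eq_le le0 /=.
by have := ssm_ge0 F mA AR h; rewrite lecE => /andP[].
Qed.

(** The support is closed and lies in [0,1], since ]1, +oo[ is an open [F]-null neighbourhood of
    each point beyond 1. *)
Lemma ssm_support_compact : compact (ssm_support F).
Proof.
have c01 : compact (`[0, 1]%classic : set R) by exact: segment_compact.
apply: (subclosed_compact _ c01).
- move=> x clx; split.
    have cR : closed (Rplus R) by exact: interval_closed.
    by apply: cR => A /clx[y [[yR _] Ay]]; exists y.
  move=> U [oU Ux] FU.
  have /clx[y [[_ yU] Uy]] : nbhs x U by apply: open_nbhs_nbhs.
  exact: (yU U).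

- move=> x [xR xU] /=; move: (xR); rewrite /Rplus /= !in_itv /= andbT => -> /=.
  rewrite leNgt; apply/negP => x1.
  apply: (xU `]1, +oo[%classic); first by split=> //=; rewrite in_itv /= x1.
  apply: (ssm0_le _ _ _ _ F1y).
  + by apply: measurableI; exact: measurable_itv.
  + exact: measurable_itv.
  + by move=> y [/=]; rewrite !in_itv /= !andbT => /ltW.
  + by move=> y /=; rewrite /Rplus /= !in_itv /= !andbT; exact: le_trans.
Qed.

End ToIntegral.

Section FirstDifference.
Variables (R : realType) (H : hilbertType R) (T : bop H).
Local Notation L h p := (hform (hsip H) T p h h).
Hypothesis L_ge0 : forall i j h, 0 <= L h ('X^i * (1 - 'X) ^+ j).

Lemma first_difference : exists2 B : bop H, selfadjoint B &
  forall h, inner (B h) h = (L h ('X - 1))%:C%C.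
Proof.
have [h|B [_ BE]] := quad_bop (isquad_hform (hsip H) T ('X - 1)) (M := 1).
  (* L(1-x) >= 0 and L(x) >= 0 place L(x-1) between -|h|^2 and 0, hence the bound [M := 1]. *)
  have := L_ge0 0 1 h; have := L_ge0 1 0 h.
  rewrite !expr0 !expr1 mulr1 mul1r /hform !linearB /= -!/(hform _ _ _ _ _) => X0 X1.
  by rewrite mul1r -(hform_one T) ler_norml; lra.
exists B => //; apply: quad_inj => [||h]; [exact: linear_bop..|].
rewrite inner_conj -adjE BE.
by apply: complex_eq; rewrite ?cReJ ?cImJ /= ?oppr0.
Qed.

End FirstDifference.

Section Representations.
Variables (R : realType) (H : hilbertType R) (T : bop H).
Local Notation RT := (measurableTypeR R).
Local Notation I := (`[0%R : R, 1%R[%classic : set RT).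

Lemma L1_I (F : semispectral H) (f : R -> R) h :
  L1 F f -> (ssm_scalar F h).-integrable I (EFin \o f).
Proof.
move=> /(_ h); apply: integrableS; [exact: measurable_itv|exact: measurable_itv|].
by move=> x /I_ge0 /=; rewrite /Rplus /= in_itv /= andbT.
Qed.

Lemma levy_representation : cpd_op T ->
  (forall h, (fun n => rnorm (iter n.+1 T h) ^+ 2 - rnorm (iter n T h) ^+ 2 : R)
    @ \oo --> (0 : R)) ->
  exists (B C : bop H) (F : semispectral H),
    [/\ compact (ssm_support F), selfadjoint B, pos_op C,
        F [set 1] =1 \0 &
        forall n h, iter n (adj T) (iter n T h) =
          h + B h *+ n + C h *+ (n ^ 2)%N
            + opint F (Rplus R) (fun x => (Qpoly R n).[x]) h] /\
    [/\ C =1 \0,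
        (forall h, B h + opint F `[0, 1[ (fun x => (1 - x)^-1) h = 0),
        F `[1, +oo[%classic =1 \0 &
        L1 F (fun x => ((1 - x) ^+ 2)^-1)].
Proof.
move=> cT dT; have L_ge0 := cpd_hform_mono_ge0 cT dT.
have [F [F1 F1y momF]] := levy_semispectral L_ge0 (ddiff_cvg0 dT).
have [B sB BE] := first_difference L_ge0.
have ri h := rinv_int_levy dT L_ge0 momF h.
have rint h := (ri h).1.
exists B, (bop0 H), F; split; split=> //.
- exact: ssm_support_compact.
- by move=> h; rewrite /= inner0l.
- move=> n; apply: quad_inj => [||h]; first exact: linear_iter_adj.
    apply: linearDf; last exact: linear_bop.
    apply: linearDf; last by apply: linearMnf; exact: linear_bop.
    apply: linearDf; first exact: linear_idf.
    by apply: linearMnf; exact: linear_bop.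
  rewrite inner_iter_adj !innerDl !innerMnl inner0l mul0rn addr0.
  (* On the diagonal the right-hand side becomes L(1) + n L(x-1) + n L(1-x) - L(1-x^n), which is
     L(x^n). *)
  rewrite inner_opint_Qpoly// (ri h).2 (rquo_int_levy dT L_ge0 F1y momF).
  rewrite inner_norm norm_rnorm BE -rmorphXn -rmorphMn -!rmorphD; congr (_%:C)%C.
  rewrite -mulr_natl -hform_powX -(hform_one T) /hform !linearB /=; ring.
- apply: quad_inj => [||h].
  + by apply: linearDf; exact: linear_bop.
  + by move=> c x y; rewrite scaler0 addr0.
  rewrite innerDl inner0l BE [X in _ + X](inner_opint_rinv rint) (ri h).2.
  by rewrite -rmorphD /hform -linearD /= addrC addrA subrK subrr linear0.
move=> h; apply: (integrable_RP F1y _ _).1; last exact: rinv2_int.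
rewrite (_ : (fun x => _) = fun x : RT => rinv x ^+ 2).
  by apply: measurable_funX; exact: measurable_rinv.
by apply/funext => x; rewrite /rinv exprVn.
Qed.

(** With t = 1/(1-x) one has |t| <= 1 + t^2, and the constant 1 is integrable because the scalar
    measures are finite. *)
Lemma L1_rinv (F : semispectral H) :
  L1 F (fun x => ((1 - x) ^+ 2)^-1) -> L1 F (fun x => (1 - x)^-1).
Proof.
move=> i2 h; have mR : measurable (Rplus R : set RT) by exact: measurable_itv.
have fin : (ssm_scalar F h (Rplus R) < +oo)%E.
  by rewrite ssm_scalarE ?ltry//; exact: measurable_itv.
have i1 : (ssm_scalar F h).-integrable (Rplus R) (EFin \o cst (1 : R)).
  apply/integrableP; split; first by apply/measurable_EFinP; exact: measurable_cst.
  under eq_integral do rewrite /= normr1.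
  by rewrite integral_cst// mul1e.
apply: (le_integrable mR _ _ (integrableD mR i1 (i2 h))).
  by apply/measurable_EFinP; exact: measurable_rinv.
move=> x _; rewrite lee_fin /= -!exprVn; set t := (1 - x)^-1.
rewrite [leRHS]ger0_norm ?addr_ge0 ?sqr_ge0//.
by rewrite ler_norml; have := sqr_ge0 (t - 1); have := sqr_ge0 (t + 1);
  have := sqr_ge0 t; nra.
Qed.

(** The integral of [Qpoly R n] splits into n times that of 1/(1-x) minus that of [rquo n]; the
    vanishing of D makes the first part cancel nB. *)
Lemma integral_representation (B C : bop H) (F : semispectral H) :
  (forall n h, iter n (adj T) (iter n T h) =
     h + B h *+ n + C h *+ (n ^ 2)%N
       + opint F (Rplus R) (fun x => (Qpoly R n).[x]) h) ->
  C =1 \0 -> (forall h, B h + opint F `[0, 1[ (fun x => (1 - x)^-1) h = 0) ->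
  F `[1, +oo[%classic =1 \0 -> L1 F (fun x => (1 - x)^-1) ->
  forall n h, iter n (adj T) (iter n T h) =
    h - opint F `[0, 1[ (fun x => (1 - x ^+ n) / (1 - x) ^+ 2) h.
Proof.
move=> powE C0 BE F1y i1 n.
have rint h : (ssm_scalar F h).-integrable I (EFin \o rinv (R := R)) by exact: L1_I.
apply: quad_inj => [||h]; first exact: linear_iter_adj.
  apply: linearDf; first exact: linear_idf.
  by apply: linearNf; exact: linear_bop.
rewrite powE C0 mul0rn addr0 !innerDl innerNl innerMnl inner_opint_Qpoly//.
have -> : B h = - opint F I (rinv (R := R)) h.
  by apply/eqP; rewrite -addr_eq0; apply/eqP; exact: BE.
rewrite innerNl inner_opint_rinv// [X in _ = _ - X](inner_opint_rquo rint).
rewrite -addrA; congr (_ + _); rewrite -rmorphN -rmorphMn -rmorphD -rmorphN.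
by congr (_%:C)%C; rewrite mulNrn -mulr_natl; ring.
Qed.

Lemma subnormal_of_integral (F : semispectral H) :
  F `[1, +oo[%classic =1 \0 -> L1 F (fun x => (1 - x)^-1) ->
  (forall n h, iter n (adj T) (iter n T h) =
    h - opint F `[0, 1[ (fun x => (1 - x ^+ n) / (1 - x) ^+ 2) h) ->
  subnormal T /\ contraction_op T.
Proof.
move=> F1y i1 powE.
have rint h : (ssm_scalar F h).-integrable I (EFin \o rinv (R := R)) by exact: L1_I.
split; last exact: (integral_contraction rint powE).
by apply: subnormal_of_hform => i j u; exact: (integral_hform_ge0 rint powE).
Qed.

End Representations.

Theorem theorem3p4p4 (R : realType) (H : hilbertType R) (T : bop H) :
  [<->
    (* (i) *)
    subnormal T /\ contraction_op T;
    (* (ii) *)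
    cpd_op T /\ contraction_op T;
    (* (iii) *)
    cpd_op T /\
    forall h : H, cvgn (series (fun n =>
      rnorm (iter n.+1 T h) ^+ 2 - rnorm (iter n T h) ^+ 2 : R));
    (* (iv) *)
    cpd_op T /\
    forall h : H,
      (fun n => rnorm (iter n.+1 T h) ^+ 2 - rnorm (iter n T h) ^+ 2 : R)
        @ \oo --> (0 : R);
    (* (v) *)
    exists (B C : bop H) (F : semispectral H),
      [/\ compact (ssm_support F), selfadjoint B, pos_op C,
          F [set 1] =1 \0 &
          forall n h, iter n (adj T) (iter n T h) =
            h + B h *+ n + C h *+ (n ^ 2)%N
              + opint F (Rplus R) (fun x => (Qpoly R n).[x]) h] /\
      [/\ C =1 \0,
          (forall h, B h + opint F `[0, 1[ (fun x => (1 - x)^-1) h = 0),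
          F `[1, +oo[%classic =1 \0 &
          L1 F (fun x => ((1 - x) ^+ 2)^-1)];
    (* (v), with the weaker integrability condition *)
    exists (B C : bop H) (F : semispectral H),
      [/\ compact (ssm_support F), selfadjoint B, pos_op C,
          F [set 1] =1 \0 &
          forall n h, iter n (adj T) (iter n T h) =
            h + B h *+ n + C h *+ (n ^ 2)%N
              + opint F (Rplus R) (fun x => (Qpoly R n).[x]) h] /\
      [/\ C =1 \0,
          (forall h, B h + opint F `[0, 1[ (fun x => (1 - x)^-1) h = 0),
          F `[1, +oo[%classic =1 \0 &
          L1 F (fun x => (1 - x)^-1)];
    (* (vi) *)
    exists F : semispectral H,
      [/\ F `[1, +oo[%classic =1 \0,
          L1 F (fun x => (1 - x)^-1) &
          forall n h, iter n (adj T) (iter n T h) =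
            h - opint F `[0, 1[ (fun x => (1 - x ^+ n) / (1 - x) ^+ 2) h]
  ].
Proof.
tfae.
- by move=> [/subnormal_cpd cT T1].
- by move=> [cT T1]; split=> // h; exact: contraction_cvg_series.
- by move=> [cT sT]; split=> // h; exact: (cvg_series_cvg_0 (sT h)).
- by move=> [cT dT]; exact: levy_representation.
- move=> [B [C [F [BCF [C0 D0 F1y i2]]]]].
  by exists B, C, F; split=> //; split=> //; exact: L1_rinv.
- move=> [B [C [F [[_ _ _ _ powE] [C0 D0 F1y i1]]]]].
  by exists F; split=> //; exact: integral_representation powE C0 D0 F1y i1.
- by move=> [F [F1y i1 powE]]; exact: subnormal_of_integral powE.
Qed.
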